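(* Consider the first-order autoregressive change model described in the context. There is a constant $\mathcal{K}>0$, not depending on the change point $t_0$, such that for every $t_0\ge 1$, $$\lim_{t\to\infty}\frac1t\log\frac{p_{t_0}(\bm y_{t_0},\dots,\bm y_{t_0+t-1})}{p_\infty(\bm y_{t_0},\dots,\bm y_{t_0+t-1})}=\mathcal{K}\qquad \mathbb{P}_{t_0}\text{-almost surely}.$$ Moreover, as $\gamma\to\infty$, $$\inf_{\tau:\ \mathrm{ARL}(\tau)\ge\gamma}\mathrm{WADD}(\tau)\ \ge\ \frac{\log\gamma}{\mathcal{K}}\,(1+o(1)),$$ where the infimum is over all stopping times $\tau$ with respect to $(\mathcal F_t)$ satisfying $\mathrm{ARL}(\tau)\ge\gamma$.
   Context: Model. Fix $K\ge1$, an invertible matrix $\bm A\in\mathbb{R}^{K\times K}$ with operator norm $\|\bm A\|<1$, a positive definite matrix $\bm R_\omega\in\mathbb{R}^{K\times K}$, and a Gaussian probability density $f_1$ on $\mathbb{R}^K$. Observations $\bm y_1,\bm y_2,\dots\in\mathbb{R}^K$ are taken sequentially. For a deterministic change point $t_0\in\{1,2,\dots\}$, under the probability measure $\mathbb{P}_{t_0}$: $\bm y_t=\bm\nu_t$ for $t<t_0$ and $\bm y_t=\bm x_t+\bm\nu_t$ for $t\ge t_0$, where $\bm\nu_t\sim\mathcal N(\bm 0,\bm I)$ are i.i.d.; $\bm x_{t_0}$ has density $f_1$; $\bm x_t=\bm A\bm x_{t-1}+\bm\omega_t$ for $t>t_0$ with $\bm\omega_t\sim\mathcal N(\bm 0,\bm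 R_\omega)$ i.i.d.; and $(\bm\nu_t)$, $(\bm\omega_t)$, $\bm x_{t_0}$ are mutually independent. The signal $\bm x_t$ is not observed. Under $\mathbb{P}_\infty$ (no change), $\bm y_t=\bm\nu_t$ for all $t$. Densities of the observations under $\mathbb{P}_{t_0}$ and $\mathbb{P}_\infty$ are written $p_{t_0}$ and $p_\infty$; expectations are $\mathbb{E}_{t_0}$ and $\mathbb{E}_\infty$. Criteria. $\mathcal F_t=\sigma(\bm y_1,\dots,\bm y_t)$. For a stopping time $\tau$ with respect to $(\mathcal F_t)$, $$\mathrm{WADD}(\tau)=\sup_{t_0\ge1}\operatorname{ess\,sup}\ \mathbb{E}_{t_0}\big[(\tau-t_0)^+\mid \bm y_1,\dots,\bm y_{t_0-1}\big],\qquad \mathrm{ARL}(\tau)=\mathbb{E}_\infty[\tau].$$ *)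

(* Defs.v *)
(* MathComp-Analysis *)
From HB Require Import structures.
From mathcomp Require Import all_boot all_order all_algebra.
From mathcomp Require Import all_classical all_reals all_analysis.
From mathcomp Require Import measurable_realfun ess_sup_inf.

Set Implicit Arguments.
Unset Strict Implicit.
Unset Printing Implicit Defensive.

Import Order.TTheory GRing.Theory Num.Theory.
Import numFieldNormedType.Exports.

Local Open Scope classical_set_scope.
Local Open Scope ring_scope.

Definition measure_matrix_display : measure_display -> measure_display.
Proof. exact. Qed.

Section measurable_matrix.
Context {d} {T : sigmaRingType d} {m n : nat}.

Definition g_sigma_entries : set (set 'M[T]_(m, n)) :=
  <<s \bigcup_(ij in [set: 'I_m * 'I_n])
        preimage_set_system setT (fun M : 'M[T]_(m, n) => M ij.1 ij.2)
          measurable >>.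

Let g_sigma_entries0 : g_sigma_entries set0.
Proof. exact: sigma_algebra0. Qed.

Let g_sigma_entriesC A : g_sigma_entries A -> g_sigma_entries (~` A).
Proof. exact: sigma_algebraC. Qed.

Let g_sigma_entries_bigcup (F : _^nat) : (forall i, g_sigma_entries (F i)) ->
  g_sigma_entries (\bigcup_i (F i)).
Proof. exact: sigma_algebra_bigcup. Qed.

HB.instance Definition _ := @isMeasurable.Build (measure_matrix_display d)
  'M[T]_(m, n) g_sigma_entries g_sigma_entries0 g_sigma_entriesC
  g_sigma_entries_bigcup.

End measurable_matrix.


Lemma measurable_fun_matrixP d d' (S : measurableType d') (T : measurableType d)
    m n (f : S -> 'M[T]_(m, n)) :
  (forall i j, measurable_fun setT (fun s => f s i j)) ->
  measurable_fun setT f.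
Proof.
move=> mf _ A mA; rewrite setTI.
suff : g_sigma_entries `<=` image_set_system setT f (@measurable _ S).
  by move=> /(_ A mA); rewrite /image_set_system/= setTI.
apply: smallest_sub.
  exact/sigma_algebra_image/sigma_algebra_measurable.
move=> B [[i j] _ [C mC <-]]; rewrite /image_set_system/=.
by have := mf i j measurableT C mC; rewrite !setTI.
Qed.

Lemma measurable_entry d (T : measurableType d) m n i j :
  measurable_fun setT (fun M : 'M[T]_(m, n) => M i j).
Proof.
move=> _ A mA; apply: sub_sigma_algebra; exists (i, j) => //.
by exists A => //; rewrite setTI.
Qed.


Section sigma_finite_pushforward.
Context d d' (S : measurableType d) (T : measurableType d') (R : realType).
Variables (mu : {measure set S -> \bar R}).
Hypothesis sfmu : sigma_finite setT mu.
Variables (f : S -> T) (g : T -> S).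
Hypotheses (mf : measurable_fun setT f) (mg : measurable_fun setT g).
Hypothesis fK : cancel f g.

Let map := pushforward mu f.

Let map0 : map set0 = 0%E. Proof. exact: measure0. Qed.

Let map_ge0 A : (0 <= map A)%E. Proof. exact: measure_ge0. Qed.

Let map_sigma_additive : semi_sigma_additive map.
Proof. exact: measure_semi_sigma_additive. Qed.

HB.instance Definition _ := isMeasure.Build _ _ _ map
  map0 map_ge0 map_sigma_additive.

Let map_sigma_finite : sigma_finite setT map.
Proof.
have [F FT Foo] := sfmu.
exists (fun n => g @^-1` F n).
  by rewrite -preimage_bigcup -FT preimage_setT.
move=> n; have [mF Fn] := Foo n; split.
  by rewrite -[X in measurable X]setTI; exact: mg.
rewrite /map /pushforward -comp_preimage.
by rewrite (_ : g \o f = idfun) ?preimage_id//; apply/funext.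
Qed.

HB.instance Definition _ := Measure_isSigmaFinite.Build _ _ _ map
  map_sigma_finite.

Definition sigma_finite_pushforward : {sigma_finite_measure set T -> \bar R} :=
  map.

End sigma_finite_pushforward.

Section tuple_measure.
Context d (T : measurableType d) (R : realType).

Let cons_pair n (p : T * n.-tuple T) : n.+1.-tuple T := [tuple of p.1 :: p.2].
Let uncons n (v : n.+1.-tuple T) : T * n.-tuple T :=
  (thead v, [tuple of behead v]).

Let measurable_cons_pair n : measurable_fun setT (@cons_pair n).
Proof. exact: measurable_cons. Qed.

Let measurable_uncons n : measurable_fun setT (@uncons n).
Proof.
apply: measurable_fun_pair; last exact: measurable_behead.
exact: measurable_tnth.
Qed.

Let cons_pairK n : cancel (@cons_pair n) (@uncons n).
Proof. by move=> [x v]; congr pair; apply/val_inj. Qed.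

Let product_sigma_finite d' (U : measurableType d')
    (mu : {sigma_finite_measure set T -> \bar R})
    (nu : {sigma_finite_measure set U -> \bar R}) :
  sigma_finite setT (mu \x nu)%E.
Proof.
have /sigma_finiteP[F [TF ndF Foo]] := sigma_finiteT mu.
have /sigma_finiteP[G [TG ndG Goo]] := sigma_finiteT nu.
exists (fun n => F n `*` G n).
  rewrite -setXTT TF TG predeqE => -[x y]; split.
    move=> [/= [n _ Fnx] [k _ Gky]]; exists (maxn n k) => //; split.
    - by move: x Fnx; exact/subsetPset/ndF/leq_maxl.
    - by move: y Gky; exact/subsetPset/ndG/leq_maxr.
  by move=> [n _ []/= ? ?]; split; exists n.
move=> k; have [? ?] := Foo k; have [? ?] := Goo k.
split; first exact: measurableX.
by rewrite product_measure1E// lte_mul_pinfty// ge0_fin_numE.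
Qed.

Let cons_measure (mu : {sigma_finite_measure set T -> \bar R}) n
    (nu : {sigma_finite_measure set (n.-tuple T) -> \bar R}) :
    {sigma_finite_measure set (n.+1.-tuple T) -> \bar R} :=
  @sigma_finite_pushforward _ _ (T * n.-tuple T)%type _ R (mu \x nu)%E
    (product_sigma_finite mu nu) _ _
    (@measurable_cons_pair n) (@measurable_uncons n) (@cons_pairK n).

Fixpoint tuple_measure (mu : {sigma_finite_measure set T -> \bar R}) n :
    {sigma_finite_measure set (n.-tuple T) -> \bar R} :=
  if n isn't n'.+1 then dirac ([tuple] : 0.-tuple T)
  else cons_measure mu (tuple_measure mu n').

End tuple_measure.

Section lebesgue_cV.
Context (R : realType) (K : nat).

Let col_of_tuple (v : K.-tuple (measurableTypeR R)) : 'cV[R]_K :=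
  \col_i tnth v i.

Let tuple_of_col (x : 'cV[R]_K) : K.-tuple (measurableTypeR R) :=
  [tuple x i 0 | i < K].

Let measurable_col_of_tuple : measurable_fun setT col_of_tuple.
Proof.
apply: measurable_fun_matrixP => i j.
under eq_fun do rewrite mxE.
exact: measurable_tnth.
Qed.

Let measurable_tuple_of_col : measurable_fun setT tuple_of_col.
Proof.
apply/measurable_fun_tnthP => i.
rewrite (_ : _ \o _ = fun x : 'cV[R]_K => x i 0); first exact: measurable_entry.
by apply/funext => x /=; rewrite tnth_mktuple.
Qed.

Let col_of_tupleK : cancel col_of_tuple tuple_of_col.
Proof. by move=> v; apply: eq_from_tnth => i; rewrite tnth_mktuple mxE. Qed.

Definition lebesgue_cV : {sigma_finite_measure set 'cV[R]_K -> \bar R} :=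
  sigma_finite_pushforward
    (sigma_finiteT (tuple_measure (@lebesgue_measure R) K))
    measurable_col_of_tuple measurable_tuple_of_col col_of_tupleK.

End lebesgue_cV.

Section gaussian.
Context {R : realType} {K : nat}.
Implicit Types (A S : 'M[R]_K) (m v : 'cV[R]_K).

Definition euclidean_norm v : R := Num.sqrt (\sum_i v i 0 ^+ 2).

(* The norm [`|A|] of the library is the entrywise maximum. *)
Definition operator_norm A : R :=
  sup [set euclidean_norm (A *m v) | v in [set v | euclidean_norm v <= 1]].

Definition posdefmx S : Prop :=
  S^T = S /\ forall v, v != 0 -> 0 < (v^T *m S *m v) 0 0.

Definition gaussian_pdf m S v : R :=
  (Num.sqrt ((2 * pi) ^+ K * \det S))^-1 *
  expR (- (2^-1 * ((v - m)^T *m invmx S *m (v - m)) 0 0)).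

End gaussian.

Section random_vectors.
Context d (Omega : measurableType d) (R : realType).
Variable P : probability Omega R.

Definition has_density d' (U : measurableType d') (X : Omega -> U)
    (mu : {measure set U -> \bar R}) (f : U -> R) : Prop :=
  [/\ measurable_fun setT f, forall u, 0 <= f u &
      forall B, measurable B ->
        P (X @^-1` B) = (\int[mu]_(u in B) (f u)%:E)%E].

(* Mutual independence of the family (X i) for i in D. *)
Definition mutually_independent d' (U : measurableType d') (I : eqType)
    (D : set I) (X : I -> Omega -> U) : Prop :=
  forall (s : seq I) (B : I -> set U),
    uniq s -> (forall i, i \in s -> D i) -> (forall i, measurable (B i)) ->
    P (\bigcap_(i in [set` s]) (X i @^-1` B i)) =
    (\prod_(i <- s) P (X i @^-1` B i))%E.

(* g is a version of E_P[Z | G] for a nonnegative, possibly infinite, Z. *)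
Definition is_cond_expectation (G : set_system Omega)
    (Z g : Omega -> \bar R) : Prop :=
  [/\ forall w, (0 <= g w)%E,
      forall B : set (\bar R), measurable B -> G (g @^-1` B) &
      forall C, G C -> (\int[P]_(w in C) g w = \int[P]_(w in C) Z w)%E].

(* The default value is irrelevant: a version exists whenever Z is nonnegative
   and measurable and G is a sub-sigma-algebra. *)
Definition cond_expectation (G : set_system Omega) (Z : Omega -> \bar R) :
    Omega -> \bar R :=
  xget (cst 0%E) [set g | is_cond_expectation G Z g].

End random_vectors.

(* Time indices are those of the mathematics: observations are y 1, y 2, ...,
   and the values of all processes at time 0 are ignored. *)
Section change_model.
Context d (Omega : measurableType d) (R : realType) (K : nat).
Implicit Types (P : probability Omega R).

(* The sources of randomness when the change occurs at time t0: nu t for t >= 1,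
   omega t for t > t0, and the initial signal x t0. *)
Definition noise_family (nu omega x : nat -> Omega -> 'cV[R]_K) (t0 : nat)
    (i : nat + nat + unit) : Omega -> 'cV[R]_K :=
  match i with
  | inl (inl t) => nu t
  | inl (inr t) => omega t
  | inr tt => x t0
  end.

Definition noise_index (t0 : nat) : set (nat + nat + unit) :=
  [set i | match i with
           | inl (inl t) => (1 <= t)%N
           | inl (inr t) => (t0 < t)%N
           | inr tt => True
           end].

Definition change_law (A Romega : 'M[R]_K) (m1 : 'cV[R]_K) (S1 : 'M[R]_K)
    (y : nat -> {mfun Omega >-> 'cV[R]_K}) (t0 : nat) P : Prop :=
  exists nu omega x : nat -> {mfun Omega >-> 'cV[R]_K},
  [/\ forall t, (1 <= t)%N ->
        has_density P (nu t) (lebesgue_cV R K) (gaussian_pdf 0 1%:M),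
      has_density P (x t0) (lebesgue_cV R K) (gaussian_pdf m1 S1),
      forall t, (t0 < t)%N ->
        has_density P (omega t) (lebesgue_cV R K) (gaussian_pdf 0 Romega),
      mutually_independent P (noise_index t0) (noise_family nu omega x t0) &
      \forall w \ae P,
        [/\ forall t, (1 <= t < t0)%N -> y t w = nu t w,
            forall t, (t0 <= t)%N -> y t w = x t w + nu t w &
            forall t, (t0 < t)%N -> x t w = A *m x t.-1 w + omega t w]].

Definition nochange_law (y : nat -> {mfun Omega >-> 'cV[R]_K}) P : Prop :=
  exists nu : nat -> {mfun Omega >-> 'cV[R]_K},
  [/\ forall t, (1 <= t)%N ->
        has_density P (nu t) (lebesgue_cV R K) (gaussian_pdf 0 1%:M),
      mutually_independent P [set t | (1 <= t)%N] nu &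
      \forall w \ae P, forall t, (1 <= t)%N -> y t w = nu t w].

Variable y : nat -> {mfun Omega >-> 'cV[R]_K}.

(* (y_{t0}, ..., y_{t0+t-1}) *)
Definition obs_block (t0 t : nat) (w : Omega) : t.-tuple 'cV[R]_K :=
  [tuple y (t0 + i) w | i < t].

Definition obs_filtration (t : nat) : set_system Omega :=
  <<s \bigcup_(s in [set s | (1 <= s <= t)%N])
        preimage_set_system setT (y s) measurable >>.

(* None stands for never stopping. *)
Definition stopping_time (tau : Omega -> option nat) : Prop :=
  forall t, obs_filtration t [set w | tau w = Some t].

Definition stop_value (o : option nat) : \bar R :=
  if o is Some t then (t%:R)%:E else +oo%E.

Definition detection_delay (tau : Omega -> option nat) (t0 : nat)
    (w : Omega) : \bar R :=
  maxe (stop_value (tau w) - (t0%:R)%:E)%E 0%E.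

Definition WADD (P : nat -> probability Omega R) (tau : Omega -> option nat) :
    \bar R :=
  ereal_sup [set ess_sup (P t0) (cond_expectation (P t0)
                   (obs_filtration t0.-1) (detection_delay tau t0))
            | t0 in [set t0 | (1 <= t0)%N]].

Definition ARL (Pinf : probability Omega R) (tau : Omega -> option nat) :
    \bar R :=
  (\int[Pinf]_w stop_value (tau w))%E.

End change_model.

(* Main.v *)
(** Let m j and S j be the mean and the covariance that the Kalman filter predicts
for the j-th observation after the change, and e j the innovation. Under P_t0 the
observations have the product of the Gaussian densities N(m j, S j) as density, and
they are independent of the pre-change observations.

By Markov's inequality and the Borel-Cantelli lemma, any other sequence of
predictive densities has almost surely a likelihood at most exp(o(n)) times the
true one. Small perturbations, of both signs, of the mean or the covariance of the
filter therefore yield laws of large numbers for quadratic forms in e j and for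
the cross terms between m j and e j. Since |A| < 1, the Riccati recursion is a
contraction and S j converges to some S, and H = I + A^T H A has a solution. With G
the limiting filter gain, the log-likelihood ratio then has the average limit
- ln(det S) / 2 + tr (S (I + G^T H G - S^-1)) / 2. It is positive since the density
N(0, (1 + r) I), for small r > 0, is also a competitor.

For the lower bound (Lai), ARL >= gamma forces some t0 with
P_oo(tau < t0 + m | tau >= t0) <= 2 m / gamma. Changing the measure costs a factor
exp((Kc + delta) m) outside an event of small P_t0-probability, so for
m ~ (1 - eps) ln gamma / Kc a stop before t0 + m is also unlikely under P_t0. *)

(* A strong law for the innovations would call for independence or martingale theory. Here the limit
   uses probability only through [competitor_ae]: the rest is deterministic analysis along one path,
   for any sequences [m], [e] that obey the filter recursion and the inequalities granted by the
   competitors. A competitor perturbed by s bounds s times the wanted average by its own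
   log-determinant or quadratic cost; dividing by s of either sign and letting s tend to 0 gives two
   equal bounds. Only s = 1 / (n + 1) and its negative occur, so countably many null sets suffice.
   Replacing the covariances and gains of the filter by their limits requires bounded average
   energies beforehand; the competitor with doubled covariance supplies the bound for [e j], and |A|
   < 1 carries it over to [m j].

   In the lower bound the change point t0 depends on the stopping time and on gamma, so the
   convergence of the likelihood ratio must be uniform in t0. It is, because the density of the
   block is the same for every t0 and the block is independent of the past: the estimate at t0 = 1
   serves for all. *)
Require Import Defs.
From HB Require Import structures.
From mathcomp Require Import all_boot all_order all_algebra.
From mathcomp Require Import all_classical all_reals all_analysis.
From mathcomp Require Import measurable_realfun ess_sup_inf.
From mathcomp Require Import ring lra zify.
Import Order.TTheory GRing.Theory Num.Theory.
Import numFieldNormedType.Exports.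
Local Open Scope classical_set_scope.
Local Open Scope ring_scope.

Set Implicit Arguments.
Unset Strict Implicit.
Unset Printing Implicit Defensive.

(** * Quadratic forms and matrix norms *)

Section dot_product.
Context {R : realType} {K : nat}.
Implicit Types (u v w : 'cV[R]_K) (M B : 'M[R]_K).

Definition dotv u v : R := (u^T *m v) 0 0.

Lemma dotvE u v : dotv u v = \sum_i u i 0 * v i 0.
Proof. by rewrite /dotv mxE; apply: eq_bigr => i _; rewrite mxE. Qed.

Lemma dotvC u v : dotv u v = dotv v u.
Proof. by rewrite !dotvE; apply: eq_bigr => i _; rewrite mulrC. Qed.

Lemma dotvDl u v w : dotv (u + v) w = dotv u w + dotv v w.
Proof. by rewrite /dotv raddfD/= mulmxDl mxE. Qed.

Lemma dotvDr u v w : dotv w (u + v) = dotv w u + dotv w v.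
Proof. by rewrite /dotv mulmxDr mxE. Qed.

Lemma dotvNl u v : dotv (- u) v = - dotv u v.
Proof. by rewrite /dotv raddfN/= mulNmx mxE. Qed.

Lemma dotvNr u v : dotv u (- v) = - dotv u v.
Proof. by rewrite /dotv mulmxN mxE. Qed.

Lemma dotvBl u v w : dotv (u - v) w = dotv u w - dotv v w.
Proof. by rewrite dotvDl dotvNl. Qed.

Lemma dotvBr u v w : dotv w (u - v) = dotv w u - dotv w v.
Proof. by rewrite dotvDr dotvNr. Qed.

Lemma dotvZl a u v : dotv (a *: u) v = a * dotv u v.
Proof. by rewrite /dotv linearZ/= -scalemxAl mxE. Qed.

Lemma dotvZr a u v : dotv u (a *: v) = a * dotv u v.
Proof. by rewrite dotvC dotvZl dotvC. Qed.

Lemma dot0v v : dotv 0 v = 0.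
Proof. by rewrite /dotv trmx0 mul0mx mxE. Qed.

Lemma dotv0 v : dotv v 0 = 0.
Proof. by rewrite dotvC dot0v. Qed.

Lemma dotv_mull M u v : dotv (M *m u) v = dotv u (M^T *m v).
Proof. by rewrite /dotv trmx_mul mulmxA. Qed.

Lemma dotv_mulr M u v : dotv u (M *m v) = dotv (M^T *m u) v.
Proof. by rewrite dotv_mull trmxK. Qed.

Lemma dotvv_ge0 u : 0 <= dotv u u.
Proof. by rewrite dotvE sumr_ge0// => i _; rewrite -expr2 sqr_ge0. Qed.

Lemma dotvv_eq0 u : (dotv u u == 0) = (u == 0).
Proof.
apply/eqP/eqP => [|->]; last by rewrite dot0v.
rewrite dotvE => /eqP; rewrite psumr_eq0; last first.
  by move=> i _; rewrite -expr2 sqr_ge0.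
move=> /allP h; apply/matrixP => i j; rewrite (ord1 j) mxE.
by have /(_ (mem_index_enum i)) := h i; rewrite mulf_eq0 orbb => /eqP.
Qed.

Lemma dotvv_gt0 u : u != 0 -> 0 < dotv u u.
Proof. by move=> u0; rewrite lt0r dotvv_ge0 dotvv_eq0 u0. Qed.

Definition quad M v : R := dotv v (M *m v).

Lemma quadE M v : (v^T *m M *m v) 0 0 = quad M v.
Proof. by rewrite /quad /dotv mulmxA. Qed.

Lemma quad1 v : quad 1%:M v = dotv v v.
Proof. by rewrite /quad mul1mx. Qed.

Lemma quad_scalar c v : quad c%:M v = c * dotv v v.
Proof. by rewrite /quad mul_scalar_mx dotvZr. Qed.

Lemma quadDl M B v : quad (M + B) v = quad M v + quad B v.
Proof. by rewrite /quad mulmxDl dotvDr. Qed.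

Lemma quadBl M B v : quad (M - B) v = quad M v - quad B v.
Proof. by rewrite /quad mulmxBl dotvBr. Qed.

Lemma quadZl c M v : quad (c *: M) v = c * quad M v.
Proof. by rewrite /quad -scalemxAl dotvZr. Qed.

Lemma quadD M u v : M^T = M -> quad M (u + v) = quad M u + 2 * dotv u (M *m v) + quad M v.
Proof.
move=> sM; rewrite /quad mulmxDr !dotvDr !dotvDl.
have -> : dotv v (M *m u) = dotv u (M *m v) by rewrite dotv_mulr sM dotvC.
ring.
Qed.

Lemma quadZ M c v : quad M (c *: v) = c ^+ 2 * quad M v.
Proof. by rewrite /quad -scalemxAr dotvZl dotvZr mulrA expr2. Qed.

Lemma quad_mul M B v : quad M (B *m v) = quad (B^T *m M *m B) v.
Proof. by rewrite /quad dotv_mull !mulmxA. Qed.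

Definition psdmx M : Prop := M^T = M /\ forall v, 0 <= quad M v.

Lemma posdefmxP M : posdefmx M <-> M^T = M /\ forall v, v != 0 -> 0 < quad M v.
Proof.
by split=> -[h1 h2]; split => // v v0; [rewrite -quadE|rewrite quadE]; exact: h2.
Qed.

Lemma posdef_psd M : posdefmx M -> psdmx M.
Proof.
move=> /posdefmxP[sM pM]; split => // v; have [->|/pM/ltW//] := eqVneq v 0.
by rewrite /quad dot0v.
Qed.

Lemma posdef_psdD M B : posdefmx M -> psdmx B -> posdefmx (M + B).
Proof.
move=> /posdefmxP[sM pM] [sB pB]; apply/posdefmxP; split; first by rewrite raddfD/= sM sB.
by move=> v v0; rewrite quadDl ltr_pwDl// pM.
Qed.

Lemma psd1 : psdmx 1%:M.
Proof. by split; [rewrite trmx1|move=> v; rewrite quad1 dotvv_ge0]. Qed.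

Lemma posdef1 : @posdefmx R K 1%:M.
Proof.
by apply/posdefmxP; split; [rewrite trmx1|move=> v; rewrite quad1; exact: dotvv_gt0].
Qed.

Lemma posdefZ c M : 0 < c -> posdefmx M -> posdefmx (c *: M).
Proof.
move=> c0 /posdefmxP[sM pM]; apply/posdefmxP; split; first by rewrite linearZ/= sM.
by move=> v v0; rewrite quadZl mulr_gt0// pM.
Qed.

Lemma psd_congr B M : psdmx M -> psdmx (B *m M *m B^T).
Proof.
move=> [sM pM]; split; first by rewrite !trmx_mul trmxK sM mulmxA.
by move=> v; rewrite -{1}(trmxK B) -quad_mul pM.
Qed.

Lemma posdef_unit M : posdefmx M -> M \in unitmx.
Proof.
move=> /posdefmxP[sM pM]; rewrite -row_free_unit -kermx_eq0.
apply/rowV0P => v /sub_kermxP vM0; apply/eqP; apply: contraT => v0.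
have := pM v^T; rewrite /quad -[M]sM -trmx_mul vM0 trmx0 dotv0 ltxx => -> //.
by apply: contra v0 => /eqP h; rewrite -[v]trmxK h trmx0.
Qed.

Lemma mulmxVl M v : M \in unitmx -> M *m (invmx M *m v) = v.
Proof. by move=> Mu; rewrite mulmxA mulmxV// mul1mx. Qed.

Lemma mulVmxl M v : M \in unitmx -> invmx M *m (M *m v) = v.
Proof. by move=> Mu; rewrite mulmxA mulVmx// mul1mx. Qed.

Lemma invmx_sym M : M^T = M -> (invmx M)^T = invmx M.
Proof. by move=> sM; rewrite trmx_inv sM. Qed.

Lemma posdef_inv M : posdefmx M -> posdefmx (invmx M).
Proof.
move=> pM; have uM := posdef_unit pM; case/posdefmxP : pM => sM pM.
apply/posdefmxP; split; first exact: invmx_sym.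
move=> v v0; rewrite /quad -{1}(mulmxVl v uM) dotv_mull sM; apply: pM.
by apply: contra v0 => /eqP h; rewrite -(mulmxVl v uM) h mulmx0.
Qed.

Lemma psd_CS M u v : psdmx M -> dotv u (M *m v) ^+ 2 <= quad M u * quad M v.
Proof.
move=> [sM pM].
have key (t : R) : 0 <= quad M u + 2 * t * dotv u (M *m v) + t ^+ 2 * quad M v.
  have := pM (u + t *: v); rewrite quadD// quadZ -scalemxAr dotvZr.
  by congr (_ <= _); ring.
set a := quad M u in key *; set b := dotv _ _ in key *; set c := quad M v in key *.
have c0 : 0 <= c := pM v; have a0 : 0 <= a := pM u.
have [cE|cN] := eqVneq c 0.
  have [->|bN] := eqVneq b 0; first by rewrite expr0n/= mulr_ge0.
  have := key (- (a + 1) / (2 * b)); rewrite cE mulr0 addr0.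
  have -> : a + 2 * (- (a + 1) / (2 * b)) * b = -1 by field.
  by rewrite lerNr oppr0 ler10.
have cgt : 0 < c by rewrite lt0r cN.
have := key (- b / c).
have -> : a + 2 * (- b / c) * b + (- b / c) ^+ 2 * c = (a * c - b ^+ 2) / c by field.
by rewrite pmulr_lge0 ?invr_gt0// subr_ge0.
Qed.

Lemma dotv_CS u v : dotv u v ^+ 2 <= dotv u u * dotv v v.
Proof. by have := psd_CS u v psd1; rewrite !quad1 mul1mx. Qed.

(** The squared Frobenius norm, summed over columns so that a bound on [M *m v] carries over to
    [M *m B] column by column. *)
Definition frob M : R := \sum_j dotv (col j M) (col j M).

Lemma frob_ge0 M : 0 <= frob M.
Proof. by apply: sumr_ge0 => j _; exact: dotvv_ge0. Qed.

Lemma frobE M : frob M = \sum_i \sum_j M i j ^+ 2.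
Proof.
rewrite /frob exchange_big/=; apply: eq_bigr => j _; rewrite dotvE.
by apply: eq_bigr => i _; rewrite !mxE expr2.
Qed.

Lemma frob_tr M : frob M^T = frob M.
Proof.
rewrite !frobE exchange_big/=; apply: eq_bigr => i _; apply: eq_bigr => j _.
by rewrite mxE.
Qed.

Lemma entry_frob M i j : M i j ^+ 2 <= frob M.
Proof.
rewrite frobE (bigD1 i)//= (bigD1 j)//= -addrA lerDl addr_ge0//.
  by apply: sumr_ge0 => k _; exact: sqr_ge0.
by apply: sumr_ge0 => k _; apply: sumr_ge0 => l _; exact: sqr_ge0.
Qed.

Lemma dotv_mulmx_frob M v : dotv (M *m v) (M *m v) <= frob M * dotv v v.
Proof.
rewrite -frob_tr /frob mulr_suml dotvE; apply: ler_sum => i _.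
have -> : (M *m v) i 0 = dotv (col i M^T) v.
  by rewrite dotvE mxE; apply: eq_bigr => j _; rewrite !mxE.
by rewrite -expr2 dotv_CS.
Qed.

Lemma frob_mulmx_le c M B : (forall v, dotv (M *m v) (M *m v) <= c * dotv v v) ->
  frob (M *m B) <= c * frob B.
Proof.
move=> h; rewrite /frob mulr_sumr; apply: ler_sum => j _.
by rewrite colE -mulmxA -colE h.
Qed.

(** By Cauchy-Schwarz, x ^+ 2 = <v, M M^T v> ^+ 2 is at most |v|^2 times c x, and x cancels. No
    singular values are involved. *)
Lemma normsq_trmx_le c M : 0 <= c -> (forall v, dotv (M *m v) (M *m v) <= c * dotv v v) ->
  forall v, dotv (M^T *m v) (M^T *m v) <= c * dotv v v.
Proof.
move=> c0 h v; set x := dotv (M^T *m v) _.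
have [->|x0] := eqVneq x 0; first by rewrite mulr_ge0// dotvv_ge0.
have xgt : 0 < x by rewrite lt0r x0 dotvv_ge0.
have : x ^+ 2 <= dotv v v * (c * x).
  rewrite {1}/x dotv_mull trmxK (le_trans (dotv_CS _ _))//.
  by rewrite ler_wpM2l ?dotvv_ge0 ?h.
by rewrite expr2 mulrA ler_pM2r// mulrC.
Qed.

Lemma euclidean_normE v : euclidean_norm v = Num.sqrt (dotv v v).
Proof.
by rewrite /euclidean_norm dotvE; congr Num.sqrt; apply: eq_bigr => i _; rewrite expr2.
Qed.

Lemma operator_norm_ge0_le M : 0 <= operator_norm M /\
  forall v, dotv (M *m v) (M *m v) <= operator_norm M ^+ 2 * dotv v v.
Proof.
set S := [set euclidean_norm (M *m v) | v in [set v | euclidean_norm v <= 1]].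
have hS : has_sup S.
  split; first by exists (euclidean_norm (M *m 0)); exists 0 => //=; rewrite euclidean_normE dot0v sqrtr0 ler01.
  exists (Num.sqrt (frob M)) => _ [v/= v1 <-].
  rewrite euclidean_normE ler_wsqrtr// (le_trans (dotv_mulmx_frob _ _))//.
  rewrite ler_piMr ?frob_ge0//.
  move: v1; rewrite euclidean_normE -[X in _ <= X -> _]sqrtr1 ler_sqrt//.
have ub := sup_upper_bound hS.
have n0 : 0 <= operator_norm M.
  have -> : 0 = euclidean_norm (M *m 0) by rewrite mulmx0 euclidean_normE dot0v sqrtr0.
  by apply: ub; exists 0 => //=; rewrite euclidean_normE dot0v sqrtr0 ler01.
split => // v; have [->|v0] := eqVneq v 0; first by rewrite mulmx0 !dot0v mulr0.
have vgt := dotvv_gt0 v0; set s := Num.sqrt (dotv v v).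
have sgt : 0 < s by rewrite sqrtr_gt0.
have := ub (euclidean_norm (M *m (s^-1 *: v))).
move=> /(_ _)/wrap[|h].
  exists (s^-1 *: v) => //=; rewrite euclidean_normE dotvZl dotvZr.
  rewrite -(sqr_sqrtr (ltW vgt)) -/s.
  have -> : s^-1 * (s^-1 * s ^+ 2) = 1 by field; rewrite gt_eqF.
  by rewrite sqrtr1.
move: h; rewrite euclidean_normE -scalemxAr dotvZl dotvZr -/(operator_norm M) => h.
have := ler_pM (sqrtr_ge0 _) (sqrtr_ge0 _) h h.
rewrite -!expr2 sqr_sqrtr; last by rewrite !mulr_ge0 ?dotvv_ge0 ?invr_ge0 ?ltW.
have sE : dotv v v = s ^+ 2 by rewrite sqr_sqrtr// ltW.
rewrite sE mulrA -expr2 exprVn -ler_pdivlMl ?invr_gt0 ?exprn_gt0// invrK mulrC => h'.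
by rewrite (le_trans h')// mulrC.
Qed.

End dot_product.

#[global] Hint Resolve posdef1 : core.

(** * Gaussian conditioning *)

Section schur.
Context {R : realType} {n : nat}.
Implicit Types (S : 'M[R]_(1 + n)).

(** The result of one Gaussian elimination step; it drives the inductions on the dimension for
    determinants and for Gaussian integrals. *)
Definition schur S : 'M[R]_n :=
  drsubmx S - (S 0 0)^-1 *: (dlsubmx S *m ursubmx S).

Lemma ulsubmx11 S : ulsubmx S = (S 0 0)%:M.
Proof.
by apply/matrixP => i j; rewrite !mxE !ord1 eqxx mulr1n; congr (S _ _); apply/val_inj.
Qed.

Lemma det_schur S : S 0 0 != 0 -> \det S = S 0 0 * \det (schur S).
Proof.
move=> S0; set a := S 0 0.
have : block_mx (1%:M : 'M[R]_1) 0 (- a^-1 *: dlsubmx S) 1%:M *m S =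
    block_mx a%:M (ursubmx S) 0 (schur S).
  rewrite -{2}[S]submxK mulmx_block !(mul1mx, mul0mx, addr0) ulsubmx11.
  congr block_mx; rewrite -scalemxAl.
    by rewrite mul_mx_scalar scalerA mulNr mulVf// scaleN1r addNr.
  by rewrite addrC scaleNr -/a.
move/(congr1 determinant); rewrite det_mulmx det_lblock !det1 !mul1r => ->.
by rewrite det_ublock det_scalar1.
Qed.

Lemma quad_schur S (t : 'M[R]_1) (x : 'cV[R]_n) : S^T = S -> S 0 0 != 0 ->
  quad S (col_mx t x) =
  S 0 0 * (t 0 0 + (S 0 0)^-1 * (ursubmx S *m x) 0 0) ^+ 2 + quad (schur S) x.
Proof.
move=> sS S0; set a := S 0 0; set r := ursubmx S *m x.
have mD (U V : 'M[R]_1) : (U + V) 0 0 = U 0 0 + V 0 0 by rewrite mxE.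
have mN (U : 'M[R]_1) : (- U) 0 0 = - U 0 0 by rewrite mxE.
have mZ c (U : 'M[R]_1) : (c *: U) 0 0 = c * U 0 0 by rewrite mxE.
have mM (U V : 'M[R]_1) : (U^T *m V) 0 0 = U 0 0 * V 0 0.
  by rewrite mxE big_ord1 mxE.
have rT : r^T = x^T *m dlsubmx S by rewrite /r trmx_mul trmx_ursub sS.
rewrite /quad /dotv -{1}[S]submxK mul_block_col tr_col_mx mul_row_col ulsubmx11 -/a -/r.
rewrite /schur -/a mulmxBl -scalemxAl mulmxBr -scalemxAr mul_scalar_mx.
rewrite !mulmxDr (mulmxA x^T (dlsubmx S)) -rT -(mulmxA (dlsubmx S)) -/r.
rewrite (mulmxA x^T (dlsubmx S)) -rT -scalemxAr !(mD, mN, mZ, mM).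
field; exact: S0.
Qed.

Lemma posdef_schur S : posdefmx S -> 0 < S 0 0 /\ posdefmx (schur S).
Proof.
move=> /posdefmxP[sS pS].
have S0 : 0 < S 0 0.
  have := pS (delta_mx 0 0); rewrite /quad /dotv -colE.
  have -> : (@delta_mx R (1 + n) 1 0 0)^T *m col 0 S = (S 0 0)%:M.
    by rewrite trmx_delta -rowE; apply/matrixP => i j; rewrite !ord1 !mxE eqxx.
  rewrite !mxE eqxx mulr1n => -> //.
  by apply/eqP => /matrixP/(_ 0 0)/eqP; rewrite !mxE !eqxx oner_eq0.
split => //; apply/posdefmxP; split.
  rewrite /schur raddfB/= linearZ/= trmx_mul trmx_ursub trmx_dlsub trmx_drsub.
  by rewrite sS.
move=> v v0.
have := pS (col_mx (- (S 0 0)^-1 *: (ursubmx S *m v)) v).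
rewrite quad_schur ?gt_eqF// 2!mxE mulNr addNr expr0n/= mulr0 add0r; apply.
apply: contra v0 => /eqP/(congr1 dsubmx); rewrite col_mxKd => ->.
by apply/eqP/matrixP => i j; rewrite !mxE.
Qed.

End schur.

Lemma posdef_det_gt0 (R : realType) n (S : 'M[R]_n) : posdefmx S -> 0 < \det S.
Proof.
elim: n S => [|n IH] S pS; first by rewrite det_mx00.
have [S0 /IH d0] := @posdef_schur R n S pS.
by rewrite (@det_schur R n S) ?gt_eqF// mulr_gt0.
Qed.

(** The block matrix with rows (1, -X) and (Y, 1) becomes triangular when multiplied by the same
    unipotent matrix on either side. *)
Lemma sylvester_det (R : comNzRingType) m n (X : 'M[R]_(m, n)) (Y : 'M[R]_(n, m)) :
  \det (1%:M + X *m Y) = \det (1%:M + Y *m X).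
Proof.
have h1 : block_mx 1%:M (- X) Y 1%:M *m block_mx 1%:M X 0 1%:M =
    block_mx 1%:M 0 Y (1%:M + Y *m X).
  by rewrite mulmx_block !(mul1mx, mulmx1, mulmx0, addr0) subrr addrC.
have h2 : block_mx 1%:M X 0 1%:M *m block_mx 1%:M (- X) Y 1%:M =
    block_mx (1%:M + X *m Y) 0 Y 1%:M.
  by rewrite mulmx_block !(mul1mx, mulmx1, mul0mx, add0r) addNr.
have /(congr1 determinant) := h1; have /(congr1 determinant) := h2.
by rewrite !det_mulmx !det_lblock !det_ublock !det1 !(mul1r, mulr1) => -> ->.
Qed.

Section bayes.
Context {R : realType} {K : nat}.
Variables (P Q B : 'M[R]_K).
Hypotheses (pP : posdefmx P) (pQ : posdefmx Q).

(** For x of covariance P and z = B x + noise of covariance Q, these are the covariance of z, then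
    the covariance and the gain of x given z. The filter takes B = Q = 1 to absorb an observation,
    and B = A to pass to the next state. *)
Definition marg_cov := B *m P *m B^T + Q.
Definition post_cov := invmx (invmx P + B^T *m invmx Q *m B).
Definition bayes_gain := post_cov *m B^T *m invmx Q.

Lemma marg_cov_posdef : posdefmx marg_cov.
Proof. by rewrite /marg_cov addrC; apply: posdef_psdD => //; exact/psd_congr/posdef_psd. Qed.

Lemma post_prec_posdef : posdefmx (invmx P + B^T *m invmx Q *m B).
Proof.
apply: posdef_psdD; first exact: posdef_inv.
by have := psd_congr B^T (posdef_psd (posdef_inv pQ)); rewrite trmxK.
Qed.

Lemma post_cov_posdef : posdefmx post_cov.
Proof. exact/posdef_inv/post_prec_posdef. Qed.

Let uP := posdef_unit pP.
Let uQ := posdef_unit pQ.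
Let W := B^T *m invmx Q *m B.

Lemma post_covE : post_cov + P *m W *m post_cov = P.
Proof.
have := mulmxV (posdef_unit post_prec_posdef); rewrite -/post_cov mulmxDl => /(congr1 (mulmx P)).
by rewrite mulmxDr mulmxA mulmxV// mul1mx mulmx1 mulmxA.
Qed.

(** Checked by multiplying with [marg_cov]: [post_covE] replaces P W V by P - V, where V is
    [post_cov], and the corrections cancel. *)
Lemma woodbury : invmx marg_cov =
  invmx Q - invmx Q *m B *m post_cov *m B^T *m invmx Q.
Proof.
set X := (X in _ = X); have h : marg_cov *m X = 1%:M.
  rewrite /marg_cov /X mulmxDl !mulmxBr mulmxV//.
  rewrite (mulmxA Q) (mulmxA Q) (mulmxA Q) (mulmxA Q) mulmxV// mul1mx.
  have -> : B *m P *m B^T *m (invmx Q *m B *m post_cov *m B^T *m invmx Q) =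
     B *m (P *m W *m post_cov) *m B^T *m invmx Q by rewrite /W !mulmxA.
  have -> : P *m W *m post_cov = P - post_cov by rewrite -[X in X - _]post_covE addrC addKr.
  rewrite mulmxBr !mulmxBl; set a := B *m P *m B^T *m _; set b := _ *m B^T *m invmx Q.
  by rewrite opprB [a + _]addrC subrK addrC subrK.
by rewrite -[RHS]mul1mx -(mulVmx (posdef_unit marg_cov_posdef)) -mulmxA h mulmx1.
Qed.

(** Sylvester's identity with X = B and Y = P B^T Q^-1. *)
Lemma bayes_det : \det P * \det Q = \det marg_cov * \det post_cov.
Proof.
have h1 : \det marg_cov = \det (1%:M + B *m (P *m B^T *m invmx Q)) * \det Q.
  by rewrite -det_mulmx mulmxDl mul1mx !mulmxA mulmxKV// addrC.
have h2 : \det P = \det (1%:M + (P *m B^T *m invmx Q) *m B) * \det post_cov.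
  by rewrite -det_mulmx mulmxDl mul1mx -[in LHS]post_covE /W !mulmxA.
by rewrite h1 h2 sylvester_det; ring.
Qed.

(** Completing the square in x; what is left in z is the Woodbury form of the inverse of
    [marg_cov]. *)
Lemma bayes_quad (x z : 'cV[R]_K) :
  quad (invmx P) x + quad (invmx Q) (z - B *m x) =
  quad (invmx marg_cov) z + quad (invmx post_cov) (x - bayes_gain *m z).
Proof.
have sQ : (invmx Q)^T = invmx Q by apply: invmx_sym; case: pQ.
have sV : (invmx post_cov)^T = invmx post_cov.
  by apply: invmx_sym; have [] := post_cov_posdef.
have sV' : post_cov^T = post_cov by have [] := post_cov_posdef.
have iV : invmx post_cov = invmx P + W by rewrite /post_cov invmxK.
have VG : invmx post_cov *m bayes_gain = B^T *m invmx Q.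
  by rewrite /bayes_gain !mulmxA mulVmx ?mul1mx// posdef_unit//; exact: post_cov_posdef.
rewrite quadD// [in RHS]quadD// woodbury quadBl.
have -> : quad (invmx post_cov) x = quad (invmx P) x + quad (invmx Q) (- (B *m x)).
  rewrite iV quadDl; congr (_ + _).
  by rewrite -mulmxN quad_mul /quad -/W mulmxN !dotvNr !dotvNl ?opprK.
have -> : quad (invmx post_cov) (- (bayes_gain *m z)) =
    quad (invmx Q *m B *m post_cov *m B^T *m invmx Q) z.
  rewrite /quad mulmxN dotvNl dotvNr opprK dotv_mull; congr dotv.
  by rewrite (mulmxA (invmx post_cov)) VG /bayes_gain !trmx_mul trmxK sQ sV' !mulmxA.
have -> : dotv x (invmx post_cov *m - (bayes_gain *m z)) =
    dotv z (invmx Q *m - (B *m x)).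
  rewrite !mulmxN !dotvNr (mulmxA (invmx post_cov)) VG -mulmxA dotv_mulr trmxK dotvC.
  by rewrite dotv_mull sQ.
ring.
Qed.

End bayes.

Section gaussian_algebra.
Context {R : realType} {K : nat}.
Implicit Types (P Q S B : 'M[R]_K) (m v x z : 'cV[R]_K).

Lemma gaussian_pdfE m S v : gaussian_pdf m S v =
  (Num.sqrt ((2 * pi) ^+ K * \det S))^-1 * expR (- (2^-1 * quad (invmx S) (v - m))).
Proof. by rewrite /gaussian_pdf quadE. Qed.

Lemma gaussian_peak_gt0 S : posdefmx S -> 0 < (2 * pi) ^+ K * \det S.
Proof. by move=> /posdef_det_gt0 d0; rewrite mulr_gt0// exprn_gt0// mulr_gt0// pi_gt0. Qed.

Lemma gaussian_pdf_gt0 m S v : posdefmx S -> 0 < gaussian_pdf m S v.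
Proof.
move=> pS; rewrite gaussian_pdfE mulr_gt0 ?expR_gt0// invr_gt0 sqrtr_gt0.
exact: gaussian_peak_gt0.
Qed.

Lemma gaussian_pdf_ge0 m S v : posdefmx S -> 0 <= gaussian_pdf m S v.
Proof. by move=> pS; rewrite ltW// gaussian_pdf_gt0. Qed.

Lemma ln_gaussian_pdf m S v : posdefmx S -> ln (gaussian_pdf m S v) =
  - (2^-1 * (K%:R * ln (2 * pi) + ln (\det S) + quad (invmx S) (v - m))).
Proof.
move=> pS; have d0 := posdef_det_gt0 pS; have p0 := gaussian_peak_gt0 pS.
have pp : 0 < 2 * pi :> R by rewrite mulr_gt0// pi_gt0.
rewrite gaussian_pdfE; set c := 2 * pi in p0 pp *.
have sg : 0 < Num.sqrt (c ^+ K * \det S) by rewrite sqrtr_gt0.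
have sE : ln (Num.sqrt (c ^+ K * \det S)) = 2^-1 * ln (c ^+ K * \det S).
  by rewrite -[in RHS](sqr_sqrtr (ltW p0)) lnXn// -mulr_natl; field.
have e0 := expR_gt0 (- (2^-1 * quad (invmx S) (v - m))).
rewrite lnM ?posrE ?invr_gt0// expRK lnV ?posrE// sE lnM ?posrE ?exprn_gt0//.
by rewrite lnXn// -mulr_natl; field.
Qed.

(** Pointwise Bayes rule, joint density as marginal times posterior. A hidden x can then be
    integrated out because it occurs on the right only in a probability density. *)
Lemma gaussian_bayes P Q B m x z : posdefmx P -> posdefmx Q ->
  gaussian_pdf m P x * gaussian_pdf (B *m x) Q z =
  gaussian_pdf (B *m m) (marg_cov P Q B) z *
  gaussian_pdf (m + bayes_gain P Q B *m (z - B *m m)) (post_cov P Q B) x.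
Proof.
move=> pP pQ; rewrite !gaussian_pdfE.
rewrite mulrACA [RHS]mulrACA -!expRD -!invfM -!sqrtrM ?ltW ?gaussian_peak_gt0//; last first.
  exact: marg_cov_posdef.
congr (_ * expR _).
  by rewrite mulrACA (bayes_det B)// mulrACA.
have := bayes_quad B pP pQ (x - m) (z - B *m m).
rewrite mulmxBr opprB addrA subrK opprD addrA => h.
by rewrite -!mulNr -!mulrDr h.
Qed.

End gaussian_algebra.

(** * Integration over column vectors *)

Section matrix_measurability.
Context d (T : measurableType d) (R : realType).

Lemma measurable_fun_entry m n (f : T -> 'M[R]_(m, n)) i j :
  measurable_fun setT f -> measurable_fun setT (fun s => f s i j).
Proof. by move=> mf; apply: (measurableT_comp (measurable_entry i j)). Qed.

Lemma measurable_fun_addmx m n (f g : T -> 'M[R]_(m, n)) :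
  measurable_fun setT f -> measurable_fun setT g ->
  measurable_fun setT (fun s => f s + g s).
Proof.
move=> mf mg; apply: measurable_fun_matrixP => i j; under eq_fun do rewrite mxE.
by apply: measurable_funD; exact: measurable_fun_entry.
Qed.

Lemma measurable_fun_oppmx m n (f : T -> 'M[R]_(m, n)) :
  measurable_fun setT f -> measurable_fun setT (fun s => - f s).
Proof.
move=> mf; apply: measurable_fun_matrixP => i j; under eq_fun do rewrite mxE.
by apply: measurableT_comp => //; exact: measurable_fun_entry.
Qed.

Lemma measurable_fun_submx m n (f g : T -> 'M[R]_(m, n)) :
  measurable_fun setT f -> measurable_fun setT g ->
  measurable_fun setT (fun s => f s - g s).
Proof. by move=> mf mg; apply: measurable_fun_addmx => //; exact: measurable_fun_oppmx. Qed.

Lemma measurable_fun_mulmx m n p (f : T -> 'M[R]_(m, n)) (g : T -> 'M[R]_(n, p)) :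
  measurable_fun setT f -> measurable_fun setT g ->
  measurable_fun setT (fun s => f s *m g s).
Proof.
move=> mf mg; apply: measurable_fun_matrixP => i j; under eq_fun do rewrite mxE.
by apply: measurable_sum => k; apply: measurable_funM; exact: measurable_fun_entry.
Qed.

Lemma measurable_fun_trmx m n (f : T -> 'M[R]_(m, n)) :
  measurable_fun setT f -> measurable_fun setT (fun s => (f s)^T).
Proof.
move=> mf; apply: measurable_fun_matrixP => i j; under eq_fun do rewrite mxE.
exact: measurable_fun_entry.
Qed.

Lemma measurable_gaussian_pdf K (S : 'M[R]_K) (f g : T -> 'cV[R]_K) :
  measurable_fun setT f -> measurable_fun setT g ->
  measurable_fun setT (fun s => gaussian_pdf (f s) S (g s)).
Proof.
move=> mf mg; rewrite /gaussian_pdf; apply: measurable_funM => //.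
apply: measurableT_comp => //; apply: measurableT_comp => //.
apply: measurable_funM => //; apply: measurable_fun_entry.
have mgf := measurable_fun_submx mg mf.
apply: measurable_fun_mulmx => //; apply: measurable_fun_mulmx => //.
exact: measurable_fun_trmx.
Qed.

End matrix_measurability.

Section tuple_measure_integral.
Context d (T : measurableType d) (R : realType).
Local Open Scope ereal_scope.

Lemma ge0_integral_tuple_measureS (mu : {sigma_finite_measure set T -> \bar R}) n
    (f : n.+1.-tuple T -> \bar R) :
  measurable_fun setT f -> (forall v, 0 <= f v) ->
  \int[tuple_measure mu n.+1]_v f v =
  \int[mu]_x \int[tuple_measure mu n]_v f [tuple of x :: v].
Proof.
move=> mf f0; pose c (p : T * n.-tuple T) : n.+1.-tuple T := [tuple of p.1 :: p.2].
have mc : measurable_fun setT c by exact: measurable_cons.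
transitivity (\int[pushforward (mu \x tuple_measure mu n) c]_v f v).
  by apply: eq_measure_integral.
rewrite ge0_integral_pushforward// preimage_setT.
rewrite fubini_tonelli1//; first exact: (measurableT_comp mf mc).
by move=> p /=.
Qed.

Lemma integral_tuple_measure0 (mu : {sigma_finite_measure set T -> \bar R})
    (f : 0.-tuple T -> \bar R) : measurable_fun setT f ->
  \int[tuple_measure mu 0]_v f v = f [tuple].
Proof. by move=> mf; rewrite [LHS]integral_dirac// diracT mul1e. Qed.

End tuple_measure_integral.

Section lebesgue_shift.
Context {R : realType}.
Local Open Scope ereal_scope.

Lemma lebesgue_measure_shift (a : R) (A : set R) : measurable A ->
  pushforward (@lebesgue_measure R) (fun x : measurableTypeR R => (x + a)%R : measurableTypeR R) A =
  lebesgue_measure A.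
Proof.
move=> mA; pose f := fun x : measurableTypeR R => (x + a)%R : measurableTypeR R.
have mf : measurable_fun setT f by exact: measurable_funD.
pose h := isMeasurableFun.Build _ _ _ _ f mf; pose g : {mfun _ >-> _} := HB.pack f h.
apply/esym; apply: (lebesgue_measure_unique (mu := pushforward lebesgue_measure g)) => //= _ [[x y]] _ <-.
rewrite /pushforward /=.
have -> : f @^-1` [set` `]x, y]%R] = [set` `](x - a), (y - a)]%R].
  by apply/seteqP; split=> z /=; rewrite !in_itv/= /f ltrBlDr lerBrDr.
rewrite !lebesgue_measure_itv/= !lte_fin ltrD2r.
by case: ifP => // _; rewrite -!EFinD; congr EFin; ring.
Qed.

Lemma ge0_integral_lebesgue_shift (a : R) (f : R -> \bar R) :
  measurable_fun setT f -> (forall x, 0 <= f x) ->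
  \int[lebesgue_measure]_x f (x + a)%R = \int[lebesgue_measure]_x f x.
Proof.
move=> mf f0.
transitivity (\int[pushforward (@lebesgue_measure R) (fun x : measurableTypeR R => (x + a)%R : measurableTypeR R)]_x f x).
  by rewrite ge0_integral_pushforward// ?preimage_setT//; exact: measurable_funD.
apply: (eq_measure_integral (@lebesgue_measure R)) => [|ms A mA _].
  exact: measurable_funD.
exact: lebesgue_measure_shift.
Qed.

Lemma ge0_integral_lebesgue_cV K (f : 'cV[R]_K -> \bar R) :
  measurable_fun setT f -> (forall x, 0 <= f x) ->
  \int[lebesgue_cV R K]_x f x =
  \int[tuple_measure (@lebesgue_measure R) K]_v f (\col_i tnth v i).
Proof.
move=> mf f0; pose c (v : K.-tuple (measurableTypeR R)) : 'cV[R]_K := \col_i tnth v i.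
have mc : measurable_fun setT c.
  apply: measurable_fun_matrixP => i j; under eq_fun do rewrite mxE.
  exact: measurable_tnth.
transitivity (\int[pushforward (tuple_measure (@lebesgue_measure R) K) c]_v f v).
  by apply: eq_measure_integral.
by rewrite ge0_integral_pushforward// preimage_setT.
Qed.

Lemma measurable_col_mx K d (T : measurableType d) (f : T -> R) (g : T -> 'cV[R]_K) :
  measurable_fun setT f -> measurable_fun setT g ->
  measurable_fun setT (fun s => col_mx (f s)%:M (g s) : 'cV[R]_(1 + K)).
Proof.
move=> mf mg; apply: measurable_fun_matrixP => i j.
rewrite (ord1 j); case: (split_ordP i) => k ->.
  by under eq_fun do rewrite col_mxEu (ord1 k) mxE eqxx mulr1n.
by under eq_fun do rewrite col_mxEd; exact: measurable_fun_entry.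
Qed.

Lemma ge0_integral_lebesgue_cVS K (f : 'cV[R]_(1 + K) -> \bar R) :
  measurable_fun setT f -> (forall x, 0 <= f x) ->
  \int[lebesgue_cV R (1 + K)]_x f x =
  \int[lebesgue_measure]_t \int[lebesgue_cV R K]_x f (col_mx t%:M x).
Proof.
move=> mf f0; rewrite ge0_integral_lebesgue_cV//.
have mcol n : measurable_fun setT (fun v : n.-tuple (measurableTypeR R) => (\col_i tnth v i : 'cV[R]_n)).
  apply: measurable_fun_matrixP => i j; under eq_fun do rewrite mxE.
  exact: measurable_tnth.
rewrite ge0_integral_tuple_measureS//; last exact: measurableT_comp (mcol _).
apply: eq_integral => t _; rewrite ge0_integral_lebesgue_cV//; last first.
  by apply: measurableT_comp => //; exact: measurable_col_mx.
apply: eq_integral => v _; congr f; apply/matrixP => i j.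
rewrite (ord1 j) mxE; case: (split_ordP i) => k ->.
  by rewrite col_mxEu (ord1 k) mxE eqxx mulr1n.
rewrite col_mxEd mxE; have -> : rshift 1 k = lift ord0 k by apply/val_inj.
by rewrite tnthS; congr tnth; apply/val_inj.
Qed.

End lebesgue_shift.

(** * Gaussian integrals and translation invariance *)

Section gaussian_integral.
Context {R : realType}.
Local Open Scope ereal_scope.

Lemma integral_gauss_fun_shift (a c : R) : (0 < a)%R ->
  \int[lebesgue_measure]_t (expR (- (2^-1 * (a * (t + c) ^+ 2))))%:E =
  (Num.sqrt (2 * pi / a))%:E :> \bar R.
Proof.
move=> a0; pose s := ((Num.sqrt a)^-1)%R.
have s0 : s != 0%R by rewrite gt_eqF// invr_gt0 sqrtr_gt0.
have sE : (s ^+ 2 = a^-1)%R by rewrite exprVn sqr_sqrtr// ltW.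
have peak0 := normal_peak_gt0 s0.
have peakE : (normal_peak s = (Num.sqrt (2 * pi / a))^-1)%R.
  by rewrite /normal_peak sE; congr (Num.sqrt _)^-1%R; rewrite -mulr_natl; ring.
have E t : (expR (- (2^-1 * (a * (t + c) ^+ 2))))%:E =
    (Num.sqrt (2 * pi / a))%:E * (normal_pdf (- c) s t)%:E :> \bar R.
  rewrite -EFinM normal_pdfE// peakE (mulrA (Num.sqrt _)) divff ?mul1r; last first.
    by rewrite gt_eqF// -invr_gt0 -peakE.
  rewrite /normal_fun sE opprK; congr (expR _)%:E.
  have a0' : a != 0%R by rewrite gt_eqF.
  by rewrite -mulr_natl; field.
under eq_integral do rewrite E.
rewrite ge0_integralZl//.
- by rewrite integral_normal_pdf mule1.
- by apply/measurable_EFinP; exact: measurable_normal_pdf.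
- by move=> t _; rewrite lee_fin normal_pdf_ge0.
Qed.

Lemma measurable_quad d (T : measurableType d) K (Q : 'M[R]_K) (f : T -> 'cV[R]_K) :
  measurable_fun setT f -> measurable_fun setT (fun s => quad Q (f s)).
Proof.
move=> mf; apply: measurable_fun_entry; apply: measurable_fun_mulmx.
  exact: measurable_fun_trmx.
exact: measurable_fun_mulmx.
Qed.

(** Induction on K: [quad_schur] completes the square in the first coordinate, Tonelli integrates
    that coordinate first, and the Schur complement is the form in the others. *)
Lemma integral_expR_quad K (Q : 'M[R]_K) : posdefmx Q ->
  \int[lebesgue_cV R K]_x (expR (- (2^-1 * quad Q x)))%:E =
  (Num.sqrt ((2 * pi) ^+ K / \det Q))%:E.
Proof.
elim: K Q => [|K IH] Q pQ.
  rewrite ge0_integral_lebesgue_cV//; last first.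
    by apply/measurable_EFinP; apply: measurableT_comp => //;
      apply: measurableT_comp => //; apply: measurable_funM => //; exact: measurable_quad.
  rewrite integral_tuple_measure0//.
    rewrite det_mx00 expr0 divr1 sqrtr1 [X in quad _ X](_ : _ = 0%R).
      by rewrite /quad dot0v mulr0 oppr0 expR0.
    by apply/matrixP => -[].
  apply/measurable_EFinP; apply: measurableT_comp => //;
    apply: measurableT_comp => //; apply: measurable_funM => //; apply: measurable_quad.
  apply: measurable_fun_matrixP => i j; under eq_fun do rewrite mxE.
  exact: measurable_tnth.
have [a0 pS] := @posdef_schur R K Q pQ.
have sQ : Q^T = Q by case: pQ.
set a := Q 0%R 0%R in a0.
pose r := ursubmx (Q : 'M[R]_(1 + K)).
pose g (p : measurableTypeR R * 'cV[R]_K) := (expR (- (2^-1 * (a * (p.1 + a^-1 * (r *m p.2) 0 0) ^+ 2 +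
   quad (schur (Q : 'M[R]_(1 + K))) p.2)))%R)%:E.
have mg : measurable_fun setT g.
  apply/measurable_EFinP; apply: measurableT_comp => //;
    apply: measurableT_comp => //; apply: measurable_funM => //.
  apply: measurable_funD; last exact: measurable_quad.
  apply: measurable_funM => //; apply: measurable_funX.
  apply: measurable_funD => //; apply: measurable_funM => //.
  by apply: measurable_fun_entry; exact: measurable_fun_mulmx.
rewrite (@ge0_integral_lebesgue_cVS R K)//; last first.
  by apply/measurable_EFinP; apply: measurableT_comp => //;
    apply: measurableT_comp => //; apply: measurable_funM => //; exact: measurable_quad.
transitivity (\int[lebesgue_measure]_t \int[lebesgue_cV R K]_x g (t, x)).
  apply: eq_integral => t _; apply: eq_integral => x _.
  have t00 : (t%:M : 'M[R]_1) 0%R 0%R = t by rewrite mxE eqxx mulr1n.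
  by rewrite /g (@quad_schur R K) ?gt_eqF//= t00.
rewrite (fubini_tonelli g)//; last by move=> z; rewrite lee_fin expR_ge0.
transitivity (\int[lebesgue_cV R K]_x ((Num.sqrt (2 * pi / a))%:E *
    (expR (- (2^-1 * quad (schur (Q : 'M[R]_(1 + K))) x)))%:E)).
  apply: eq_integral => x _; rewrite -(integral_gauss_fun_shift (a^-1 * (r *m x) 0 0)%R a0).
  rewrite -ge0_integralZr//; last first.
    apply/measurable_EFinP; apply: measurableT_comp => //;
    apply: measurableT_comp => //; apply: measurable_funM => //.
    by apply: measurable_funM => //; apply: measurable_funX; exact: measurable_funD.
  by apply: eq_integral => t _; rewrite -EFinM -expRD /g/= mulrDr opprD.
rewrite ge0_integralZl//; last first.
  by apply/measurable_EFinP; apply: measurableT_comp => //;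
    apply: measurableT_comp => //; apply: measurable_funM => //; exact: measurable_quad.
rewrite IH// -EFinM -sqrtrM; last by rewrite divr_ge0 ?ltW// mulr_gt0 ?pi_gt0.
rewrite (@det_schur R K Q) ?gt_eqF// -/a; congr (Num.sqrt _)%:E.
by rewrite mulrACA -exprS invfM.
Qed.

Lemma col_mx_addE K (t : R) (x : 'cV[R]_K) (b : 'cV[R]_(1 + K)) :
  (col_mx t%:M x + b = col_mx (t + b 0 0)%:M (x + dsubmx b))%R.
Proof.
rewrite -{1}[b]vsubmxK add_col_mx; congr col_mx.
apply/matrixP => i j; rewrite !ord1 !mxE eqxx !mulr1n; congr (_ + b _ _)%R.
exact/val_inj.
Qed.

Lemma ge0_integral_lebesgue_cV_shift K (b : 'cV[R]_K) (f : 'cV[R]_K -> \bar R) :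
  measurable_fun setT f -> (forall x, 0 <= f x) ->
  \int[lebesgue_cV R K]_x f (x + b)%R = \int[lebesgue_cV R K]_x f x.
Proof.
elim: K b f => [|K IH]; first move=> b f mf f0.
  by apply: eq_integral => x _; congr f; apply/matrixP => -[].
change (K.+1) with (1 + K)%N => b f mf f0.
have mfb : measurable_fun setT (fun x : 'cV[R]_(1 + K) => f (x + b)%R).
  apply: measurableT_comp => //; apply: measurable_fun_addmx => //.
transitivity (\int[lebesgue_measure]_t \int[lebesgue_cV R K]_x f (col_mx t%:M x + b)%R).
  exact: (@ge0_integral_lebesgue_cVS R K (fun x => f (x + b)%R) mfb (fun x => f0 _)).
rewrite [RHS](@ge0_integral_lebesgue_cVS R K f mf f0).
set F := fun t => \int[lebesgue_cV R K]_x f (col_mx t%:M x).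
have mF : measurable_fun [set: measurableTypeR R] F.
  apply: (measurable_fun_fubini_tonelli_F (m2 := lebesgue_cV R K)
    (fun p : measurableTypeR R * 'cV[R]_K => f (col_mx p.1%:M p.2 : 'cV[R]_(1 + K)))) => //.
  by apply: measurableT_comp => //; exact: measurable_col_mx.
transitivity (\int[lebesgue_measure]_t F (t + b 0 0)%R); last first.
  by apply: (@ge0_integral_lebesgue_shift R (b 0 0)%R F mF) => t; exact: integral_ge0.
apply: eq_integral => t _; rewrite /F -[RHS](IH (dsubmx b))//; last first.
  by apply: measurableT_comp => //; exact: measurable_col_mx.
apply: eq_integral => x _; congr f.
exact: (@col_mx_addE K t x b).
Qed.

(** Turns b plus centred noise into a variable of mean b: state and observation equations become
    conditional densities. *)
Lemma ge0_integral_gaussian_shift K (S : 'M[R]_K) (b : 'cV[R]_K) (f : 'cV[R]_K -> \bar R) :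
  measurable_fun setT f -> (forall x, 0 <= f x) -> posdefmx S ->
  \int[lebesgue_cV R K]_n (f (b + n)%R * (gaussian_pdf 0 S n)%:E) =
  \int[lebesgue_cV R K]_y (f y * (gaussian_pdf b S y)%:E).
Proof.
move=> mf f0 pS.
rewrite -[RHS](ge0_integral_lebesgue_cV_shift b).
- apply: eq_integral => x _; rewrite (addrC b); congr (_ * _%:E).
  by rewrite !gaussian_pdfE subr0 addrK.
- by apply: emeasurable_funM => //; apply/measurable_EFinP; exact: measurable_gaussian_pdf.
- by move=> x; rewrite mule_ge0// lee_fin ltW// gaussian_pdf_gt0.
Qed.

Lemma integral_gaussian_pdf K (S : 'M[R]_K) (m : 'cV[R]_K) : posdefmx S ->
  \int[lebesgue_cV R K]_x (gaussian_pdf m S x)%:E = 1.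
Proof.
move=> pS; have pI := posdef_inv pS.
have p0 := gaussian_peak_gt0 pS.
transitivity (\int[lebesgue_cV R K]_x (gaussian_pdf 0 S x)%:E).
  rewrite (eq_integral (fun y => cst 1 y * (gaussian_pdf m S y)%:E)); last first.
    by move=> y _; rewrite /= mul1e.
  rewrite -ge0_integral_gaussian_shift//.
  by apply: eq_integral => n _; rewrite /= mul1e.
under eq_integral do rewrite gaussian_pdfE subr0 EFinM.
rewrite ge0_integralZl//.
- rewrite integral_expR_quad// -EFinM det_inv invrK mulVf//.
  by rewrite gt_eqF// sqrtr_gt0.
- by apply/measurable_EFinP; apply: measurableT_comp => //;
    apply: measurableT_comp => //; apply: measurable_funM => //; exact: measurable_quad.

Qed.

End gaussian_integral.

Opaque lebesgue_cV tuple_measure.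

(** * Likelihoods of the observations *)

Section path_likelihood.
Context {R : realType} {K : nat}.
Local Notation V := 'cV[R]_K.
Variables (c : nat -> V -> V -> R) (u : nat -> V -> V -> V).

(** Likelihood in prediction-update form: [c] is the predictive density of the next observation in
    state [m], and [u] the state after it. The filter, white noise and all competitors are
    instances. *)
Fixpoint lik (i : nat) (m : V) (ys : seq V) : R :=
  if ys is y :: ys' then c i m y * lik i.+1 (u i m y) ys' else 1.

Hypothesis mc : forall i, measurable_fun setT (fun p : V * V => c i p.1 p.2).
Hypothesis mu : forall i, measurable_fun setT (fun p : V * V => u i p.1 p.2).
Hypothesis c_ge0 : forall i m y, 0 <= c i m y.

Lemma lik_ge0 i m ys : 0 <= lik i m ys.
Proof. by elim: ys i m => [|y ys IH] i m //=; rewrite mulr_ge0. Qed.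

Lemma measurable_lik t i d (T : measurableType d) (f : T -> V) (g : T -> t.-tuple V) :
  measurable_fun setT f -> measurable_fun setT g ->
  measurable_fun setT (fun s => lik i (f s) (g s)).
Proof.
elim: t i f g => [|t IH] i f g mf mg.
  rewrite (_ : (fun s => _) = cst 1)//.
  by apply/funext => s; rewrite (tuple0 (g s)).
have mh : measurable_fun setT (fun s => thead (g s)).
  exact: (measurableT_comp (measurable_tnth ord0) mg).
have mb : measurable_fun setT (fun s => [tuple of behead (g s)]).
  exact: (measurableT_comp (@measurable_behead _ V t) mg).
have mp : measurable_fun setT (fun s => (f s, thead (g s))).
  exact: measurable_fun_pair.
rewrite (_ : (fun s => _) = fun s => c i (f s) (thead (g s)) *
  lik i.+1 (u i (f s) (thead (g s))) [tuple of behead (g s)]); last first.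
  by apply/funext => s; rewrite [in LHS](tuple_eta (g s)).
apply: measurable_funM.
  exact: (measurableT_comp (mc i) mp).
apply: IH => //; exact: (measurableT_comp (mu i) mp).
Qed.

(** The tail has mass 1 from whatever state it starts, so observations are integrated out from the
    last to the first. *)
Lemma integral_lik t i m :
  (forall i m, (\int[lebesgue_cV R K]_y (c i m y)%:E = 1)%E) ->
  (\int[tuple_measure (lebesgue_cV R K) t]_v (lik i m v)%:E = 1)%E.
Proof.
move=> c1; elim: t i m => [|t IH] i m.
  rewrite integral_tuple_measure0//.
  by apply/measurable_EFinP; apply: (@measurable_lik 0 i _ _ (cst m) id).
rewrite ge0_integral_tuple_measureS; last 2 first.
  - by apply/measurable_EFinP; apply: (@measurable_lik t.+1 i _ _ (cst m) id).
  - by move=> v; rewrite lee_fin lik_ge0.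
rewrite -[RHS](c1 i m); apply: eq_integral => y _ /=.
under eq_integral do rewrite EFinM.
rewrite ge0_integralZl//; first by rewrite IH mule1.
- by apply/measurable_EFinP; apply: (@measurable_lik t i.+1 _ _ (cst _) id).
- by move=> v _; rewrite lee_fin lik_ge0.
- by rewrite lee_fin.
Qed.

End path_likelihood.

(** * The Kalman filter by iterated conditioning *)

Section kalman.
Context {R : realType} {K : nat}.
Local Notation V := 'cV[R]_K.
Variables (A Q : 'M[R]_K).
Hypothesis pQ : posdefmx Q.
Local Open Scope ereal_scope.

(** Expectation of F over the next t observations when the current hidden state is x: y is N(x, 1)
    and the next state z is N(A x, Q). *)
Fixpoint markov_mix t : (t.-tuple V -> \bar R) -> V -> \bar R :=
  if t is t'.+1 then fun F x =>
    \int[lebesgue_cV R K]_y ((\int[lebesgue_cV R K]_z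
      (markov_mix (fun v => F [tuple of y :: v]) z * (gaussian_pdf (A *m x) Q z)%:E)) *
       (gaussian_pdf x 1%:M y)%:E)
  else fun F _ => F [tuple].

Lemma markov_mix_ge0 t (F : t.-tuple V -> \bar R) x : (forall v, 0 <= F v) ->
  0 <= markov_mix F x.
Proof.
elim: t F x => [|t IH] F x F0 //=.
apply: integral_ge0 => y _; rewrite mule_ge0//; last first.
  by rewrite lee_fin ltW// gaussian_pdf_gt0//; exact: posdef1.
apply: integral_ge0 => z _; rewrite mule_ge0//; last first.
  by rewrite lee_fin ltW// gaussian_pdf_gt0.
by apply: IH => v.
Qed.

(** The induction is over all parameter spaces T, since T absorbs the observations already taken. *)
Lemma measurable_markov_mix t d (T : measurableType d) (F : T * t.-tuple V -> \bar R)
    (f : T -> V) :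
  measurable_fun setT F -> (forall p, 0 <= F p) -> measurable_fun setT f ->
  measurable_fun setT (fun s => markov_mix (fun v => F (s, v)) (f s)).
Proof.
move: d T F f; elim: t => [|t IH] d T F f mF F0 mf /=.
  by apply: measurableT_comp => //; exact: measurable_pair2.
pose g (q : (T * V) * V) : \bar R :=
  markov_mix (fun v => F (q.1.1, [tuple of q.1.2 :: v])) q.2 * (gaussian_pdf (A *m f q.1.1) Q q.2)%:E.
have mg : measurable_fun setT g.
  apply: emeasurable_funM; last first.
    apply/measurable_EFinP; apply: measurable_gaussian_pdf => //.
    apply: measurable_fun_mulmx => //; apply: measurableT_comp => //.
    exact: measurableT_comp.
  apply: (IH _ ((T * V) * V)%type (fun w : ((T * V) * V) * t.-tuple V => F (w.1.1.1, [tuple of w.1.1.2 :: w.2])) snd) => //.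
  apply: measurableT_comp => //; apply: measurable_fun_pair.
    by apply: measurableT_comp => //; exact: measurableT_comp.
  apply: measurable_cons => //.
  by apply: measurableT_comp => //; exact: measurableT_comp.
have g0 q : 0 <= g q.
  rewrite mule_ge0//; first exact: markov_mix_ge0.
  by rewrite lee_fin ltW// gaussian_pdf_gt0.
pose h (q : T * V) := (\int[lebesgue_cV R K]_z g (q, z)) * (gaussian_pdf (f q.1) 1%:M q.2)%:E.
have mh : measurable_fun setT h.
  apply: emeasurable_funM; last first.
    by apply/measurable_EFinP; apply: measurable_gaussian_pdf => //; exact: measurableT_comp.
  exact: (measurable_fun_fubini_tonelli_F g).
apply: (measurable_fun_fubini_tonelli_F h) => //.
move=> q; rewrite mule_ge0//; first exact: integral_ge0.
by rewrite lee_fin ltW// gaussian_pdf_gt0//; exact: posdef1.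
Qed.

Variable Ps : nat -> 'M[R]_K.
Hypothesis Ps_posdef : forall i, posdefmx (Ps i).
Hypothesis PsS : forall i, Ps i.+1 = marg_cov (post_cov (Ps i) 1%:M 1%:M) Q A.

Definition kalman_pred (i : nat) (m y : V) : R := gaussian_pdf m (1%:M + Ps i) y.
Definition kalman_update (i : nat) (m y : V) : V :=
  (A *m (m + bayes_gain (Ps i) 1%:M 1%:M *m (y - m)))%R.

Lemma Ps1_posdef i : posdefmx (1%:M + Ps i)%R.
Proof. apply: posdef_psdD; [exact: posdef1|exact: posdef_psd]. Qed.

Lemma measurable_kalman_pred i : measurable_fun setT (fun p : V * V => kalman_pred i p.1 p.2).
Proof. exact: measurable_gaussian_pdf. Qed.

Lemma measurable_kalman_update i :
  measurable_fun setT (fun p : V * V => kalman_update i p.1 p.2).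
Proof.
apply: measurable_fun_mulmx => //; apply: measurable_fun_addmx => //.
by apply: measurable_fun_mulmx => //; exact: measurable_fun_submx.
Qed.

(** [gaussian_bayes] is applied to y given x, then to z given x. The last factor is the law of x
    given y and z; integrating it out leaves the predictive density of y and the Gaussian prior of
    the next state. *)
Lemma kalman_step i m x y z :
  (gaussian_pdf m (Ps i) x * gaussian_pdf x 1%:M y * gaussian_pdf (A *m x) Q z =
   kalman_pred i m y * gaussian_pdf (kalman_update i m y) (Ps i.+1) z *
   gaussian_pdf (m + bayes_gain (Ps i) 1%:M 1%:M *m (y - m) +
      bayes_gain (post_cov (Ps i) 1%:M 1%:M) Q A *m (z - kalman_update i m y))
     (post_cov (post_cov (Ps i) 1%:M 1%:M) Q A) x)%R.
Proof.
have h1 := gaussian_bayes 1%:M m x y (Ps_posdef i) posdef1.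
rewrite !mul1mx in h1; rewrite h1 /kalman_pred.
have -> : marg_cov (Ps i) 1%:M 1%:M = (1%:M + Ps i)%R.
  by rewrite /marg_cov trmx1 mulmx1 mul1mx addrC.
have h2 := gaussian_bayes A (m + bayes_gain (Ps i) 1%:M 1%:M *m (y - m))%R x z
  (post_cov_posdef 1%:M (Ps_posdef i) posdef1) pQ.
by rewrite -[LHS]mulrA h2 -[in RHS]mulrA [in RHS](PsS i) /kalman_update.
Qed.

(** Tonelli moves the hidden x innermost, where [kalman_step] removes it. The next state z then has
    a prior of the same form with updated mean, which is why [i] and [m] vary in the induction. *)
Lemma kalman_likelihood t i m (F : t.-tuple V -> \bar R) :
  measurable_fun setT F -> (forall v, 0 <= F v) ->
  \int[lebesgue_cV R K]_x (markov_mix F x * (gaussian_pdf m (Ps i) x)%:E) =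
  \int[tuple_measure (lebesgue_cV R K) t]_v
    (F v * (lik kalman_pred kalman_update i m v)%:E).
Proof.
pose leb := lebesgue_cV R K.
have g0 S (a b : V) : posdefmx S -> 0 <= (gaussian_pdf a S b)%:E :> \bar R.
  by move=> pS; rewrite lee_fin ltW// gaussian_pdf_gt0.
elim: t i m F => [|t IH] i m F mF F0.
  rewrite integral_tuple_measure0//=; last first.
    apply: emeasurable_funM => //; apply/measurable_EFinP.
    apply: (@measurable_lik _ _ _ _ _ _ _ _ _ _ (cst m) id) => //.
      exact: measurable_kalman_pred.
    exact: measurable_kalman_update.
  rewrite ge0_integralZl//.
  - by rewrite integral_gaussian_pdf.
  - by apply/measurable_EFinP; exact: measurable_gaussian_pdf.
  - by move=> x _; exact: g0.
pose G (y z : V) := markov_mix (fun v => F [tuple of y :: v]) z.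
have G0 y z : 0 <= G y z by apply: markov_mix_ge0.
have mG : measurable_fun setT (fun p : V * V => G p.1 p.2).
  apply: (@measurable_markov_mix t _ (V * V)%type (fun w => F [tuple of w.1.1 :: w.2]) snd) => //.
  apply: measurableT_comp => //; apply: measurable_cons => //.
  by apply: measurableT_comp => //; exact: measurableT_comp.
rewrite ge0_integral_tuple_measureS; last 2 first.
  - apply: emeasurable_funM => //; apply/measurable_EFinP.
    apply: (@measurable_lik _ _ _ _ _ _ _ _ _ _ (cst m) id) => //.
      exact: measurable_kalman_pred.
    exact: measurable_kalman_update.
  - move=> v; rewrite mule_ge0// lee_fin lik_ge0// => j a b.
    by rewrite ltW// gaussian_pdf_gt0//; exact: Ps1_posdef.
pose W (x y z : V) : \bar R := G y z *
  (gaussian_pdf m (Ps i) x * gaussian_pdf x 1%:M y * gaussian_pdf (A *m x) Q z)%:E.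
have W0 x y z : 0 <= W x y z.
  by rewrite mule_ge0// lee_fin !mulr_ge0 ?gaussian_pdf_ge0.
have mW : measurable_fun setT (fun p : (V * V) * V => W p.1.1 p.1.2 p.2).
  apply: emeasurable_funM.
    have mq : measurable_fun setT (fun p : (V * V) * V => (p.1.2, p.2)).
      by apply: measurable_fun_pair => //; exact: measurableT_comp.
    exact: (measurableT_comp mG mq).
  apply/measurable_EFinP; apply: measurable_funM; first apply: measurable_funM.
  - by apply: measurable_gaussian_pdf => //; exact: measurableT_comp.
  - by apply: measurable_gaussian_pdf => //; exact: measurableT_comp.
  - apply: measurable_gaussian_pdf => //; apply: measurable_fun_mulmx => //.
    exact: measurableT_comp.
pose W2 (p : V * V) := \int[leb]_z W p.1 p.2 z.
have mW2 : measurable_fun setT W2.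
  exact: (measurable_fun_fubini_tonelli_F (fun p : (V * V) * V => W p.1.1 p.1.2 p.2)).
have mGy y : measurable_fun setT (G y).
  exact: (measurableT_comp mG (pair1_measurable y)).
transitivity (\int[leb]_x \int[leb]_y W2 (x, y)).
  apply: eq_integral => x _ /=.
  pose H y z := G y z * (gaussian_pdf (A *m x) Q z)%:E.
  have H0 y z : 0 <= H y z by rewrite mule_ge0// lee_fin gaussian_pdf_ge0.
  have mH : measurable_fun setT (fun p : V * V => H p.1 p.2).
    apply: emeasurable_funM => //; apply/measurable_EFinP.
    exact: measurable_gaussian_pdf.
  have mHy y : measurable_fun setT (H y).
    exact: (measurableT_comp mH (pair1_measurable y)).
  have mIH : measurable_fun setT (fun y => \int[leb]_z H y z).
    exact: (measurable_fun_fubini_tonelli_F (fun p : V * V => H p.1 p.2)).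
  rewrite -ge0_integralZr//; last 3 first.
  - apply: emeasurable_funM => //; apply/measurable_EFinP.
    exact: measurable_gaussian_pdf.
  - by move=> y _; rewrite mule_ge0 ?g0//; apply: integral_ge0 => z _; exact: H0.
  - exact: g0.
  apply: eq_integral => y _.
  transitivity (\int[leb]_z (H y z * (gaussian_pdf x 1%:M y * gaussian_pdf m (Ps i) x)%:E)).
    rewrite EFinM -muleA; apply/esym; apply: ge0_integralZr => //.
    by rewrite lee_fin mulr_ge0 ?gaussian_pdf_ge0.
  apply: eq_integral => z _; rewrite /H /W -muleA -EFinM; congr (_ * _%:E); ring.
rewrite fubini_tonelli//; last by move=> p; apply: integral_ge0 => z _; exact: W0.
apply: eq_integral => y _.
transitivity (\int[leb]_z \int[leb]_x W x y z).
  apply: (fubini_tonelli (fun p : V * V => W p.1 y p.2)) => //.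
  have mq : measurable_fun setT (fun p : V * V => ((p.1, y), p.2)).
    by apply: measurable_fun_pair => //; exact: measurable_fun_pair.
  exact: (measurableT_comp mW mq).
transitivity (\int[leb]_z (G y z * (gaussian_pdf (kalman_update i m y) (Ps i.+1) z)%:E *
    (kalman_pred i m y)%:E)).
  apply: eq_integral => z _; rewrite /W.
  under eq_integral do rewrite kalman_step EFinM muleA.
  have pV : posdefmx (post_cov (post_cov (Ps i) 1%:M 1%:M) Q A).
    by apply: post_cov_posdef => //; exact: post_cov_posdef.
  rewrite ge0_integralZl//.
  - by rewrite integral_gaussian_pdf// mule1 -muleA -EFinM [X in _ * X%:E]mulrC.
  - by apply/measurable_EFinP; exact: measurable_gaussian_pdf.
  - by move=> x _; exact: g0.
  - rewrite mule_ge0// lee_fin mulr_ge0 ?gaussian_pdf_ge0//; exact: Ps1_posdef.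
have kp0 : (0 <= kalman_pred i m y)%R by apply: gaussian_pdf_ge0; exact: Ps1_posdef.
rewrite ge0_integralZr//; last 2 first.
- apply: emeasurable_funM => //; apply/measurable_EFinP.
  exact: measurable_gaussian_pdf.
- by move=> z _; rewrite mule_ge0// g0.
rewrite IH//; last by apply: measurableT_comp => //; exact: measurable_cons.
rewrite -ge0_integralZr//; last 2 first.
- apply: emeasurable_funM; first by apply: measurableT_comp => //; exact: measurable_cons.
  apply/measurable_EFinP; apply: (@measurable_lik _ _ _ _ _ _ _ _ _ _ (cst _) id) => //.
    exact: measurable_kalman_pred.
  exact: measurable_kalman_update.
- move=> v _; rewrite mule_ge0// lee_fin lik_ge0// => j a b.
  by apply: gaussian_pdf_ge0; exact: Ps1_posdef.
by apply: eq_integral => v _ /=; rewrite -muleA -EFinM [X in _ * X%:E]mulrC.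
Qed.

End kalman.

Section density_integral.
Context d (T : measurableType d) (R : realType).
Local Open Scope ereal_scope.
Import HBNNSimple.

(** Simple functions and monotone convergence; the model specifies its densities only through
    probabilities of sets. *)
Lemma ge0_integral_density (nu mu : {measure set T -> \bar R}) (f : T -> R)
    (h : T -> \bar R) :
  measurable_fun setT f -> (forall u, 0 <= f u)%R ->
  (forall B, measurable B -> nu B = \int[mu]_(u in B) (f u)%:E) ->
  measurable_fun setT h -> (forall u, 0 <= h u) ->
  \int[nu]_u h u = \int[mu]_u (h u * (f u)%:E).
Proof.
move=> mf f0 nuE mh h0; pose g := nnsfun_approx measurableT mh.
have mfE : measurable_fun setT (EFin \o f) by exact/measurable_EFinP.
have mg n : measurable_fun setT (EFin \o g n) by exact/measurable_EFinP.
transitivity (lim (\int[nu]_x (EFin \o g n) x @[n --> \oo])).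
  rewrite -monotone_convergence//.
  - by apply: eq_integral => x _; apply/esym/cvg_lim => //; exact: cvg_nnsfun_approx.
  - by move=> n x _; rewrite /= lee_fin.
  - by move=> x _ a b ab; rewrite lee_fin; exact/lefP/nd_nnsfun_approx.
transitivity (lim (\int[mu]_x ((EFin \o g n) x * (f x)%:E) @[n --> \oo])); last first.
  rewrite -monotone_convergence//.
  - apply: eq_integral => x _; apply/cvg_lim => //.
    by apply: cvgeZr => //; exact: cvg_nnsfun_approx.
  - by move=> n; exact: emeasurable_funM.
  - by move=> n x _; rewrite mule_ge0//= lee_fin.
  - move=> x _ a b ab; rewrite lee_wpmul2r ?lee_fin//; exact/lefP/nd_nnsfun_approx.
suff H n : \int[nu]_x (EFin \o g n) x = \int[mu]_x ((EFin \o g n) x * (f x)%:E).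
  by under eq_fun do rewrite H.
have E x : (EFin \o g n) x = \sum_(y \in range (g n)) (y * \1_(g n @^-1` [set y]) x)%:E.
  by rewrite /= fimfunE -fsumEFin.
under eq_integral do rewrite E.
rewrite ge0_integral_fsum//; last 2 first.
- by move=> r; exact/measurable_EFinP/measurable_funM.
- by move=> r x _; exact: nnfun_muleindic_ge0.
under [RHS]eq_integral => x _.
  rewrite E ge0_mule_fsuml; last by move=> y; exact: nnfun_muleindic_ge0.
  over.
rewrite ge0_integral_fsum//; last 2 first.
- by move=> r; apply: emeasurable_funM => //; exact/measurable_EFinP/measurable_funM.
- by move=> r x _; rewrite mule_ge0 ?lee_fin//; exact: nnfun_muleindic_ge0.
apply: eq_fsbigr => r; rewrite inE => -[t _ tr].
have r0 : (0 <= r)%R by rewrite -tr.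
rewrite integralZl_indic_nnsfun// integral_indic// setIT nuE//.
under [RHS]eq_integral do rewrite EFinM -muleA.
rewrite ge0_integralZl//.
- congr (_ * _); rewrite integral_mkcond; apply: eq_integral => x _.
  by rewrite patchE indicE; case: ifPn; rewrite ?mul1e ?mul0e.
- by apply: emeasurable_funM => //; exact/measurable_EFinP.
- by move=> x _; rewrite mule_ge0 ?lee_fin.
Qed.

End density_integral.

Lemma bigcap_cons (I : eqType) (V : Type) (F : I -> set V) (i : I) (s : seq I) :
  \bigcap_(j in [set` i :: s]) F j = F i `&` \bigcap_(j in [set` s]) F j.
Proof.
apply/seteqP; split=> [v Fv|v [Fi Fs] j].
  split; first by apply: Fv; rewrite /= mem_head.
  by move=> j /= js; apply: Fv; rewrite /= inE js orbT.
by rewrite /= inE => /orP[/eqP->//|]; exact: Fs.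
Qed.

(** * Independence, with one noise integrated out at a time *)

Section independence.
Context d (Omega : measurableType d) (R : realType) (P : probability Omega R).
Context d' (U : measurableType d') (I : eqType) (X : I -> Omega -> U).
Hypothesis mX : forall i, measurable_fun setT (X i).
Local Open Scope ereal_scope.

(** Z is what has been revealed so far and D indexes the noises still to come. The product form lets
    one noise at a time move from the family into Z. *)
Definition indep_of d2 (T : measurableType d2) (Z : Omega -> T) (D : set I) : Prop :=
  forall (s : seq I) (B : I -> set U) (C : set T),
    uniq s -> (forall i, i \in s -> D i) -> (forall i, measurable (B i)) ->
    measurable C ->
    P (Z @^-1` C `&` \bigcap_(i in [set` s]) (X i @^-1` B i)) =
    P (Z @^-1` C) * \prod_(i <- s) P (X i @^-1` B i).

Let measurable_inter (s : seq I) (B : I -> set U) : (forall i, measurable (B i)) ->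
  measurable (\bigcap_(i in [set` s]) (X i @^-1` B i)).
Proof.
move=> mB; elim: s => [|i s IH]; first by rewrite classical_sets.set_nil bigcap_set0.
rewrite bigcap_cons; apply: measurableI => //.
by rewrite -[X in measurable X]setTI; exact: mX.
Qed.

Lemma indep_of_cst (D : set I) : mutually_independent P D X ->
  indep_of (fun=> tt) D.
Proof.
move=> ind s B C us sD mB mC; have [Ct|Ct] := pselect (C tt).
  have -> : (fun=> tt) @^-1` C = [set: Omega] by apply/seteqP; split.
  by rewrite setTI ind// probability_setT mul1e.
have -> : (fun=> tt) @^-1` C = set0 :> set Omega by apply/seteqP; split.
by rewrite set0I measure0 mul0e.
Qed.

Lemma indep_of_comp d2 (T : measurableType d2) d3 (T3 : measurableType d3)
    (Z : Omega -> T) (h : T -> T3) (D : set I) :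
  measurable_fun setT h -> indep_of Z D -> indep_of (h \o Z) D.
Proof.
move=> mh ind s B C us sD mB mC; rewrite comp_preimage; apply: ind => //.
by rewrite -[X in measurable X]setTI; exact: mh.
Qed.

Lemma indep_of_sub d2 (T : measurableType d2) (Z : Omega -> T) (D E : set I) :
  E `<=` D -> indep_of Z D -> indep_of Z E.
Proof. by move=> ED ind s B C us sE; apply: ind => // i /sE /ED. Qed.

Lemma indep_of_law d2 (T : measurableType d2) (Z : Omega -> T) (D : set I) j :
  measurable_fun setT Z -> indep_of Z D -> D j ->
  forall A B, measurable A -> measurable B ->
  P (Z @^-1` A `&` X j @^-1` B) = P (Z @^-1` A) * P (X j @^-1` B).
Proof.
move=> mZ ind Dj A B mA mB.
have := ind [:: j] (fun=> B) A isT; rewrite big_seq1 => <-//.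
  by congr (P (_ `&` _)); rewrite set_cons1 bigcap_set1.
by move=> i; rewrite inE => /eqP ->.
Qed.

(** Both sides are finite measures in C. They agree on rectangles, which are stable under
    intersection and generate the product sigma-algebra. *)
Lemma indep_of_pair d2 (T : measurableType d2) (Z : Omega -> T) (D : set I) j :
  measurable_fun setT Z -> indep_of Z D -> D j ->
  indep_of (fun w => (Z w, X j w)) (D `\ j).
Proof.
move=> mZ ind Dj s B C us sD mB mC.
have mZX : measurable_fun setT (fun w => (Z w, X j w)) by exact: measurable_fun_pair.
set E := \bigcap_(i in _) _.
have mE : measurable E by exact: measurable_inter.
have js : j \notin s by apply/negP => /sD[_]; apply.
set c := \prod_(i <- s) P (X i @^-1` B i).
have c0 : 0 <= c by apply: prode_ge0.
have cfin : c \is a fin_num.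
  apply: (big_ind (fun x : \bar R => x \is a fin_num)) => // [x y|i _]; first exact: fin_numM.
  by apply: fin_num_measure; rewrite -[X in measurable X]setTI; exact: mX.
have cN : (0 <= fine c)%R by rewrite fine_ge0.
pose hZX := isMeasurableFun.Build _ _ _ _ _ mZX.
pose ZX : {mfun _ >-> _} := HB.pack (fun w => (Z w, X j w)) hZX.
pose m1 := pushforward (mrestr P mE) ZX.
pose m2 := mscale (NngNum cN) (distribution P ZX).
have m2E C' : m2 C' = c * P (ZX @^-1` C') by rewrite -[in RHS](fineK cfin).
suff : m1 C = m2 C by rewrite m2E muleC.
pose G : set (set (T * U)) :=
  [set C | exists A, measurable A /\ exists B, measurable B /\ C = A `*` B].
apply: (measure_unique G (fun=> setT)) => //.
- rewrite measurable_prod_measurableType //; congr (<<s _ >>).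
  rewrite predeqE; split => [[A mA [B' mB' <-]]|[A [mA [B' [mB' ->]]]]].
    by exists A; split => //; exists B'.
  by exists A => //; exists B'.
- move=> /= _ _ [X1 [mX1 [X2 [mX2 ->]]]] [Y1 [mY1 [Y2 [mY2 ->]]]].
  rewrite -setXI; exists (X1 `&` Y1); split; first exact: measurableI.
  by exists (X2 `&` Y2); split => //; exact: measurableI.
- by move=> _; exists setT; split => //; exists setT; split => //; rewrite setXTT.
- by rewrite bigcup_const.
- move=> _ [A [mA [B' [mB' ->]]]].
  apply: (etrans _ (esym (m2E (A `*` B')))); rewrite /pushforward /mrestr.
  have -> : (fun w => (Z w, X j w)) @^-1` (A `*` B') = Z @^-1` A `&` X j @^-1` B' by [].
  rewrite (indep_of_law mZ ind)//.
  (* On a rectangle the claim is the hypothesis for [j :: s], with B' placed at j. *)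
  pose B2 i := if i == j then B' else B i.
  have := ind (j :: s) B2 A.
  move=> H; have {H} : P (Z @^-1` A `&` \bigcap_(i in [set` j :: s]) (X i @^-1` B2 i)) =
    P (Z @^-1` A) * (P (X j @^-1` B') * c).
    rewrite H//=.
    + rewrite big_cons; congr (_ * (_ * _)); first by rewrite /B2 eqxx.
      apply: eq_big_seq => i si; rewrite /B2.
      by case: eqP => // ij; rewrite -ij si in js.
    + by rewrite js.
    + by move=> i; rewrite inE => /orP[/eqP->//|/sD[]].
    + by move=> i; rewrite /B2; case: ifP.
  rewrite (muleC c) -muleA => <-.
  change (P (Z @^-1` A `&` X j @^-1` B' `&` E) =
    P (Z @^-1` A `&` \bigcap_(i in [set` j :: s]) X i @^-1` B2 i)).
  rewrite -setIA; congr (P (_ `&` _)).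
  rewrite bigcap_cons; congr (_ `&` _); first by rewrite /B2 eqxx.
  apply: eq_bigcapr => i /= si; rewrite /B2.
  by case: eqP => // ij; rewrite -ij si in js.
- move=> _; change (P (setT `&` E) < +oo); by rewrite setTI ltey_eq fin_num_measure.
Qed.

(** By independence the joint law is a product measure; Tonelli integrates the noise against its
    density with Z frozen. *)
Lemma integral_indep d2 (T : measurableType d2) (Z : Omega -> T) (D : set I) j
    (mu : {sigma_finite_measure set U -> \bar R}) (g : U -> R) (f : T * U -> \bar R) :
  measurable_fun setT Z -> indep_of Z D -> D j -> has_density P (X j) mu g ->
  measurable_fun setT f -> (forall p, 0 <= f p) ->
  \int[P]_w f (Z w, X j w) = \int[P]_w \int[mu]_u (f (Z w, u) * (g u)%:E).
Proof.
move=> mZ ind Dj [mg g0 gE] mf f0.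
have mZX : measurable_fun setT (fun w => (Z w, X j w)) by exact: measurable_fun_pair.
pose hZ := isMeasurableFun.Build _ _ _ _ Z mZ; pose Zm : {mfun _ >-> _} := HB.pack Z hZ.
pose hX := isMeasurableFun.Build _ _ _ _ (X j) (mX j).
pose Xm : {mfun _ >-> _} := HB.pack (X j) hX.
pose hZX := isMeasurableFun.Build _ _ _ _ _ mZX.
pose ZXm : {mfun _ >-> _} := HB.pack (fun w => (Z w, X j w)) hZX.
transitivity (\int[distribution P ZXm]_p f p).
  by rewrite ge0_integral_pushforward// preimage_setT.
transitivity (\int[distribution P Zm \x distribution P Xm]_p f p).
  apply: eq_measure_integral => C mC _; apply/esym.
  apply: (product_measure_unique (m1 := distribution P Zm) (m2 := distribution P Xm)) => // A B mA mB.
  exact: (indep_of_law mZ ind).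
rewrite fubini_tonelli1//.
have mF : measurable_fun setT (fubini_F (distribution P Xm) f).
  exact: (measurable_fun_fubini_tonelli_F f).
rewrite ge0_integral_pushforward// ?preimage_setT; last first.
  by move=> t _; exact: integral_ge0.
apply: eq_integral => w _ /=; rewrite /fubini_F.
apply: (ge0_integral_density (f := g)) => //.
by apply: measurableT_comp => //; exact: pair1_measurable.
Qed.

End independence.

(** * Laws of the observations *)

Section observation_laws.
Context d (Omega : measurableType d) (R : realType) (P : probability Omega R).
Context (K : nat) (I : eqType) (X : I -> Omega -> 'cV[R]_K).
Hypothesis mX : forall i, measurable_fun setT (X i).
Local Notation V := 'cV[R]_K.
Local Open Scope ereal_scope.
Local Notation gauss S := (gaussian_pdf (0%R : V) S).

Fixpoint iid_obs (a : nat -> I) n (k : nat) (w : Omega) : n.-tuple V :=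
  if n is n'.+1 then [tuple of X (a k) w :: iid_obs a n' k.+1 w] else [tuple].

Fixpoint state_obs (A : 'M[R]_K) (a b : nat -> I) n (k : nat) (x : V) (w : Omega) :
    n.-tuple V :=
  if n is n'.+1 then
    [tuple of (x + X (a k) w)%R :: state_obs A a b n' k.+1 (A *m x + X (b k) w)%R w]
  else [tuple].

(* In reverse order: X (a k.-1), ..., X (a 0). *)
Fixpoint past_obs (a : nat -> I) k (w : Omega) : k.-tuple V :=
  if k is k'.+1 then [tuple of X (a k') w :: past_obs a k' w] else [tuple].

(** The law of the pre-change observations, written without a probability so that P_t0 and P_oo can
    share it. *)
Fixpoint past_integral k : (k.-tuple V -> \bar R) -> \bar R :=
  if k is k'.+1 then fun f =>
    past_integral (fun u => \int[lebesgue_cV R K]_n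
      (f [tuple of n :: u] * (gauss 1%:M n)%:E))
  else fun f => f [tuple].

Local Notation indep Z D := (@indep_of _ _ _ P _ _ _ X _ _ Z D).

Lemma measurable_past_obs a k : measurable_fun setT (past_obs a k).
Proof.
elim: k => [|k IH] /=; first by exact: measurable_cst.
exact: measurable_cons.
Qed.

Lemma indep_past_obs (a : nat -> I) k (D : set I) : injective a ->
  (forall j, D (a j)) -> mutually_independent P D X ->
  indep (past_obs a k) (D `\` [set a j | j in [set j | (j < k)%N]]).
Proof.
move=> ia Da ind; elim: k => [|k IH].
  apply: (@indep_of_sub _ _ _ _ _ _ _ _ _ _ _ D); first by move=> i [].
  exact: (indep_of_comp (h := fun=> [tuple] : 0.-tuple V) _ (indep_of_cst ind)).
have Dk : (D `\` [set a j | j in [set j | (j < k)%N]]) (a k).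
  by split => // -[j /= jk /ia jE]; rewrite jE ltnn in jk.
have := indep_of_pair mX (@measurable_past_obs a k) IH Dk.
move=> /(indep_of_comp (h := fun p : k.-tuple V * V => [tuple of p.2 :: p.1])) H.
apply: indep_of_sub (H _); last exact: measurable_cons.
move=> i [Di Ni]; split; first split => //.
  by move=> [j /= jk ji]; apply: Ni; exists j => //=; exact: ltnW.
by move=> /= iE; apply: Ni; exists k => //=.
Qed.

Lemma integral_past_obs (a : nat -> I) k (D : set I) (f : k.-tuple V -> \bar R) :
  injective a -> (forall j, D (a j)) -> mutually_independent P D X ->
  (forall j, has_density P (X (a j)) (lebesgue_cV R K) (gauss 1%:M)) ->
  measurable_fun setT f -> (forall u, 0 <= f u) ->
  \int[P]_w f (past_obs a k w) = past_integral f.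
Proof.
move=> ia Da ind Xa; elim: k f => [|k IH] f mf f0 /=.
  rewrite integral_cst// -[RHS]mule1; congr (_ * _); exact: probability_setT.
have Dk : (D `\` [set a j | j in [set j | (j < k)%N]]) (a k).
  by split => // -[j /= jk /ia jE]; rewrite jE ltnn in jk.
have mg : measurable_fun setT (fun p : k.-tuple V * V => f [tuple of p.2 :: p.1]).
  by apply: measurableT_comp => //; exact: measurable_cons.
rewrite (integral_indep mX (@measurable_past_obs a k) (indep_past_obs ia Da ind) Dk (Xa k) mg)//.
rewrite -IH//.
- apply: (measurable_fun_fubini_tonelli_F (m2 := lebesgue_cV R K)
    (fun p : k.-tuple V * V => f [tuple of p.2 :: p.1] * (gauss 1%:M p.2)%:E)).
    by apply: emeasurable_funM => //; apply/measurable_EFinP; exact: measurable_gaussian_pdf.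
  by move=> p; rewrite mule_ge0// lee_fin gaussian_pdf_ge0.
- by move=> u; apply: integral_ge0 => n _; rewrite mule_ge0// lee_fin gaussian_pdf_ge0.
Qed.

Lemma integral_iid_obs (a : nat -> I) n k d2 (T : measurableType d2) (Z : Omega -> T)
    (F : T * n.-tuple V -> \bar R) :
  injective a -> measurable_fun setT Z ->
  indep Z [set a j | j in [set j | (k <= j)%N]] ->
  (forall j, has_density P (X (a j)) (lebesgue_cV R K) (gauss 1%:M)) ->
  measurable_fun setT F -> (forall p, 0 <= F p) ->
  \int[P]_w F (Z w, iid_obs a n k w) =
  \int[P]_w \int[tuple_measure (lebesgue_cV R K) n]_v
    (F (Z w, v) * (lik (fun _ _ y => gauss 1%:M y) (fun _ m _ => m) 0 0%R v)%:E).
Proof.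
move=> ia + + Xa; move: k d2 T Z F; elim: n => [|n IH] k d2 T Z F mZ indZ mF F0.
  apply: eq_integral => w _; rewrite integral_tuple_measure0/= ?mule1//.
  have -> : (fun v : 0.-tuple V => F (Z w, v) * (lik (fun _ _ y => gauss 1%:M y)
      (fun _ m _ => m) 0 0%R v)%:E) = fun v => F (Z w, v).
    by apply/funext => v; rewrite (tuple0 v) /= mule1.
  by apply: (measurableT_comp mF); exact: pair1_measurable.
pose Z' w := (Z w, X (a k) w).
pose F' (p : (T * V) * n.-tuple V) := F (p.1.1, [tuple of p.1.2 :: p.2]).
have mF' : measurable_fun setT F'.
  apply: measurableT_comp => //; apply: measurable_fun_pair; first exact: measurableT_comp.
  by apply: measurable_cons => //; exact: measurableT_comp.
have mZ' : measurable_fun setT Z' by exact: measurable_fun_pair.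
have ak : [set a j | j in [set j | (k <= j)%N]] (a k) by exists k => /=.
have indZ' : indep Z' [set a j | j in [set j | (k < j)%N]].
  apply: indep_of_sub (indep_of_pair mX mZ indZ ak).
  move=> _ [j /= kj <-]; split; first by exists j => //=; exact: ltnW.
  by move=> /= /ia jk; rewrite jk ltnn in kj.
rewrite [LHS](IH k.+1 _ _ Z' F')//; last by move=> p; exact: F0.
pose L := lik (fun (_ : nat) (_ y : V) => gauss 1%:M y) (fun _ m _ => m).
have L0 i m v : (0 <= L i m v)%R by apply: lik_ge0 => *; exact: gaussian_pdf_ge0.
have mL l i m : measurable_fun setT (fun v : l.-tuple V => L i m v).
  apply: (@measurable_lik _ _ _ _ _ _ _ _ _ _ (cst m) id) => // j.
    exact: measurable_gaussian_pdf.
  exact: measurable_fst.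
have LS i j m v : L i m v = L j m v.
  by elim: v i j m => [|y v IHv] i j m //=; congr (_ * _)%R; exact: IHv.
pose G (p : (T * V) * n.-tuple V) := F' p * (L 0%N 0%R p.2)%:E.
have mG : measurable_fun setT G.
  by apply: emeasurable_funM => //; apply/measurable_EFinP; exact: (measurableT_comp (mL n 0%N 0%R) measurable_snd).
have G0 p : 0 <= G p by apply: mule_ge0; [exact: F0|rewrite lee_fin].
pose g (p : T * V) := \int[tuple_measure (lebesgue_cV R K) n]_v G (p, v).
have mg : measurable_fun setT g by exact: (measurable_fun_fubini_tonelli_F G).
rewrite [LHS](integral_indep mX mZ indZ ak (Xa k) mg); last first.
  by move=> p; exact: integral_ge0.
apply: eq_integral => w _; rewrite ge0_integral_tuple_measureS; last 2 first.
- apply: emeasurable_funM; last by apply/measurable_EFinP; exact: mL.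
  by apply: measurableT_comp => //; exact: pair1_measurable.
- by move=> v; rewrite mule_ge0// lee_fin.
apply: eq_integral => y _; rewrite /g -ge0_integralZr//; last 2 first.
- by apply: (measurableT_comp mG); exact: pair1_measurable.
- by rewrite lee_fin gaussian_pdf_ge0.
apply: eq_integral => v _; rewrite /G /= -muleA -EFinM -/L (LS 1%N 0%N); congr (_ * _%:E).
by rewrite mulrC.
Qed.

(** Both noises of the current time enter Z before the induction hypothesis is applied. They are
    then integrated out, signal noise first, to match the nesting in [markov_mix]. *)
Lemma integral_state_obs (A Q : 'M[R]_K) (a b : nat -> I) n k d2
    (T : measurableType d2) (Z : Omega -> T) (xi : T -> V)
    (F : T * n.-tuple V -> \bar R) :
  injective a -> injective b -> (forall i j, a i <> b j) -> posdefmx Q ->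
  measurable_fun setT Z -> measurable_fun setT xi ->
  indep Z [set i | exists2 j, (k <= j)%N & i = a j \/ i = b j] ->
  (forall j, has_density P (X (a j)) (lebesgue_cV R K) (gauss 1%:M)) ->
  (forall j, has_density P (X (b j)) (lebesgue_cV R K) (gauss Q)) ->
  measurable_fun setT F -> (forall p, 0 <= F p) ->
  \int[P]_w F (Z w, state_obs A a b n k (xi (Z w)) w) =
  \int[P]_w markov_mix A Q (fun v => F (Z w, v)) (xi (Z w)).
Proof.
move=> ia ib ab pQ + + + Xa Xb.
move: k d2 T Z xi F; elim: n => [|n IH] k d2 T Z xi F mZ mxi indZ mF F0 //.
pose Z1 w := (Z w, X (a k) w).
pose Z' w := (Z1 w, X (b k) w).
have mZ1 : measurable_fun setT Z1 by exact: measurable_fun_pair.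
have mZ' : measurable_fun setT Z' by exact: measurable_fun_pair.
pose F' (p : (T * V * V) * n.-tuple V) := F (p.1.1.1, [tuple of (xi p.1.1.1 + p.1.1.2)%R :: p.2]).
pose xi' (p : T * V * V) := (A *m xi p.1.1 + p.2)%R.
have m11 : measurable_fun setT (fun p : T * V * V => xi p.1.1).
  by apply: (measurableT_comp mxi); exact: measurableT_comp.
have mxi' : measurable_fun setT xi'.
  by apply: measurable_fun_addmx => //; exact: measurable_fun_mulmx.
have mF' : measurable_fun setT F'.
  apply: (measurableT_comp mF); apply: measurable_fun_pair.
    by apply: measurableT_comp => //; exact: measurableT_comp.
  apply: measurable_cons => //; apply: measurable_fun_addmx.
    by apply: (measurableT_comp m11).
  by apply: measurableT_comp => //; exact: measurableT_comp.
set D := [set i | _] in indZ.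
have Dak : D (a k) by exists k => //; left.
have Dbk : (D `\ a k) (b k).
  by split; [exists k => //; right|move=> /= h; exact: (ab k k)].
have ind1 : indep Z1 (D `\ a k) by exact: indep_of_pair.
have indZ' : indep Z' [set i | exists2 j, (k < j)%N & i = a j \/ i = b j].
  apply: indep_of_sub (indep_of_pair mX mZ1 ind1 Dbk).
  move=> i [j kj [] ->]; (split; [split; [exists j; [exact: ltnW|by [left|right]]|]|]) => /= h.
  - by move: kj; rewrite (ia _ _ h) ltnn.
  - exact: (ab _ _ h).
  - by apply: (ab k j); rewrite h.
  - by move: kj; rewrite (ib _ _ h) ltnn.
rewrite [LHS](IH k.+1 _ _ Z' xi' F')//; last by move=> p; exact: F0.
have g0 (S : 'M[R]_K) m y : posdefmx S -> 0 <= (gaussian_pdf m S y)%:E :> \bar R.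
  by move=> pS; rewrite lee_fin gaussian_pdf_ge0.
pose M (p : (T * V) * V) z := markov_mix A Q (fun v => F (p.1.1, [tuple of p.2 :: v])) z.
have M0 p z : 0 <= M p z by apply: markov_mix_ge0.
have mM : measurable_fun setT (fun q : ((T * V) * V) * V => M q.1 q.2).
  apply: (@measurable_markov_mix _ _ _ _ _ _ _ _ (fun q : (((T * V) * V) * V) * n.-tuple V =>
     F (q.1.1.1.1, [tuple of q.1.1.2 :: q.2]))) => //.
  have m1 : measurable_fun setT (fun q : (((T * V) * V) * V) * n.-tuple V => q.1.1).
    exact: measurableT_comp.
  apply: (measurableT_comp mF); apply: measurable_fun_pair.
    by apply: measurableT_comp => //; apply: measurableT_comp.
  by apply: measurable_cons => //; exact: measurableT_comp.
pose h (p : T * V) := \int[lebesgue_cV R K]_z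
  (M (p, (xi p.1 + p.2)%R) z * (gaussian_pdf (A *m xi p.1) Q z)%:E).
have mxi1 : measurable_fun setT (fun p : T * V => xi p.1) by exact: measurableT_comp.
have mad : measurable_fun setT (fun q : (T * V) * V => (xi q.1.1 + q.1.2)%R).
  by apply: measurable_fun_addmx; [exact: m11|exact: measurableT_comp].
have mMp : measurable_fun setT (fun q : (T * V) * V => M (q.1, (xi q.1.1 + q.1.2)%R) q.2).
  apply: (measurableT_comp mM (g := fun q : (T * V) * V => ((q.1, (xi q.1.1 + q.1.2)%R), q.2))).
  exact: (measurable_fun_pair (measurable_fun_pair measurable_fst mad) measurable_snd).
have mh : measurable_fun setT h.
  apply: (measurable_fun_fubini_tonelli_F (m2 := lebesgue_cV R K) (fun q : (T * V) * V =>
    M (q.1, (xi q.1.1 + q.1.2)%R) q.2 * (gaussian_pdf (A *m xi q.1.1) Q q.2)%:E)).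
    apply: emeasurable_funM => //; apply/measurable_EFinP.
    by apply: measurable_gaussian_pdf => //; apply: measurable_fun_mulmx => //; exact: m11.
  by move=> p; rewrite mule_ge0// g0.
have h0 p : 0 <= h p by apply: integral_ge0 => z _; rewrite mule_ge0// g0.
pose f2 (q : (T * V) * V) := M (q.1, (xi q.1.1 + q.1.2)%R) (A *m xi q.1.1 + q.2)%R.
have mM2 : measurable_fun setT f2.
  apply: (measurableT_comp mM (g := fun q : (T * V) * V =>
    ((q.1, (xi q.1.1 + q.1.2)%R), (A *m xi q.1.1 + q.2)%R))).
  exact: (measurable_fun_pair (measurable_fun_pair measurable_fst mad) mxi').
transitivity (\int[P]_w h (Z1 w)).
  apply: (etrans (integral_indep mX mZ1 ind1 Dbk (Xb k) mM2 _)); first by move=> q; exact: M0.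
  apply: eq_integral => w _.
  apply: (ge0_integral_gaussian_shift (A *m xi (Z w)) (f := M (Z1 w, (xi (Z w) + X (a k) w)%R))) => //.
  exact: (measurableT_comp mM (pair1_measurable (Z1 w, (xi (Z w) + X (a k) w)%R))).
apply: (etrans (integral_indep mX mZ indZ Dak (Xa k) mh h0)).
apply: eq_integral => w _.
(* 0 fills the place of the current noise, on which [M] depends only through the observation y. *)
pose hh y := \int[lebesgue_cV R K]_z (M ((Z w, 0%R), y) z * (gaussian_pdf (A *m xi (Z w)) Q z)%:E).
have mhh : measurable_fun setT hh.
  apply: (measurable_fun_fubini_tonelli_F (m2 := lebesgue_cV R K) (fun q : V * V =>
    M ((Z w, 0%R), q.1) q.2 * (gaussian_pdf (A *m xi (Z w)) Q q.2)%:E)).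
    apply: emeasurable_funM; last by apply/measurable_EFinP; exact: measurable_gaussian_pdf.
    have mp : measurable_fun setT (fun q : V * V => (((Z w, 0%R : V), q.1), q.2)).
      by apply: measurable_fun_pair => //; exact: measurable_fun_pair.
    exact: (measurableT_comp mM mp).
  by move=> p; rewrite mule_ge0// g0.
have hh0 u : 0 <= hh u by apply: integral_ge0 => z _; rewrite mule_ge0// g0.
transitivity (\int[lebesgue_cV R K]_u (hh (xi (Z w) + u)%R * (gauss 1%:M u)%:E)).
  by apply: eq_integral => u _; congr (_ * _).
exact: (ge0_integral_gaussian_shift (xi (Z w)) mhh hh0 (@posdef1 R K)).
Qed.

End observation_laws.

Lemma iid_obsE d (Omega : measurableType d) (R : realType) K (I : eqType) (X : I -> Omega -> 'cV[R]_K)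
    (a : nat -> I) n k w : iid_obs X a n k w = [tuple X (a (k + i)%N) w | i < n].
Proof.
elim: n k => [|n IH] k /=; first by apply: eq_from_tnth => -[].
apply: eq_from_tnth => i; rewrite tnth_mktuple.
case: (unliftP ord0 i) => [j|] ->.
  by rewrite tnthS /= IH tnth_mktuple /= /bump /= add1n addSnnS.
by rewrite tnth0 addn0.
Qed.

Lemma measurable_iid_obs d (Omega : measurableType d) (R : realType) K (I : eqType)
    (X : I -> Omega -> 'cV[R]_K) (a : nat -> I) n k :
  (forall i, measurable_fun setT (X i)) -> measurable_fun setT (iid_obs X a n k).
Proof.
move=> mX; elim: n k => [|n IH] k /=; first exact: measurable_cst.
exact: measurable_cons.
Qed.

Section change_model_laws.
Context d (Omega : measurableType d) (R : realType) (K : nat).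
Local Notation V := 'cV[R]_K.
Variables (A Q S1 : 'M[R]_K) (m1 : V).
Variable y : nat -> {mfun Omega >-> V}.
Local Open Scope ereal_scope.

(** Covariance of the hidden state at time t0 + i given the i post-change observations before it. *)
Definition riccati i := iter i (fun S => marg_cov (post_cov S 1%:M 1%:M) Q A) S1.

Definition kalman_lik (v : seq V) : R :=
  lik (kalman_pred riccati) (kalman_update A riccati) 0 m1 v.

Definition white_lik (v : seq V) : R :=
  lik (fun _ _ => gaussian_pdf 0 1%:M) (fun _ m _ => m) 0 0%R v.

Local Notation past := (past_obs (fun i => y i : Omega -> V) S).

Lemma riccati_posdef i : posdefmx Q -> posdefmx S1 -> posdefmx (riccati i).
Proof.
move=> pQ pS; elim: i => [//|i IH]; rewrite /riccati iterS -/(riccati i).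
by apply: marg_cov_posdef => //; exact: post_cov_posdef.
Qed.

Lemma measurable_past k : measurable_fun setT (past k).
Proof. by apply: measurable_past_obs. Qed.

Lemma measurable_obs_block t n : measurable_fun setT (obs_block y t n).
Proof.
apply/measurable_fun_tnthP => i; rewrite /obs_block.
by rewrite (_ : _ \o _ = y (t + i)%N)//; apply/funext => w /=; rewrite tnth_mktuple.
Qed.

(** One formula carries two facts: the block has density [kalman_lik], and it is independent of the
    past. *)
Lemma change_law_integral t0 n (P : probability Omega R)
    (H : t0.-1.-tuple V * n.-tuple V -> \bar R) :
  (1 <= t0)%N -> posdefmx Q -> posdefmx S1 -> change_law A Q m1 S1 y t0 P ->
  measurable_fun setT H -> (forall p, 0 <= H p) ->
  \int[P]_w H (past t0.-1 w, obs_block y t0 n w) =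
  past_integral (fun u => \int[tuple_measure (lebesgue_cV R K) n]_v
    (H (u, v) * (kalman_lik v)%:E)).
Proof.
move=> t0_gt0 pQ pS [nu [omega [x [Dnu Dx Dom ind ae_y]]]] mH H0.
pose X := noise_family (fun t => nu t : Omega -> V) (fun t => omega t : Omega -> V) (fun t => x t : Omega -> V) t0.
have mX i : measurable_fun setT (X i) by case: i => [[]|[]].
(* [ap j] is the observation noise at time j + 1, used before the change; [a j] is the one at t0 +
   j. Signal noise starts at t0 + 1 because x t0 is drawn directly. *)
pose ap j : nat + nat + unit := inl (inl j.+1).
pose a j : nat + nat + unit := inl (inl (t0 + j)%N).
pose b j : nat + nat + unit := inl (inr (t0 + j).+1).
have iap : injective ap by move=> i j [].
have ia : injective a by move=> i j [] /eqP; rewrite eqn_add2l => /eqP.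
have ib : injective b by move=> i j [] /eqP; rewrite eqn_add2l => /eqP.
have Dap j : noise_index t0 (ap j) by [].
pose U := past_obs X ap t0.-1.
have mU : measurable_fun setT U by apply: measurable_past_obs.
have indU := indep_past_obs (k := t0.-1) mX iap Dap ind.
have Dxx : (noise_index t0 `\` [set ap j | j in [set j | (j < t0.-1)%N]]) (inr tt).
  by split => // -[].
pose Z w := (U w, X (inr tt) w).
have mZ : measurable_fun setT Z by exact: measurable_fun_pair.
have indZ : indep_of P X Z [set i | exists2 j, (0 <= j)%N & i = a j \/ i = b j].
  apply: indep_of_sub (indep_of_pair mX mU indU Dxx).
  move=> i [j _ [] ->]; (split; last by []); split.
  - by rewrite /a /noise_index /= addn_gt0 t0_gt0.
  - move=> [k /= kt []] kE; move: kt; rewrite -ltnS kE prednK//.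
    by rewrite ltnNge leq_addr.
  - by rewrite /noise_index/= ltnS leq_addr.
  - by move=> [].
have ne : (forall i j, a i <> b j) by [].
have Xa j : has_density P (X (a j)) (lebesgue_cV R K) (gaussian_pdf 0 1%:M).
  by apply: Dnu; rewrite addn_gt0 t0_gt0.
have Xb j : has_density P (X (b j)) (lebesgue_cV R K) (gaussian_pdf 0 Q).
  by apply: Dom; rewrite ltnS leq_addr.
have mso l k : measurable_fun setT (fun p : V * Omega => state_obs X A a b l k p.1 p.2).
  elim: l k => [|l IH] k /=; first exact: measurable_cst.
  apply: measurable_cons.
    apply: measurable_fun_addmx => //; exact: (measurableT_comp (mX (a k)) measurable_snd).
  apply: (measurableT_comp (IH k.+1) (g := fun p : V * Omega => (A *m p.1 + X (b k) p.2, p.2)%R)).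
  apply: measurable_fun_pair => //; apply: measurable_fun_addmx.
    exact: measurable_fun_mulmx.
  exact: (measurableT_comp (mX (b k)) measurable_snd).
transitivity (\int[P]_w H (U w, state_obs X A a b n 0 (X (inr tt) w) w)).
  apply: ge0_ae_eq_integral => //.
  - apply: (measurableT_comp mH); apply: measurable_fun_pair.
      exact: measurable_past.
    exact: measurable_obs_block.
  - apply: (measurableT_comp mH); apply: measurable_fun_pair => //.
    have mp : measurable_fun setT (fun w => (X (inr tt) w, w)) by exact: measurable_fun_pair.
    exact: (measurableT_comp (mso n 0%N) mp).
  apply: filterS ae_y => w [y1 y2 x1] _; congr H; congr pair.
    suff h k : (k < t0)%N -> past k w = past_obs X ap k w by apply: h; rewrite prednK.
    elim: k => [//|k IH] kt /=; rewrite IH//; last exact: ltnW.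
    by apply/val_inj => /=; congr cons; rewrite /X /= y1.
  suff h k xx : xx = x (t0 + k)%N w -> state_obs X A a b n k xx w =
      iid_obs (fun i => y i : Omega -> V) (addn t0) n k w.
    rewrite (h 0%N) ?addn0// iid_obsE.
    by apply: eq_from_tnth => i; rewrite !tnth_mktuple add0n.
  move: k xx; elim: (n) => [//|l IH] k xx -> /=.
  apply/val_inj => /=; congr cons; first by rewrite /X /= y2// leq_addr.
  by rewrite (IH k.+1)// /X/= addnS (x1 (t0 + k).+1) ?ltnS ?leq_addr.
pose F (p : (t0.-1.-tuple V * V) * n.-tuple V) := H (p.1.1, p.2).
have mF : measurable_fun setT F.
  by apply: (measurableT_comp mH); apply: measurable_fun_pair => //; exact: measurableT_comp.
rewrite (@integral_state_obs _ _ _ P K _ X mX A Q a b n 0 _ _ Z snd F)//; last by move=> p; exact: H0.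
have pr i := riccati_posdef i pQ pS.
pose G (p : t0.-1.-tuple V * V) := markov_mix A Q (fun v => H (p.1, v)) p.2.
have mG : measurable_fun setT G.
  by apply: (@measurable_markov_mix _ _ _ _ _ _ _ _ (fun q : (t0.-1.-tuple V * V) * n.-tuple V => H (q.1.1, q.2))).
rewrite [LHS](integral_indep mX mU indU Dxx Dx mG); last first.
  by move=> p; apply: markov_mix_ge0.
pose f (u : t0.-1.-tuple V) := \int[tuple_measure (lebesgue_cV R K) n]_v
  (H (u, v) * (kalman_lik v)%:E).
have L0 v : (0 <= kalman_lik v)%R.
  by apply: lik_ge0 => i m z; apply: gaussian_pdf_ge0; exact: Ps1_posdef.
have HL0 p : 0 <= H p * (kalman_lik p.2)%:E by rewrite mule_ge0// lee_fin.
have mf : measurable_fun setT f.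
  apply: (measurable_fun_fubini_tonelli_F (m2 := tuple_measure (lebesgue_cV R K) n)
    (fun p => H p * (kalman_lik p.2)%:E)) => //.
  apply: emeasurable_funM => //; apply/measurable_EFinP.
  apply: (@measurable_lik _ _ _ _ _ _ _ _ _ _ (cst m1) snd) => // i.
    exact: measurable_kalman_pred.
  exact: measurable_kalman_update.
have f0 u : 0 <= f u by apply: integral_ge0 => v _; exact: (HL0 (u, v)).
have Xap j : has_density P (X (ap j)) (lebesgue_cV R K) (gaussian_pdf 0 1%:M).
  exact: Dnu.
apply: (etrans _ (integral_past_obs mX iap Dap ind Xap mf f0)).
apply: eq_integral => w _.
have mHw : measurable_fun setT (fun v => H (U w, v)).
  by apply: (measurableT_comp mH); exact: pair1_measurable.
exact: (kalman_likelihood pQ pr (fun i => erefl) 0 m1 mHw (fun v => H0 _)).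
Qed.

Lemma nochange_law_integral t0 n (P : probability Omega R)
    (H : t0.-1.-tuple V * n.-tuple V -> \bar R) :
  (1 <= t0)%N -> nochange_law y P ->
  measurable_fun setT H -> (forall p, 0 <= H p) ->
  \int[P]_w H (past t0.-1 w, obs_block y t0 n w) =
  past_integral (fun u => \int[tuple_measure (lebesgue_cV R K) n]_v
    (H (u, v) * (white_lik v)%:E)).
Proof.
move=> t0_gt0 [nu [Dnu ind ae_y]] mH H0.
pose X t := nu t : Omega -> V.
have mX i : measurable_fun setT (X i) by [].
have ia : injective (addn t0) by move=> i j /eqP; rewrite eqn_add2l => /eqP.
pose D := [set t | (1 <= t)%N].
have Dap j : D j.+1 by [].
pose U := past_obs X S t0.-1.
have mU : measurable_fun setT U by apply: measurable_past_obs.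
have indU := indep_past_obs (k := t0.-1) mX succn_inj Dap ind.
have indZ : indep_of P X U [set (addn t0) j | j in [set j | (0 <= j)%N]].
  apply: indep_of_sub indU => _ [j _ <-]; split; first by rewrite /D/= addn_gt0 t0_gt0.
  move=> [k /= kt kE]; move: kt; rewrite -ltnS kE prednK//.
  by rewrite ltnNge leq_addr.
have Xa j : has_density P (X (t0 + j)%N) (lebesgue_cV R K) (gaussian_pdf 0 1%:M).
  by apply: Dnu; rewrite addn_gt0 t0_gt0.
transitivity (\int[P]_w H (U w, iid_obs X (addn t0) n 0 w)).
  apply: ge0_ae_eq_integral => //.
  - apply: (measurableT_comp mH); apply: measurable_fun_pair.
      exact: measurable_past.
    exact: measurable_obs_block.
  - apply: (measurableT_comp mH); apply: measurable_fun_pair => //.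
    exact: measurable_iid_obs.
  apply: filterS ae_y => w y1 _; congr H; congr pair.
    suff h k : past k w = past_obs X S k w by exact: h.
    elim: k => [//|k IH] /=; rewrite IH//.
    by apply/val_inj => /=; congr cons; rewrite /X /= y1.
  rewrite iid_obsE; apply: eq_from_tnth => i; rewrite !tnth_mktuple add0n /X y1//.
  by rewrite addn_gt0 t0_gt0.
rewrite [LHS](integral_iid_obs mX ia mU indZ Xa mH H0).
pose f (u : t0.-1.-tuple V) := \int[tuple_measure (lebesgue_cV R K) n]_v
  (H (u, v) * (white_lik v)%:E).
have L0 v : (0 <= white_lik v)%R by apply: lik_ge0 => i m z; exact: gaussian_pdf_ge0.
have HL0 p : 0 <= H p * (white_lik p.2)%:E by rewrite mule_ge0// lee_fin.
have mf : measurable_fun setT f.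
  apply: (measurable_fun_fubini_tonelli_F (m2 := tuple_measure (lebesgue_cV R K) n)
    (fun p => H p * (white_lik p.2)%:E)) => //.
  apply: emeasurable_funM => //; apply/measurable_EFinP.
  apply: (@measurable_lik _ _ _ _ _ _ _ _ _ _ (cst 0%R) snd) => // i.
    exact: measurable_gaussian_pdf.
  exact: measurable_fst.
have f0 u : 0 <= f u by apply: integral_ge0 => v _; exact: (HL0 (u, v)).
have Xap j : has_density P (X j.+1) (lebesgue_cV R K) (gaussian_pdf 0 1%:M).
  exact: Dnu.
exact: (integral_past_obs mX succn_inj Dap ind Xap mf f0).
Qed.

End change_model_laws.

(** * Competing likelihoods *)

Section densities.
Context d (Omega : measurableType d) (R : realType) (P : probability Omega R).
Context d' (U : measurableType d') (mu : {sigma_finite_measure set U -> \bar R}).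
Local Open Scope ereal_scope.

Lemma has_density_ae (X : Omega -> U) (f : U -> R) (B : set U) :
  has_density P X mu f -> measurable B -> mu B = 0 -> P (X @^-1` B) = 0.
Proof.
move=> [mf f0 fE] mB B0; rewrite fE//; apply: null_set_integral => //.
by apply/measurable_EFinP; exact: measurable_funTS.
Qed.

(** The two densities of X2 differ on a mu-null set, which X avoids P-almost surely. P and P2 may
    differ, so versions of the no-change density can be compared under the change law. *)
Lemma has_density_unique d2 (Omega2 : measurableType d2) (P2 : probability Omega2 R)
    (X : Omega -> U) (X2 : Omega2 -> U) (f g f2 : U -> R) :
  measurable_fun setT X ->
  has_density P X mu f -> has_density P2 X2 mu f2 -> has_density P2 X2 mu g ->
  \forall w \ae P, f2 (X w) = g (X w).
Proof.
move=> mX Xf [mf2 f20 f2E] [mg g0 gE].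
have i2 : mu.-integrable setT (EFin \o f2).
  apply/integrableP; split; first exact/measurable_EFinP.
  under eq_integral do rewrite gee0_abs ?lee_fin//.
  by rewrite -f2E// preimage_setT probability_setT ltry.
have := @integral_ae_eq _ U R mu setT measurableT (EFin \o g) (EFin \o f2) i2.
move=> /(_ _ _)/wrap[|E _ mE|]; first exact/measurable_EFinP.
  by rewrite -f2E// gE.
move=> [N [mN N0 sN]].
have PN := has_density_ae Xf mN N0.
exists (X @^-1` N); split=> //; first by rewrite -[X in measurable X]setTI; exact: mX.
move=> w /= h; apply: sN => /= fg; apply: h.
by have := fg I => -[].
Qed.

End densities.

Section competitor.
Context d (Omega : measurableType d) (R : realType) (P : probability Omega R).
Context (dU : nat -> measure_display) (U : forall n, measurableType (dU n)).
Variables (mu : forall n, {sigma_finite_measure set (U n) -> \bar R}).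
Variables (X : forall n, Omega -> U n) (f q : forall n, U n -> R).
Hypothesis mX : forall n, measurable_fun setT (X n).
Hypothesis Xf : forall n, has_density P (X n) (mu n) (@f n).
Hypothesis mq : forall n, measurable_fun setT (@q n).
Hypothesis q0 : forall n u, 0 <= @q n u.
Hypothesis q1 : forall n, (\int[mu n]_u (@q n u)%:E <= 1)%E.

Let badU (e : R) n : set (U n) := [set u | expR (e * n%:R) * @f n u <= @q n u].
Let bad (e : R) n : set Omega := X n @^-1` (@badU e n).

Let mbadU e n : measurable (@badU e n).
Proof.
have [mf _ _] := Xf n.
rewrite -[X in measurable X]setTI.
by apply: (measurable_fun_le measurableT) => //; apply: measurable_funM.
Qed.

Let mbad e n : measurable (bad e n).
Proof. by rewrite -[X in measurable X]setTI; exact: mX. Qed.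

(** On the bad set f is at most exp (- e n) q, and q has mass at most 1. *)
Let bad_le e n : (P (bad e n) <= (expR (- e) ^+ n)%:E)%E.
Proof.
have [mf f0 fE] := Xf n.
rewrite /bad (fE _ (mbadU e n)).
have mqE : measurable_fun setT (fun u => (@q n u)%:E) by exact/measurable_EFinP.
apply: (@le_trans _ _ (\int[mu n]_(u in @badU e n)
   ((expR (- e) ^+ n)%:E * (@q n u)%:E))%E).
  apply: ge0_le_integral => //.
  - by move=> u _; rewrite lee_fin.
  - by apply/measurable_EFinP; exact: measurable_funTS.
  - by apply: emeasurable_funM => //; exact: measurable_funTS.
  - move=> u /= h; rewrite -EFinM lee_fin.
    have -> : expR (- e) ^+ n = (expR (e * n%:R))^-1.
      by rewrite -expRM_natl mulrN expRN [n%:R * e]mulrC.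
    by rewrite mulrC ler_pdivlMr ?expR_gt0// mulrC.
apply: (@le_trans _ _ (\int[mu n]_u ((expR (- e) ^+ n)%:E * (@q n u)%:E))%E).
  apply: ge0_subset_integral => //; first by apply: emeasurable_funM.
  by move=> u _; rewrite mule_ge0 ?lee_fin ?exprn_ge0 ?expR_ge0.
rewrite ge0_integralZl// ?lee_fin ?exprn_ge0 ?expR_ge0//; last first.
  by move=> u _; rewrite lee_fin.
by rewrite -[leRHS]mule1 lee_wpmul2l// lee_fin exprn_ge0 ?expR_ge0.
Qed.

(* Markov's inequality for the likelihood ratio [q n / f n], then Borel-Cantelli. *)
Lemma competitor_ae : \forall w \ae P, forall e : R, 0 < e ->
  \forall n \near \oo, @q n (X n w) <= expR (e * n%:R) * @f n (X n w).
Proof.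
(* The levels 1 / (j + 1) suffice for all e > 0 and keep the exceptional sets countable. *)
have H (j : nat) : P.-negligible (lim_sup_set (bad j.+1%:R^-1)).
  set e := j.+1%:R^-1; have e0 : 0 < e by rewrite invr_gt0.
  exists (lim_sup_set (bad e)); split => //.
    by apply: bigcapT_measurable => k; apply: bigcup_measurable.
  apply: lim_sup_set_cvg0 => //.
  have r1 : `|expR (- e)| < 1.
    by rewrite ger0_norm ?expR_ge0// -[ltRHS]expR0 ltr_expR oppr_lt0.
  apply: (@le_lt_trans _ _ (\sum_(n <oo) (expR (- e) ^+ n)%:E)%E).
    by apply: lee_nneseries => // n _; exact: bad_le.
  have /= h := @cvg_geometric_series R 1 _ r1.
  rewrite (_ : (\sum_(n <oo) _)%E = (limn (series (geometric 1 (expR (- e)))))%:E).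
    exact: ltry.
  rewrite -EFin_lim//; last by apply/cvg_ex; eexists; exact: h.
  apply: congr_lim; apply/funext => n /=.
  by rewrite /series /= -sumEFin; apply: eq_bigr => k _; rewrite /= mul1r.
have [M [mM M0 sM]] := negligible_bigcup H.
exists M; split => // w /= nw; apply: sM; apply: contrapT => nU; apply: nw => e e0.
have [j je] := @filter_ex _ _ _ _ (near_infty_natSinv_lt (PosNum e0)).
have : ~ lim_sup_set (bad j.+1%:R^-1) w by move=> h; apply: nU; exists j.
move=> /existsNP[N] /not_implyP[_ nN]; exists N => // n /= Nn.
have : ~ bad j.+1%:R^-1 n w by move=> h; apply: nN; exists n.
rewrite /bad /= => /negP; rewrite -ltNge => /ltW /le_trans; apply.
have [_ f0 _] := Xf n.
by rewrite ler_wpM2r// ler_expR ler_wpM2r// ltW.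
Qed.

End competitor.

(** * Averages *)

Section average_bounds.
Context {R : realType}.
Implicit Types (a b h : nat -> R) (c e k : R).

(** The upper limit of the averages is at most c. The one-sided notion is basic because a competitor
    yields only an upper bound. *)
Definition avg_le a c := forall e, 0 < e ->
  \forall n \near \oo, \sum_(0 <= j < n) a j <= (c + e) * n%:R.

Lemma le_near_mulrn c e : 0 < e -> \forall n \near \oo, c <= e * n%:R.
Proof.
move=> e0; near=> n; rewrite mulrC -ler_pdivrMr//.
near: n; exact: nbhs_infty_ger.
Unshelve. all: by end_near. Qed.

Lemma avg_leD a b c k : avg_le a c -> avg_le b k -> avg_le (fun j => a j + b j) (c + k).
Proof.
move=> ac bk e e0; have e2 : 0 < e / 2 by rewrite divr_gt0.
near=> n; rewrite big_split/=.
have h1 : \sum_(0 <= j < n) a j <= (c + e / 2) * n%:R by near: n; exact: ac.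
have h2 : \sum_(0 <= j < n) b j <= (k + e / 2) * n%:R by near: n; exact: bk.
by apply: (le_trans (lerD h1 h2)); rewrite -mulrDl ler_wpM2r//; lra.
Unshelve. all: by end_near. Qed.

Lemma avg_leZ k a c : 0 <= k -> avg_le a c -> avg_le (fun j => k * a j) (k * c).
Proof.
rewrite le_eqVlt => /predU1P[<-|k0] ac e e0.
  apply: nearW => n; rewrite mul0r add0r big1 ?mulr_ge0 ?(ltW e0)// => j _.
  by rewrite mul0r.
near=> n; rewrite -mulr_sumr.
have h1 : \sum_(0 <= j < n) a j <= (c + e / k) * n%:R.
  by near: n; apply: ac; rewrite divr_gt0.
apply: (le_trans (ler_wpM2l (ltW k0) h1)); rewrite mulrA ler_wpM2r//.
by rewrite mulrDr mulrCA divff ?mulr1// gt_eqF.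
Unshelve. all: by end_near. Qed.

Lemma avg_le_sub a b c k : (forall j, a j <= b j) -> c <= k -> avg_le b c -> avg_le a k.
Proof.
move=> ab ck bc e e0; near=> n.
have h1 : \sum_(0 <= j < n) b j <= (c + e) * n%:R by near: n; exact: bc.
apply: (le_trans (ler_sum _ (fun j _ => ab j))); apply: (le_trans h1).
by rewrite ler_wpM2r// lerD2r.
Unshelve. all: by end_near. Qed.

Lemma eq_avg_le a b c : (forall j, a j = b j) -> avg_le b c -> avg_le a c.
Proof. by move=> ab; apply: avg_le_sub => // j; rewrite ab. Qed.

Lemma avg_le_cst c : avg_le (fun=> c) c.
Proof.
move=> e e0; apply: nearW => n.
by rewrite sumr_const_nat subn0 -[c *+ n]mulr_natr ler_wpM2r// lerDl ltW.
Qed.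

Lemma avg_le_cst_le c k : avg_le (fun=> c) k -> c <= k.
Proof.
move=> ck; rewrite leNgt; apply/negP => kc.
have e0 : 0 < (c - k) / 2 by rewrite divr_gt0// subr_gt0.
have [n [h n0]] : exists n, \sum_(0 <= j < n) c <= (k + (c - k) / 2) * n%:R /\ (0 < n)%N.
  have h1 := ck _ e0; have h2 : \forall n \near \oo, (0 < n)%N by exact: nbhs_infty_gt.
  by have [n []] := @filter_ex _ _ _ _ (filterI h1 h2); exists n.
move: h; rewrite sumr_const_nat subn0 -[c *+ n]mulr_natr ler_pM2r ?ltr0n//.
by apply/negP; rewrite -ltNge; lra.
Qed.

Lemma avg_le_inf a c (f : nat -> R) : (forall n, avg_le a (f n)) ->
  f n @[n --> \oo] --> c -> avg_le a c.
Proof.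
move=> af fc e e0.
have e2 : 0 < e / 2 by rewrite divr_gt0.
have [i ci] : exists i, f i <= c + e / 2.
  apply: (@filter_ex _ (nbhs \oo)); apply: (cvgr_le c fc).
  by rewrite ltrDl.
near=> n; have : \sum_(0 <= j < n) a j <= (f i + e / 2) * n%:R by near: n; exact: af.
by move=> /le_trans; apply; rewrite ler_wpM2r//; lra.
Unshelve. all: by end_near. Qed.

(** Once f is below d, the sum is at most d times the sum of b, and the finitely many earlier terms
    are negligible against n. It serves to replace convergent coefficients by their limits. *)
Lemma avg_le_near0 a b c (f : nat -> R) : (forall j, a j <= f j * b j) ->
  (forall j, 0 <= b j) -> f n @[n --> \oo] --> (0 : R) -> avg_le b c -> avg_le a 0.
Proof.
move=> afb b0 f0 bc e e0.
have c1 : 0 < `|c| + 1 by rewrite ltr_wpDl.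
pose d := e / (2 * (`|c| + 1)).
have d0 : 0 < d by rewrite divr_gt0// mulr_gt0.
have [N _ fd] : \forall n \near \oo, f n <= d by exact: (cvgr_le 0 f0).
pose B := \sum_(0 <= j < N) a j.
have e2 : 0 < e / 2 by rewrite divr_gt0.
near=> n.
have Nn : (N <= n)%N by near: n; exact: nbhs_infty_ge.
have hb : \sum_(0 <= j < n) b j <= (c + 1) * n%:R by near: n; exact: bc.
have hB : B <= e / 2 * n%:R by near: n; exact: le_near_mulrn.
rewrite (@big_cat_nat _ _ _ N)//= -/B add0r.
have : \sum_(N <= j < n) a j <= d * \sum_(0 <= j < n) b j.
  rewrite [X in _ <= _ * X](@big_cat_nat _ _ _ N)//= mulrDr.
  rewrite -[X in X <= _]add0r lerD//; first by rewrite mulr_ge0 ?(ltW d0)// sumr_ge0.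
  rewrite mulr_sumr; apply: ler_sum_nat => j /andP[Nj _].
  by apply: (le_trans (afb j)); rewrite ler_wpM2r//; exact: fd.
have h3 : d * \sum_(0 <= j < n) b j <= e / 2 * n%:R.
  apply: (le_trans (ler_wpM2l (ltW d0) hb)).
  apply: (@le_trans _ _ (d * ((`|c| + 1) * n%:R))).
    by rewrite ler_wpM2l ?(ltW d0)// ler_wpM2r// lerD2r ler_norm.
  rewrite mulrA ler_wpM2r// /d -mulrA; rewrite ler_pM2l//.
  by rewrite invfM -mulrA mulVf ?mulr1// gt_eqF.
move=> h2; have := le_trans h2 h3 => h4.
by apply: (le_trans (lerD hB h4)); rewrite -mulrDl ler_wpM2r//; lra.
Unshelve. all: by end_near. Qed.

Lemma avg_le_cvg a c : a n @[n --> \oo] --> c -> avg_le a c.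
Proof.
move=> ac.
have h : avg_le (fun j => a j - c) 0.
  apply: (@avg_le_near0 _ (fun=> 1) 1 (fun j => a j - c)) => //.
  - by move=> j; rewrite mulr1.
  - by rewrite -(subrr c); apply: cvgB => //; exact: cvg_cst.
  - exact: avg_le_cst.
rewrite -[c]add0r; apply: eq_avg_le (avg_leD h (avg_le_cst c)) => j.
by rewrite subrK.
Qed.

Definition avg_cvg a c := avg_le a c /\ avg_le (fun j => - a j) (- c).

Lemma avg_cvgD a b c k : avg_cvg a c -> avg_cvg b k ->
  avg_cvg (fun j => a j + b j) (c + k).
Proof.
move=> [h1 h2] [h3 h4]; split; first exact: avg_leD.
by rewrite opprD; apply: eq_avg_le (avg_leD h2 h4) => j; rewrite opprD.
Qed.

Lemma avg_cvgN a c : avg_cvg a c -> avg_cvg (fun j => - a j) (- c).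
Proof. by move=> [h1 h2]; split => //; rewrite opprK; apply: eq_avg_le h1 => j; rewrite opprK. Qed.

Lemma avg_cvgZ k a c : avg_cvg a c -> avg_cvg (fun j => k * a j) (k * c).
Proof.
have P (l : R) : 0 <= l -> avg_cvg a c -> avg_cvg (fun j => l * a j) (l * c).
  move=> l0 [h1 h2]; split; first exact: avg_leZ.
  by rewrite -mulrN; apply: eq_avg_le (avg_leZ l0 h2) => j; rewrite mulrN.
move=> ac; have [k0|k0] := leP 0 k; first exact: P.
have nk : 0 <= - k by rewrite oppr_ge0 ltW.
have [h1 h2] := avg_cvgN (P _ nk ac); split.
  by rewrite mulNr opprK in h1; apply: eq_avg_le h1 => j; rewrite mulNr opprK.
by rewrite mulNr opprK in h2; apply: eq_avg_le h2 => j; rewrite mulNr opprK.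
Qed.

Lemma avg_cvg_cvg a c : a n @[n --> \oo] --> c -> avg_cvg a c.
Proof. by move=> ac; split; apply: avg_le_cvg => //; exact: cvgN. Qed.

Lemma avg_cvg_near0 a b c (f : nat -> R) : (forall j, `|a j| <= f j * b j) ->
  (forall j, 0 <= b j) -> f n @[n --> \oo] --> (0 : R) -> avg_le b c -> avg_cvg a 0.
Proof.
move=> afb b0 f0 bc; split; rewrite ?oppr0; apply: avg_le_near0 b0 f0 bc => j.
  exact: le_trans (ler_norm _) (afb j).
by apply: le_trans (afb j); rewrite -normrN ler_norm.
Qed.

Lemma eq_avg_cvg a b c : (forall j, a j = b j) -> avg_cvg b c -> avg_cvg a c.
Proof. by move=> ab [h1 h2]; split; [exact: eq_avg_le h1|apply: eq_avg_le h2 => j; rewrite ab]. Qed.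

Lemma avg_cvgP a c : avg_cvg a c -> (n%:R^-1 * \sum_(0 <= j < n) a j) @[n --> \oo] --> c.
Proof.
move=> [h1 h2]; apply/cvgrPdist_le => e e0; near=> n.
have n0 : 0 < n%:R :> R by rewrite ltr0n; near: n; exact: nbhs_infty_gt.
have k1 : \sum_(0 <= j < n) a j <= (c + e) * n%:R by near: n; exact: h1.
have k2 : \sum_(0 <= j < n) - a j <= (- c + e) * n%:R by near: n; exact: h2.
rewrite sumrN in k2.
rewrite ler_norml; apply/andP; split.
  by rewrite lerBrDl lerBlDr mulrC ler_pdivrMr.
rewrite lerBlDr -lerBlDl mulrC ler_pdivlMr//.
by rewrite -lerN2 -mulNr; apply: (le_trans k2); rewrite ler_wpM2r//; lra.
Unshelve. all: by end_near. Qed.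

(** A term is the difference of two consecutive partial sums, so both sides of the limit enter. *)
Lemma avg_cvg_last a c : (forall j, 0 <= a j) -> avg_cvg a c ->
  forall e, 0 < e -> \forall n \near \oo, a n <= e * n%:R.
Proof.
move=> a0 [h1 h2] e e0; have e4 : 0 < e / 4 by rewrite divr_gt0.
have e2 : 0 < e / 2 by rewrite divr_gt0.
near=> n.
have k1 : \sum_(0 <= j < n.+1) a j <= (c + e / 4) * n.+1%:R.
  near: n; have [N _ hN] := h1 _ e4; exists N => // n /= Nn; apply: hN => /=.
  exact: leqW.
have k2 : \sum_(0 <= j < n) - a j <= (- c + e / 4) * n%:R by near: n; exact: h2.
have k3 : c + e / 4 <= e / 2 * n%:R by near: n; exact: le_near_mulrn.
rewrite sumrN in k2; rewrite big_nat_recr//= -[n.+1%:R]natr1 in k1.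
by lra.
Unshelve. all: by end_near. Qed.

(** Once g n <= e / 2 * (1 - beta) * n, the bound b N + e / 2 * n reproduces itself under the
    recursion. *)
Lemma recursion_last (b g : nat -> R) (beta : R) : 0 <= beta -> beta < 1 ->
  (forall n, 0 <= b n) -> (forall n, b n.+1 <= beta * b n + g n) ->
  (forall e, 0 < e -> \forall n \near \oo, g n <= e * n%:R) ->
  forall e, 0 < e -> \forall n \near \oo, b n <= e * n%:R.
Proof.
move=> be0 be1 b0 bS gl e e0; have be2 : 0 < 1 - beta by rewrite subr_gt0.
pose d := e / 2 * (1 - beta).
have d0 : 0 < d by rewrite mulr_gt0// divr_gt0.
have [N _ gN] := gl _ d0.
have H (k : nat) : b (N + k)%N <= b N + e / 2 * (N + k)%:R.
  elim: k => [|k IH]; first by rewrite addn0 lerDl mulr_ge0// ltW// divr_gt0.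
  rewrite addnS; apply: (le_trans (bS _)).
  have hg := gN (N + k)%N (leq_addr _ _).
  have h1 : beta * b (N + k)%N <= beta * (b N + e / 2 * (N + k)%:R) by rewrite ler_wpM2l.
  have h2 : beta * b N <= b N by rewrite ler_piMl// ltW.
  have h3 : e / 2 * (N + k)%:R <= e / 2 * (N + k).+1%:R.
    by rewrite ler_wpM2l ?ler_nat// ltW// divr_gt0.
  rewrite /= /d in hg; rewrite mulrDr in h1.
  have h4 : beta * (e / 2 * (N + k)%:R) + e / 2 * (1 - beta) * (N + k)%:R = e / 2 * (N + k)%:R.
    ring.
  lra.
near=> n.
have Nn : (N <= n)%N by near: n; exact: nbhs_infty_ge.
have hB : b N <= e / 2 * n%:R by near: n; apply: le_near_mulrn; rewrite divr_gt0.
have := H (n - N)%N; rewrite subnKC// => /le_trans; apply.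
have : e / 2 * n%:R + e / 2 * n%:R = e * n%:R by field.
lra.
Unshelve. all: by end_near. Qed.

Lemma recursion_sum (b g : nat -> R) (beta : R) n :
  (forall n, b n.+1 <= beta * b n + g n) ->
  (1 - beta) * \sum_(0 <= j < n) b j + b n <= b 0%N + \sum_(0 <= j < n) g j.
Proof.
move=> bS; elim: n => [|n IH]; first by rewrite !big_geq// mulr0 add0r addr0.
rewrite !big_nat_recr//= mulrDr; have := bS n; lra.
Qed.

Lemma recursion_avg (b g : nat -> R) (beta c : R) : beta < 1 ->
  (forall n, 0 <= b n) -> (forall n, b n.+1 <= beta * b n + g n) ->
  avg_le g c -> avg_le b (c / (1 - beta)).
Proof.
move=> be1 b0 bS gc e e0; have be2 : 0 < 1 - beta by rewrite subr_gt0.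
pose d := e * (1 - beta) / 2; have d0 : 0 < d by rewrite divr_gt0// mulr_gt0.
near=> n.
have h1 : \sum_(0 <= j < n) g j <= (c + d) * n%:R by near: n; exact: gc.
have h2 : b 0%N <= d * n%:R by near: n; exact: le_near_mulrn.
have h3 := recursion_sum n bS.
rewrite -(ler_pM2l be2) mulrA mulrDr mulrCA divff ?gt_eqF// mulr1.
have h4 : (c + (1 - beta) * e) * n%:R = (c + d) * n%:R + d * n%:R.
  by rewrite -mulrDl /d; congr (_ * _); field.
have := b0 n; lra.
Unshelve. all: by end_near. Qed.

Lemma avg_cvg_telescope h : (forall e, 0 < e -> \forall n \near \oo, `|h n| <= e * n%:R) ->
  avg_cvg (fun j => h j - h j.+1) 0.
Proof.
move=> hl.
have T n : \sum_(0 <= j < n) (h j - h j.+1) = h 0%N - h n.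
  elim: n => [|n IH]; first by rewrite big_geq// subrr.
  by rewrite big_nat_recr//= IH addrA subrK.
split=> e e0; have e2 : 0 < e / 2 by rewrite divr_gt0.
- near=> n; rewrite T add0r.
  have h1 : `|h n| <= e / 2 * n%:R by near: n; exact: hl.
  have h2 : h 0%N <= e / 2 * n%:R by near: n; exact: le_near_mulrn.
  have := ler_norm (- h n); rewrite normrN => h3.
  have : e / 2 * n%:R + e / 2 * n%:R = e * n%:R by field.
  lra.
- near=> n; rewrite sumrN T oppr0 add0r.
  have h1 : `|h n| <= e / 2 * n%:R by near: n; exact: hl.
  have h2 : - h 0%N <= e / 2 * n%:R by near: n; exact: le_near_mulrn.
  have := ler_norm (h n) => h3.
  have : e / 2 * n%:R + e / 2 * n%:R = e * n%:R by field.
  lra.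
Unshelve. all: by end_near. Qed.

End average_bounds.

(** * Limits of matrices *)

Section matrix_convergence.
Context {R : realType}.

Definition mcvg m n (X : nat -> 'M[R]_(m, n)) (L : 'M[R]_(m, n)) : Prop :=
  forall i j, X k i j @[k --> \oo] --> L i j.

Lemma cvg_sumr (I : Type) (r : seq I) (f : I -> nat -> R) (l : I -> R) :
  (forall i, f i k @[k --> \oo] --> l i) ->
  (\sum_(i <- r) f i k) @[k --> \oo] --> \sum_(i <- r) l i.
Proof. by move=> fl; apply: cvg_big => //; exact: add_continuous. Qed.

Lemma cvg_prodr (I : Type) (r : seq I) (f : I -> nat -> R) (l : I -> R) :
  (forall i, f i k @[k --> \oo] --> l i) ->
  (\prod_(i <- r) f i k) @[k --> \oo] --> \prod_(i <- r) l i.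
Proof. by move=> fl; apply: cvg_big => //; exact: mul_continuous. Qed.

Lemma mcvg_cst m n (L : 'M[R]_(m, n)) : mcvg (fun=> L) L.
Proof. by move=> i j; exact: cvg_cst. Qed.

Lemma mcvgD m n (X Y : nat -> 'M[R]_(m, n)) L M : mcvg X L -> mcvg Y M ->
  mcvg (fun k => X k + Y k) (L + M).
Proof.
by move=> XL YM i j; rewrite mxE; under eq_cvg do rewrite mxE; exact: cvgD.
Qed.

Lemma mcvgN m n (X : nat -> 'M[R]_(m, n)) L : mcvg X L ->
  mcvg (fun k => - X k) (- L).
Proof. by move=> XL i j; rewrite mxE; under eq_cvg do rewrite mxE; exact: cvgN. Qed.

Lemma mcvgB m n (X Y : nat -> 'M[R]_(m, n)) L M : mcvg X L -> mcvg Y M ->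
  mcvg (fun k => X k - Y k) (L - M).
Proof. by move=> XL YM; apply: mcvgD => //; exact: mcvgN. Qed.

Lemma mcvgM m n p (X : nat -> 'M[R]_(m, n)) (Y : nat -> 'M[R]_(n, p)) L M :
  mcvg X L -> mcvg Y M -> mcvg (fun k => X k *m Y k) (L *m M).
Proof.
move=> XL YM i j; rewrite mxE; under eq_cvg do rewrite mxE.
by apply: cvg_sumr => l; exact: cvgM.
Qed.

Lemma mcvgT m n (X : nat -> 'M[R]_(m, n)) L : mcvg X L ->
  mcvg (fun k => (X k)^T) L^T.
Proof. by move=> XL i j; rewrite mxE; under eq_cvg do rewrite mxE; exact: XL. Qed.

Lemma mcvgS m n (X : nat -> 'M[R]_(m, n)) L : mcvg X L -> mcvg (fun k => X k.+1) L.
Proof. by move=> XL i j; have := XL i j; rewrite -(cvg_shiftS (fun k => X k i j)). Qed.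

Lemma mcvg_unique m n (X : nat -> 'M[R]_(m, n)) L M : mcvg X L -> mcvg X M -> L = M.
Proof.
move=> XL XM; apply/matrixP => i j.
exact: (@cvg_unique _ (@Rhausdorff R) _ _ _ _ (XL i j) (XM i j)).
Qed.

Lemma eq_mcvg m n (X Y : nat -> 'M[R]_(m, n)) L : (forall k, X k = Y k) ->
  mcvg Y L -> mcvg X L.
Proof. by move=> XY YL i j; under eq_cvg do rewrite XY; exact: YL. Qed.

Lemma cvg_det n (X : nat -> 'M[R]_n) L : mcvg X L ->
  \det (X k) @[k --> \oo] --> \det L.
Proof.
move=> XL; rewrite /determinant; apply: cvg_sumr => s.
by apply: cvgM; [exact: cvg_cst|apply: cvg_prodr => i; exact: XL].
Qed.

Lemma cvg_quad n (X : nat -> 'M[R]_n) L v : mcvg X L ->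
  quad (X k) v @[k --> \oo] --> quad L v.
Proof.
move=> XL; apply: mcvgM; first exact: mcvg_cst.
by apply: mcvgM => //; exact: mcvg_cst.
Qed.

Lemma cvg_frob0 n (X : nat -> 'M[R]_n) L : mcvg X L ->
  frob (X k - L) @[k --> \oo] --> (0 : R).
Proof.
move=> XL; have -> : (0 : R) = \sum_(i < n) \sum_(j < n) 0 * 0.
  by rewrite big1 // => i _; rewrite big1// => j _; rewrite mulr0.
under eq_cvg do rewrite frobE.
apply: cvg_sumr => i; apply: cvg_sumr => j; under eq_cvg do rewrite expr2 !mxE.
have h : (X k i j - L i j) @[k --> \oo] --> (0 : R).
  by rewrite -(subrr (L i j)); apply: cvgB; [exact: XL|exact: cvg_cst].
exact: cvgM.
Qed.

Lemma mcvg_frob n (X : nat -> 'M[R]_n) L : frob (X k - L) @[k --> \oo] --> (0 : R) ->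
  mcvg X L.
Proof.
move=> XL i j; apply/cvgrPdist_lt => e e0.
have e20 : 0 < e ^+ 2 by rewrite exprn_gt0.
near=> k.
have h : frob (X k - L) < e ^+ 2.
  near: k; apply: (cvgr_lt 0 XL); exact: e20.
rewrite distrC -(@ltr_pXn2r _ 2)// ?nnegrE ?(ltW e0)//.
rewrite real_normK ?num_real//; apply: le_lt_trans h.
by have := entry_frob (X k - L) i j; rewrite !mxE.
Unshelve. all: by end_near. Qed.

Lemma dotv_mul_le n (X : 'M[R]_n) u v :
  `|dotv u (X *m v)| <= Num.sqrt (frob X) * (2^-1 * (dotv u u + dotv v v)).
Proof.
have a0 := dotvv_ge0 u; have b0 := dotvv_ge0 v; have f0 := frob_ge0 X.
have r0 : 0 <= Num.sqrt (frob X) * (2^-1 * (dotv u u + dotv v v)).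
  by rewrite mulr_ge0 ?sqrtr_ge0// mulr_ge0// addr_ge0.
rewrite -(@ler_pXn2r _ 2)// ?nnegrE// real_normK ?num_real//.
apply: (le_trans (dotv_CS _ _)); rewrite exprMn sqr_sqrtr//.
apply: (@le_trans _ _ (dotv u u * (frob X * dotv v v))).
  by rewrite ler_wpM2l// dotv_mulmx_frob.
rewrite mulrCA ler_wpM2l//.
have := sqr_ge0 (dotv u u - dotv v v); nra.
Qed.

Lemma quad_le n (X : 'M[R]_n) v : `|quad X v| <= Num.sqrt (frob X) * dotv v v.
Proof.
apply: (le_trans (dotv_mul_le _ _ _)); rewrite ler_wpM2l ?sqrtr_ge0//.
by rewrite -mulr2n -(mulr_natl (dotv v v)) mulrA mulVf ?mul1r.
Qed.

Lemma cvg_sqrt_frob0 n (X : nat -> 'M[R]_n) L : mcvg X L ->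
  Num.sqrt (frob (X k - L)) @[k --> \oo] --> (0 : R).
Proof.
move=> XL; rewrite -(sqrtr0 R).
by apply: (cvg_comp _ _ (cvg_frob0 XL)); exact: sqrt_continuous.
Qed.

Lemma mcvg_bounded n (X : nat -> 'M[R]_n) L : mcvg X L ->
  exists2 C, 0 < C & forall k v, `|quad (X k) v| <= C * dotv v v.
Proof.
move=> XL; have h : Num.sqrt (frob (X k)) @[k --> \oo] --> Num.sqrt (frob L).
  apply: (@cvg_comp _ _ _ _ _ _ (nbhs (frob L)) _); last exact: sqrt_continuous.
  rewrite frobE; under eq_cvg do rewrite frobE.
  apply: cvg_sumr => i; apply: cvg_sumr => j; under eq_cvg do rewrite expr2.
  by rewrite expr2; apply: cvgM; exact: XL.
have [M [_ HM]] := cvg_seq_bounded (cvgP _ h).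
exists (`|M| + 2) => [|k v]; first by rewrite ltr_wpDl.
apply: (le_trans (quad_le _ _)); rewrite ler_wpM2r ?dotvv_ge0//.
have hM : M < `|M| + 2 by rewrite (le_lt_trans (ler_norm _))// ltrDl.
by have := HM _ hM k I; rewrite /= ger0_norm ?sqrtr_ge0.
Qed.

(** Increments decay geometrically in every entry; the ratio is the square root of c because [frob]
    is a squared norm. *)
Lemma mcvg_contraction n (X : nat -> 'M[R]_n) (c : R) : 0 <= c -> c < 1 ->
  (forall k, frob (X k.+2 - X k.+1) <= c * frob (X k.+1 - X k)) ->
  exists L, mcvg X L.
Proof.
move=> c0 c1 Xc.
pose r := Num.sqrt c; pose C := Num.sqrt (frob (X 1%N - X 0%N)).
have r0 : 0 <= r by exact: sqrtr_ge0.
have r1 : `|r| < 1 by rewrite ger0_norm// -sqrtr1 ltr_sqrt.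
have hX k : frob (X k.+1 - X k) <= c ^+ k * frob (X 1%N - X 0%N).
  elim: k => [|k IH]; first by rewrite mul1r.
  by apply: (le_trans (Xc k)); rewrite exprS -mulrA ler_wpM2l.
have cv i j : cvgn (fun k => X k i j).
  pose u k := X k i j.
  have hu : u = fun k => u 0%N + series (telescope u) k.
    by apply/funext => k; exact: eq_sum_telescope.
  rewrite -/u hu; apply: is_cvgD; first exact: is_cvg_cst.
  apply: (@normed_cvg R R^o).
  apply: (@series_le_cvg _ _ (geometric C r)) => //.
  - by move=> k; exact: normr_ge0.
  - by move=> k; rewrite /geometric /= mulr_ge0 ?sqrtr_ge0// exprn_ge0.
  - move=> k; rewrite /telescope /u /geometric/=.
    rewrite -(@ler_pXn2r _ 2)// ?nnegrE ?mulr_ge0 ?exprn_ge0 ?sqrtr_ge0//.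
    rewrite real_normK ?num_real// exprMn sqr_sqrtr ?frob_ge0// mulrC.
    rewrite -exprM mulnC exprM sqr_sqrtr//; apply: le_trans (hX k).
    by have := entry_frob (X k.+1 - X k) i j; rewrite !mxE.
  - exact: is_cvg_geometric_series.
exists (\matrix_(i, j) limn (fun k => X k i j)) => i j; rewrite mxE; exact: cv.
Qed.

End matrix_convergence.

(** * First-order expansion of the log-determinant *)

Section log_det_expansion.
Context {R : realType} {K : nat}.

Lemma horner_char_poly_det (M : 'M[R]_K) (t : R) : (char_poly M).[t] = \det (t%:M - M).
Proof.
rewrite /char_poly -horner_evalE -det_map_mx; congr determinant.
apply/matrixP => i j; rewrite !mxE /horner_eval.
by rewrite [LHS](horner_evalE t) hornerD hornerN hornerC hornerMn hornerX.
Qed.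

(** As a function of h, det (1 - h M) is the characteristic polynomial with reversed coefficients:
    its value at 0 is 1 and its derivative there is - tr M. The limit is a difference quotient of
    its logarithm. *)
Lemma ln_det_expansion (M : 'M[R]_K) (s : nat -> R) : (0 < K)%N ->
  (forall n, s n != 0) -> s n @[n --> \oo] --> (0 : R) ->
  ((s n)^-1 * - ln (\det (1%:M - s n *: M))) @[n --> \oo] --> \tr M.
Proof.
move=> K0 s0 scvg.
pose p := \poly_(i < K.+1) (char_poly M)`_(K - i).
have pE h : h != 0 -> p.[h] = \det (1%:M - h *: M).
  move=> h0.
  have -> : 1%:M - h *: M = h *: (h^-1%:M - M).
    by rewrite scalerBr scale_scalar_mx divff.
  rewrite detZ -horner_char_poly_det horner_poly [in RHS](@horner_coef_wide _ K.+1); last first.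
    by rewrite size_char_poly.
  rewrite mulr_sumr (reindex_inj rev_ord_inj)/=; apply: eq_bigr => i _.
  rewrite subSS subKn; last by rewrite -ltnS.
  rewrite mulrCA; congr (_ * _).
  have -> : h ^+ K = h ^+ (K - i) * h ^+ i by rewrite -exprD subnK// -ltnS.
  by rewrite -mulrA exprVn divff ?mulr1// expf_neq0.
have p0 : p.[0] = 1.
  rewrite horner_coef0 coef_poly subn0.
  have := char_poly_monic M; rewrite monicE lead_coefE size_char_poly => /eqP /= ->.
  by [].
have p1 : p^`().[0] = - \tr M.
  rewrite horner_coef0 coef_deriv coef_poly mulr1n ltnS K0.
  by rewrite subn1 char_poly_trace.
have dp : is_derive (0 : R) 1 (horner p) (- \tr M).
  apply: DeriveDef; first exact: derivable_horner.
  by rewrite -derive1E -derivE p1.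
have dl : is_derive (0 : R) 1 (@ln R \o horner p) (1 * - \tr M).
  apply: is_derive1_comp => //; rewrite p0 -[X in is_derive _ _ _ X]invr1.
  by apply: is_derive1_ln.
have [dlx dlE] := dl.
have : (h^-1 *: ((@ln R \o horner p \o shift 0) (h *: 1) - (@ln R \o horner p) 0)) @[h --> 0^'] --> - \tr M.
  by rewrite -[X in _ --> X]mul1r -dlE; exact: dlx.
move=> /cvgr_dnbhsP/(_ s (conj s0 scvg)) /= H.
rewrite -[X in _ --> X]opprK.
apply: cvg_trans (cvgN H).
apply: near_eq_cvg; near=> n => /=.
rewrite p0 ln1; change (- ((s n)^-1 * (ln p.[s n * 1 + 0] - 0)) =
  (s n)^-1 * - ln (\det (1%:M - s n *: M))).
by rewrite subr0 addr0 mulr1 pE// mulrN.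
Unshelve. all: by end_near. Qed.

End log_det_expansion.

(** * Innovations of the Kalman filter *)

(** A substitute for the least eigenvalue: Cauchy-Schwarz for T between v and T^-1 v bounds |v|^4 by
    quad T v times quad T^-1 v, and the latter is at most q |v|^2. *)
Lemma posdef_lower (R : realType) K (T : 'M[R]_K) : posdefmx T ->
  exists2 c : R, 0 < c & forall v, c * dotv v v <= quad T v.
Proof.
move=> pT; have uT := posdef_unit pT; have [_ qT] := posdef_psd pT.
set q := Num.sqrt (frob (invmx T)) + 1.
have q0 : 0 < q by rewrite ltr_wpDl ?sqrtr_ge0.
exists q^-1 => [|v]; first by rewrite invr_gt0.
have [->|v0] := eqVneq v 0; first by rewrite dot0v mulr0.
have vgt := dotvv_gt0 v0.
rewrite mulrC ler_pdivrMr//.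
have := psd_CS v (invmx T *m v) (posdef_psd pT); rewrite mulmxVl//.
have -> : quad T (invmx T *m v) = quad (invmx T) v by rewrite {1}/quad mulmxVl// dotvC.
have h1 : quad (invmx T) v <= q * dotv v v.
  apply: (le_trans (ler_norm _)); apply: (le_trans (quad_le _ _)).
  by rewrite ler_wpM2r ?dotvv_ge0// lerDl.
move=> h; have := le_trans h (ler_wpM2l (qT v) h1).
by rewrite expr2 mulrA ler_pM2r.
Qed.

Section innovation_averages.
Context {R : realType} {K : nat}.
Local Notation V := 'cV[R]_K.
Hypothesis K_gt0 : (0 < K)%N.
Variables (alpha r : R) (A H S G : 'M[R]_K) (Sn Gn : nat -> 'M[R]_K).
Hypotheses (alpha0 : 0 <= alpha) (alpha1 : alpha < 1) (r0 : 0 < r).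
Hypothesis A_contr : forall v : V, dotv (A *m v) (A *m v) <= alpha * dotv v v.
Hypotheses (Hsym : H^T = H) (HE : H = 1%:M + A^T *m H *m A).
Hypotheses (pSn : forall j, posdefmx (Sn j)) (pS : posdefmx S).
Hypothesis Sn_ge : forall j v, (1 + r) * dotv v v <= quad (Sn j) v.
Hypotheses (SnS : mcvg Sn S) (iSnS : mcvg (fun j => invmx (Sn j)) (invmx S)) (GnG : mcvg Gn G).
Variables (m e : nat -> V).
Hypothesis mS : forall j, m j.+1 = A *m m j + Gn j *m e j.

(* [m j] is the predicted mean, [e j] the innovation: the observation is [m j + e j]. *)
Definition competitor_le (C Sigma : nat -> 'M[R]_K) : Prop :=
  avg_le (fun j => ln (gaussian_pdf (m j + C j *m m j) (Sigma j) (m j + e j)) -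
                   ln (gaussian_pdf (m j) (Sn j) (m j + e j))) 0.

(* Both signs occur so that dividing by the perturbation size turns the
   one-sided bounds [competitor_le] into two-sided limits. *)
Definition inv_sign (b : bool) (n : nat) : R := (-1) ^+ b / n.+1%:R.

Lemma inv_sign_neq0 b n : inv_sign b n != 0.
Proof. by rewrite mulf_neq0 ?signr_eq0// invr_eq0. Qed.

Lemma cvg_inv_sign b n0 : inv_sign b (n + n0)%N @[n --> \oo] --> (0 : R).
Proof.
rewrite -(mulr0 ((-1) ^+ b : R)); apply: cvgM; first exact: cvg_cst.
have := @cvg_harmonic R; rewrite -(cvg_shiftn n0).
by [].
Qed.

Lemma competitor_incE j C Sigma : posdefmx Sigma ->
  ln (gaussian_pdf (m j + C *m m j) Sigma (m j + e j)) -
  ln (gaussian_pdf (m j) (Sn j) (m j + e j)) =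
  2^-1 * (ln (\det (Sn j)) - ln (\det Sigma)) +
  2^-1 * (quad (invmx (Sn j)) (e j) - quad (invmx Sigma) (e j - C *m m j)).
Proof.
move=> pSi; rewrite !ln_gaussian_pdf//.
have -> : m j + e j - (m j + C *m m j) = e j - C *m m j by rewrite opprD addrACA subrr add0r.
have -> : m j + e j - m j = e j by rewrite addrC addKr.
by field.
Qed.

Let Q j := quad (invmx (Sn j)) (e j).
Let E j := dotv (e j) (e j).
Let M j := dotv (m j) (m j).

Let E0 j : 0 <= E j. Proof. exact: dotvv_ge0. Qed.
Let M0 j : 0 <= M j. Proof. exact: dotvv_ge0. Qed.
Let Q0 j : 0 <= Q j. Proof. by have [_ h] := posdef_psd (posdef_inv (pSn j)); exact: h. Qed.

Let ln_det_cvg : ln (\det (Sn j)) @[j --> \oo] --> ln (\det S).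
Proof.
apply: (cvg_comp _ _ (cvg_det SnS)); apply: continuous_ln.
exact: posdef_det_gt0.
Qed.

Hypothesis comp_double : competitor_le (fun=> 0) (fun j => 2 *: Sn j).

Lemma innovation_bound : exists C, (0 < C) /\ (forall j, E j <= C * Q j) /\
  (forall j v, quad (Sn j) v <= C * dotv v v).
Proof.
have [C C0 HC] := mcvg_bounded SnS.
have SC j v : quad (Sn j) v <= C * dotv v v by apply: le_trans (HC j v); exact: ler_norm.
exists C; split => //; split => // j.
have [->|e0] := eqVneq (E j) 0; first by rewrite mulr_ge0// ltW.
have Egt : 0 < E j by rewrite lt0r e0 E0.
have uS := posdef_unit (pSn j).
have := psd_CS (e j) (Sn j *m e j) (posdef_psd (posdef_inv (pSn j))).
rewrite mulVmxl// -/(Q j) -/(E j).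
have -> : quad (invmx (Sn j)) (Sn j *m e j) = quad (Sn j) (e j).
  by rewrite {1}/quad mulVmxl// dotvC.
move=> h; have := le_trans h (ler_wpM2l (Q0 j) (SC j (e j))).
by rewrite expr2 -/(E j) mulrA ler_pM2r// mulrC.
Qed.

(** Doubling the covariance gains Q j / 4 - K ln 2 / 2 at step j. The bound is crude, but it permits
    passing to the limit in the coefficients. *)
Lemma avg_Q_bound : avg_le Q (2 * K%:R * ln 2).
Proof.
have := avg_leZ (ler0n _ 4) comp_double.
move=> /(avg_leD (avg_le_cst (2 * K%:R * ln 2))); rewrite mulr0 addr0.
apply: eq_avg_le => j; rewrite competitor_incE; last exact: posdefZ.
rewrite mul0mx subr0 detZ lnM ?posrE ?exprn_gt0 ?posdef_det_gt0//.
rewrite lnXn// -[_ *+ K]mulr_natl.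
have -> : invmx (2 *: Sn j) = 2^-1 *: invmx (Sn j).
  by rewrite invmxZ// unitmxZ ?posdef_unit// unitfE.
by rewrite quadZl /Q; field.
Qed.

Lemma avg_E_bound : exists B, avg_le E B.
Proof.
have [C [C0 [EC _]]] := innovation_bound.
exists (C * (2 * K%:R * ln 2)).
exact: avg_le_sub EC (lexx _) (avg_leZ (ltW C0) avg_Q_bound).
Qed.

Lemma avg_quad_diff (X : nat -> 'M[R]_K) L : mcvg X L ->
  avg_cvg (fun j => quad (X j - L) (e j)) 0.
Proof.
move=> XL; have [B EB] := avg_E_bound.
apply: avg_cvg_near0 E0 (cvg_sqrt_frob0 XL) EB => j; exact: quad_le.
Qed.

Section quadratic.
Variable W : 'M[R]_K.
Hypothesis Wsym : W^T = W.
Hypothesis comp_W : forall b n, posdefmx (invmx S - inv_sign b n *: W) ->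
  competitor_le (fun=> 0) (fun=> invmx (invmx S - inv_sign b n *: W)).

(** n0 makes q / (n + n0 + 1), which bounds the perturbation, smaller than the lower bound c of
    S^-1. *)
Let pos_small : exists n0, forall b n, posdefmx (invmx S - inv_sign b (n + n0) *: W).
Proof.
have [c c0 Sc] := posdef_lower (posdef_inv pS).
have siS : (invmx S)^T = invmx S by apply: invmx_sym; case: pS.
set q := Num.sqrt (frob W) + 1.
have q0 : 0 < q by rewrite ltr_wpDl ?sqrtr_ge0.
have cq : 0 < c / q by rewrite divr_gt0.
have [n0 _ hn0] := near_infty_natSinv_lt (PosNum cq).
exists n0 => b n; apply/posdefmxP; split; first by rewrite raddfB/= linearZ/= siS Wsym.
move=> v v0; have vgt := dotvv_gt0 v0.
rewrite quadBl quadZl subr_gt0; apply: lt_le_trans (Sc v).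
apply: (le_lt_trans (ler_norm _)); rewrite normrM normrM normrX normrN1 expr1n mul1r.
have := hn0 (n + n0)%N (leq_addl _ _) => /=.
rewrite ltr_pdivlMr// => h1; rewrite ger0_norm ?invr_ge0//.
apply: (@le_lt_trans _ _ ((n + n0).+1%:R^-1 * (q * dotv v v))).
  rewrite ler_wpM2l ?invr_ge0//; apply: (le_trans (quad_le _ _)).
  by rewrite ler_wpM2r ?dotvv_ge0// lerDl.
by rewrite mulrA ltr_pM2r.
Qed.

(** With precision T = S^-1 - s W the competitor gains on average s / 2 times quad W (e j), plus ln
    det (1 - s S W) / 2, and this gain cannot be positive. Division by s / 2 and s -> 0 turn the
    log-determinant into tr (S W); the sign of s selects the side that is bounded. *)
Lemma avg_quad : avg_cvg (fun j => quad W (e j)) (\tr (S *m W)).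
Proof.
have [n0 pos] := pos_small.
have uS := posdef_unit pS.
have key (b : bool) : avg_le (fun j => (-1) ^+ b * quad W (e j)) ((-1) ^+ b * \tr (S *m W)).
  apply: (@avg_le_inf _ _ _ (fun n : nat => (-1) ^+ b * ((inv_sign b (n + n0))^-1 *
      - ln (\det (1%:M - inv_sign b (n + n0) *: (S *m W)))))); last first.
    apply: cvgM; first exact: cvg_cst.
    apply: (ln_det_expansion (s := fun n => inv_sign b (n + n0))) => //.
      by move=> n; exact: inv_sign_neq0.
    exact: cvg_inv_sign.
  move=> n; have pT := pos b n; set s := inv_sign b (n + n0); set T := invmx S - s *: W.
  have dT := posdef_det_gt0 pT; have dS := posdef_det_gt0 pS.
  have h1 := comp_W pT.
  have h2 : avg_le (fun j => - (2^-1 * (ln (\det (Sn j)) + ln (\det T))))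
      (- (2^-1 * (ln (\det S) + ln (\det T)))).
    apply: avg_le_cvg; apply: cvgN; apply: cvgM; first exact: cvg_cst.
    by apply: cvgD => //; exact: cvg_cst.
  have [_ h3] := avg_quad_diff iSnS; rewrite oppr0 in h3.
  have half0 : 0 <= 2^-1 :> R by rewrite invr_ge0.
  have h4 := avg_leD (avg_leD h1 h2) (avg_leZ half0 h3).
  have sn0 : s != 0 := inv_sign_neq0 _ _.
  have s2 : (-1) ^+ b / s = (n + n0).+1%:R.
    by rewrite /s /inv_sign invfM invrK mulrA divff ?mul1r// signr_eq0.
  have k0 : 0 <= 2 * ((-1) ^+ b / s) by rewrite s2 mulr_ge0.
  apply: avg_le_sub (avg_leZ k0 h4) => [j|].
    rewrite competitor_incE; last exact: posdef_inv.
    rewrite mul0mx subr0 invmxK det_inv lnV ?posrE// quadBl [quad T _]quadBl quadZl.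
    by rewrite le_eqVlt; apply/orP; left; apply/eqP; field.
  have -> : \det (1%:M - s *: (S *m W)) = \det S * \det T.
    by rewrite -det_mulmx mulmxBr mulmxV// -scalemxAr.
  rewrite lnM ?posrE// le_eqVlt; apply/orP; left; apply/eqP; field; exact: sn0.
split; first by have := key false; rewrite expr0 mul1r; apply: eq_avg_le => j; rewrite mul1r.
by have := key true; rewrite expr1 mulN1r; apply: eq_avg_le => j; rewrite mulN1r.
Qed.

End quadratic.

Lemma avg_Q : (forall b n, posdefmx (invmx S - inv_sign b n *: invmx S) ->
    competitor_le (fun=> 0) (fun=> invmx (invmx S - inv_sign b n *: invmx S))) ->
  avg_cvg Q K%:R.
Proof.
move=> comp_S; have siS : (invmx S)^T = invmx S by apply: invmx_sym; case: pS.
have := avg_cvgD (avg_quad siS comp_S) (avg_quad_diff iSnS).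
rewrite addr0 mulmxV ?posdef_unit// mxtrace1; apply: eq_avg_cvg => j.
by rewrite quadBl addrC subrK.
Qed.

Hypothesis comp_S : forall b n, posdefmx (invmx S - inv_sign b n *: invmx S) ->
    competitor_le (fun=> 0) (fun=> invmx (invmx S - inv_sign b n *: invmx S)).

Lemma innovation_last eps : 0 < eps -> \forall n \near \oo, E n <= eps * n%:R.
Proof.
move=> eps0; have [C [C0 [EC _]]] := innovation_bound.
have eC : 0 < eps / C by rewrite divr_gt0.
have := avg_cvg_last Q0 (avg_Q comp_S) eC; apply: filterS => n h.
apply: (le_trans (EC n)); apply: (le_trans (ler_wpM2l (ltW C0) h)).
by rewrite mulrA mulrCA divff ?mulr1// gt_eqF.
Qed.

Lemma state_recursion : exists beta C, [/\ 0 <= beta, beta < 1, 0 <= C &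
  forall j, M j.+1 <= beta * M j + C * E j].
Proof.
have [CG CG0 HG] := mcvg_bounded (mcvgM (mcvgT GnG) GnG).
(* Weight in Young's inequality for |a + b|^2: the condition (1 + t) alpha <= (1 + alpha) / 2
   amounts to (1 - alpha)^2 >= 0. *)
pose t := (1 - alpha) / 2; have t0 : 0 < t by rewrite divr_gt0// subr_gt0.
exists ((1 + alpha) / 2), ((1 + t^-1) * CG); split.
- by rewrite divr_ge0// addr_ge0.
- by rewrite ltr_pdivrMr// mul1r -[ltRHS]/(1 + 1) ltrD2l.
- by rewrite mulr_ge0 ?(ltW CG0)// addr_ge0// invr_ge0 ltW.
move=> j; rewrite /M mS.
set a := A *m m j; set b := Gn j *m e j.
have hb : dotv b b <= CG * E j.
  apply: le_trans (HG j (e j)); apply: le_trans (ler_norm _).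
  by rewrite /b dotv_mull /quad mulmxA.
have ha : dotv a a <= alpha * M j by exact: A_contr.
have hab : dotv (a + b) (a + b) <= (1 + t) * dotv a a + (1 + t^-1) * dotv b b.
  have h := dotvv_ge0 (t *: a - b).
  rewrite !(dotvBl, dotvBr, dotvZl, dotvZr) in h.
  have h2 : 0 <= t^-1 * (t * (t * dotv a a) - t * dotv a b - (t * dotv b a - dotv b b)).
    by rewrite mulr_ge0 ?invr_ge0 ?(ltW t0)//; lra.
  have e2 : t^-1 * (t * (t * dotv a a) - t * dotv a b - (t * dotv b a - dotv b b)) =
    t * dotv a a - dotv a b - dotv b a + t^-1 * dotv b b by field; rewrite gt_eqF.
  rewrite e2 in h2; rewrite !(dotvDl, dotvDr); lra.
apply: (le_trans hab); apply: lerD.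
  apply: (@le_trans _ _ ((1 + t) * (alpha * M j))).
    by rewrite ler_wpM2l// addr_ge0// ltW.
  rewrite mulrA ler_wpM2r// /t ler_pdivlMr//.
  by have := sqr_ge0 (1 - alpha); rewrite expr2; lra.
by rewrite -mulrA ler_wpM2l// addr_ge0// invr_ge0 ltW.
Qed.

Lemma avg_M_bound : exists B, avg_le M B.
Proof.
have [beta [C [b0 b1 C0 MS]]] := state_recursion.
have [B EB] := avg_E_bound.
exists (C * B / (1 - beta)).
exact: (recursion_avg b1 M0 MS (avg_leZ C0 EB)).
Qed.

Lemma state_last eps : 0 < eps -> \forall n \near \oo, M n <= eps * n%:R.
Proof.
have [beta [C [b0 b1 C0 MS]]] := state_recursion.
apply: (recursion_last b0 b1 M0 MS) => eps' e'0.
have C1 : 0 < C + 1 by rewrite ltr_wpDl.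
have := innovation_last (divr_gt0 e'0 C1); apply: filterS => n h.
apply: (le_trans (ler_wpM2l C0 h)).
apply: (@le_trans _ _ ((C + 1) * (eps' / (C + 1) * n%:R))).
  by rewrite ler_wpM2r ?lerDl// mulr_ge0// divr_ge0// ltW.
by rewrite mulrA mulrCA divff ?mulr1// gt_eqF.
Qed.

(** Moving the mean by s Sn U^T m gains s <m, U e> minus s^2 / 2 times a form in m; the factor Sn
    cancels the inverse covariance. Since the m j have bounded average energy, division by s leaves
    an error of order |s|. *)
Lemma avg_cross U : (forall b n, competitor_le
    (fun j => inv_sign b n *: (Sn j *m U^T)) Sn) ->
  avg_cvg (fun j => dotv (m j) (U *m e j)) 0.
Proof.
move=> comp_U; have [C [C0 [_ SC]]] := innovation_bound.
have [B MB] := avg_M_bound.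
pose D := 2^-1 * (C * (frob U^T * B)).
have key (b : bool) : avg_le (fun j => (-1) ^+ b * dotv (m j) (U *m e j)) 0.
  apply: (@avg_le_inf _ _ _ (fun n : nat => n.+1%:R^-1 * D)); last first.
    rewrite -(mul0r D); apply: cvgM; [exact: cvg_harmonic|exact: cvg_cst].
  move=> n; set s := inv_sign b n.
  have h2 : avg_le (fun j => 2^-1 * (s ^+ 2 * (C * (frob U^T * M j))))
      (2^-1 * (s ^+ 2 * (C * (frob U^T * B)))).
    apply: avg_leZ; first by rewrite invr_ge0.
    apply: avg_leZ; first exact: sqr_ge0.
    by apply: avg_leZ; [exact: ltW|apply: avg_leZ => //; exact: frob_ge0].
  have s2 : (-1) ^+ b / s = n.+1%:R.
    by rewrite /s /inv_sign invfM invrK mulrA divff ?mul1r// signr_eq0.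
  have sn0 : s != 0 := inv_sign_neq0 _ _.
  have k0 : 0 <= (-1) ^+ b / s by rewrite s2.
  apply: avg_le_sub (avg_leZ k0 (avg_leD (comp_U b n) h2)) => [j|].
    rewrite competitor_incE//; set v := U^T *m m j.
    have -> : (inv_sign b n *: (Sn j *m U^T)) *m m j = s *: (Sn j *m v).
      by rewrite -scalemxAl mulmxA.
    have uS := posdef_unit (pSn j).
    have siS : (invmx (Sn j))^T = invmx (Sn j) by apply: invmx_sym; case: (pSn j).
    rewrite quadD// -scaleNr quadZ -scalemxAr dotvZr mulVmxl//.
    have -> : quad (invmx (Sn j)) (Sn j *m v) = quad (Sn j) v.
      by rewrite {1}/quad mulVmxl// dotvC.
    have -> : dotv (e j) v = dotv (m j) (U *m e j) by rewrite /v dotv_mulr trmxK dotvC.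
    have hv : quad (Sn j) v <= C * (frob U^T * M j).
      by apply: (le_trans (SC j v)); rewrite ler_wpM2l ?(ltW C0)// dotv_mulmx_frob.
    set X := dotv (m j) _; set Y := C * _ in hv *; set Z := quad (Sn j) v in hv *.
    have -> : (-1) ^+ b * X = (-1) ^+ b / s * (s * X) by field; exact: sn0.
    rewrite ler_wpM2l//.
    have := ler_wpM2l (sqr_ge0 s) hv; rewrite sqrrN; lra.
  rewrite add0r /D.
  have -> : s ^+ 2 = s * s by rewrite expr2.
  have e1 : (-1) ^+ b * s = n.+1%:R^-1 by rewrite /s /inv_sign mulrA -signr_addb addbb mul1r.
  have -> : (-1) ^+ b / s * (2^-1 * (s * s * (C * (frob U^T * B)))) =
     ((-1) ^+ b * s) * (2^-1 * (C * (frob U^T * B))) by field; exact: sn0.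
  by rewrite e1.
split; first by have := key false; apply: eq_avg_le => j; rewrite expr0 mul1r.
by rewrite oppr0; have := key true; apply: eq_avg_le => j; rewrite expr1 mulN1r.
Qed.

(** W collects the forms in e: |e|^2, the one from telescoping quad H, and the quadratic term of the
    filter itself. U collects the terms bilinear in m and e. *)
Let W := 1%:M + G^T *m H *m G - invmx S.
Let U := 1%:M + A^T *m H *m G.

Hypothesis comp_W : forall b n, posdefmx (invmx S - inv_sign b n *: W) ->
  competitor_le (fun=> 0) (fun=> invmx (invmx S - inv_sign b n *: W)).
Hypothesis comp_U : forall b n, competitor_le (fun j => inv_sign b n *: (Sn j *m U^T)) Sn.
Hypothesis comp_1 : forall b n, competitor_le (fun j => inv_sign b n *: (Sn j *m 1%:M^T)) Sn.
Hypothesis comp_pos : competitor_le (fun=> - 1%:M) (fun=> (1 + r)%:M).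

Definition llr_increment j :=
  ln (gaussian_pdf (m j) (Sn j) (m j + e j)) - ln (gaussian_pdf 0 1%:M (m j + e j)).

Definition llr_rate : R :=
  - (2^-1 * ln (\det S)) + 2^-1 * \tr (S *m (1%:M + G^T *m H *m G - invmx S)).

Let z2 j := M j + 2 * dotv (m j) (e j) + E j.

Let z2E j : dotv (m j + e j) (m j + e j) = z2 j.
Proof. by rewrite !(dotvDl, dotvDr) (dotvC (e j) (m j)) /z2 -/(M j) -/(E j); ring. Qed.

Let llr_incrementE j : llr_increment j = - (2^-1 * ln (\det (Sn j))) + 2^-1 * (z2 j - Q j).
Proof.
rewrite /llr_increment !ln_gaussian_pdf// det1 ln1 subr0.
have -> : m j + e j - m j = e j by rewrite addrC addKr.
by rewrite invmx1 quad1 z2E -/(Q j); field.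
Qed.

(* The Lyapunov function [quad H] expresses |m j|^2 through innovations and a
   telescoping term, so that no ergodic theorem is needed. *)
Let M_telescope j : M j = (quad H (m j) - quad H (m j.+1)) +
  2 * dotv (m j) ((A^T *m H *m Gn j) *m e j) + quad ((Gn j)^T *m H *m Gn j) (e j).
Proof.
have h1 : quad H (m j) = M j + quad (A^T *m H *m A) (m j) by rewrite {1}HE quadDl quad1.
rewrite h1 mS quadD// -quad_mul -quad_mul.
have -> : dotv (A *m m j) (H *m (Gn j *m e j)) = dotv (m j) ((A^T *m H *m Gn j) *m e j).
  by rewrite dotv_mull !mulmxA.
by rewrite /M; ring.
Qed.

Let avg_boundary : avg_cvg (fun j => quad H (m j) - quad H (m j.+1)) 0.
Proof.
apply: (avg_cvg_telescope (h := fun j => quad H (m j))) => eps eps0.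
set q := Num.sqrt (frob H) + 1.
have q0 : 0 < q by rewrite ltr_wpDl ?sqrtr_ge0.
have := state_last (divr_gt0 eps0 q0); apply: filterS => n h.
apply: (le_trans (quad_le _ _)).
apply: (@le_trans _ _ (q * M n)); first by rewrite ler_wpM2r ?M0// /q lerDl.
apply: (le_trans (ler_wpM2l (ltW q0) h)).
by rewrite mulrA mulrCA divff ?mulr1// gt_eqF.
Qed.

Lemma llr_avg : avg_cvg llr_increment llr_rate.
Proof.
have siS : (invmx S)^T = invmx S by apply: invmx_sym; case: pS.
have WT : W^T = W.
  by rewrite /W raddfB/= raddfD/= trmx1 !trmx_mul trmxK Hsym siS mulmxA.
pose Wn j := 1%:M + (Gn j)^T *m H *m Gn j - invmx (Sn j).
have WnW : mcvg Wn W.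
  apply: mcvgB => //; apply: mcvgD; first exact: mcvg_cst.
  apply: mcvgM => //; apply: mcvgM; last exact: mcvg_cst.
  exact: mcvgT.
pose Un j := 1%:M + A^T *m H *m Gn j.
have UnU : mcvg Un U.
  apply: mcvgD; first exact: mcvg_cst.
  by apply: mcvgM => //; exact: mcvg_cst.
have hW : avg_cvg (fun j => quad (Wn j) (e j)) (\tr (S *m W)).
  have := avg_cvgD (avg_quad WT comp_W) (avg_quad_diff WnW).
  by rewrite addr0; apply: eq_avg_cvg => j; rewrite quadBl addrC subrK.
have hU : avg_cvg (fun j => dotv (m j) (Un j *m e j)) 0.
  have [BE hE] := avg_E_bound; have [BM hM] := avg_M_bound.
  have h1 : avg_cvg (fun j => dotv (m j) ((Un j - U) *m e j)) 0.
    apply: (@avg_cvg_near0 _ _ (fun j => 2^-1 * (M j + E j)) (2^-1 * (BM + BE)) _ _ _ (cvg_sqrt_frob0 UnU)).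
    - by move=> j; exact: dotv_mul_le.
    - by move=> j; rewrite mulr_ge0// addr_ge0.
    - by apply: avg_leZ => //; exact: avg_leD.
  have := avg_cvgD (avg_cross comp_U) h1; rewrite addr0; apply: eq_avg_cvg => j.
  by rewrite -dotvDr -mulmxDl addrC subrK.
have hd : avg_cvg (fun j => - (2^-1 * ln (\det (Sn j)))) (- (2^-1 * ln (\det S))).
  by apply: avg_cvg_cvg; apply: cvgN; apply: cvgM; [exact: cvg_cst|exact: ln_det_cvg].
have := avg_cvgD (avg_cvgD (avg_cvgD hd (avg_cvgZ 2^-1 avg_boundary)) (avg_cvgZ 2^-1 hW)) hU.
rewrite mulr0 !addr0; apply: eq_avg_cvg => j.
rewrite llr_incrementE /z2 {1}M_telescope /Wn /Un quadBl quadDl quad1 -/(Q j) -/(E j).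
by rewrite mulmxDl mul1mx dotvDr; field.
Qed.

(* The competitor [comp_pos] is N(0, (1 + r) I). It does no better than the filter,
   and it beats N(0, I) because the observations have average energy at least (1 + r) K. *)
Lemma llr_rate_gt0 : 0 < llr_rate.
Proof.
have r1 : 0 < 1 + r by rewrite addr_gt0.
have pr : posdefmx ((1 + r)%:M : 'M[R]_K).
  by rewrite -scalemx1; apply: posdefZ => //; exact: posdef1.
(* Sn dominates 1 + r, so its inverse is at most 1 / (1 + r). *)
have EQ j : (1 + r) * Q j <= E j.
  have [ej|e0] := eqVneq (e j) 0; first by rewrite /Q /quad /E ej !dot0v mulr0.
  have uS := posdef_unit (pSn j).
  set u := invmx (Sn j) *m e j.
  have eE : e j = Sn j *m u by rewrite mulmxVl.
  have QE : Q j = quad (Sn j) u by rewrite /Q {1}/quad -/u {1}eE dotvC /quad.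
  have h1 : Q j ^+ 2 <= dotv u u * E j.
    by rewrite QE /quad; apply: (le_trans (dotv_CS _ _)); rewrite -eE.
  have h2 : (1 + r) * dotv u u <= Q j by rewrite QE.
  have Qgt : 0 < Q j.
    have /posdefmxP[_ h] := posdef_inv (pSn j); exact: h.
  have : (1 + r) * Q j ^+ 2 <= Q j * E j.
    apply: (le_trans (ler_wpM2l (ltW r1) h1)); rewrite mulrA ler_wpM2r//.
  by rewrite expr2 mulrCA ler_pM2l.
have hz : avg_le (fun j => - z2 j) (- ((1 + r) * K%:R)).
  have [_ h1] := avg_Q comp_S; have [h2 h2'] := avg_cross comp_1.
  have := avg_leD (avg_leZ (ltW r1) h1) (avg_leZ (ler0n _ 2) h2').
  rewrite oppr0 mulr0 addr0 mulrN; apply: avg_le_sub => // j.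
  rewrite /z2 mul1mx; have := EQ j; have := M0 j; lra.
have [h1 _] := llr_avg.
(* With this weight all random terms cancel in [inc]. The remaining constant gives rate >= K / 2 *
   (r - ln (1 + r)), which is positive. *)
pose th := r / (1 + r).
have th0 : 0 <= th by rewrite divr_ge0// ltW.
have th2 : 0 <= 2^-1 * th by rewrite mulr_ge0.
have inc j : ln (gaussian_pdf (m j + (- 1%:M) *m m j) (1 + r)%:M (m j + e j)) -
     ln (gaussian_pdf (m j) (Sn j) (m j + e j)) + llr_increment j + 2^-1 * th * - z2 j =
     - (2^-1 * (K%:R * ln (1 + r))).
  rewrite competitor_incE// llr_incrementE det_scalar lnXn// -[_ *+ K]mulr_natl.
  have -> : e j - (- 1%:M) *m m j = m j + e j by rewrite mulNmx mul1mx opprK addrC.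
  rewrite invmx_scalar quad_scalar z2E -/(Q j) /th; field.
  by rewrite gt_eqF.
have E1 : avg_le (fun=> - (2^-1 * (K%:R * ln (1 + r)))) (llr_rate - 2^-1 * (r * K%:R)).
  have := avg_leD (avg_leD comp_pos h1) (avg_leZ th2 hz).
  apply: avg_le_sub => [j|]; first by rewrite inc.
  rewrite add0r /th le_eqVlt; apply/orP; left; apply/eqP; field.
  by rewrite gt_eqF.
have h := avg_le_cst_le E1.
have : ln (1 + r) < r.
  by rewrite -[X in _ < X](expRK r) ltr_ln ?posrE ?expR_gt0// expR_gt1Dx// gt_eqF.
move=> hl; have : 0 < K%:R :> R by rewrite ltr0n.
move=> K0; have := ltr_pM2l K0 (ln (1 + r)) r; rewrite hl.
lra.
Qed.

End innovation_averages.

(** * Limit of the Riccati recursion *)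

Section kalman_limits.
Context {R : realType} {K : nat}.
Local Notation V := 'cV[R]_K.
Implicit Types (P S T : 'M[R]_K) (v : V).

Lemma post_cov1 P : posdefmx P -> post_cov P 1%:M 1%:M = 1%:M - invmx (1%:M + P).
Proof.
move=> pP; have := woodbury 1%:M pP posdef1.
rewrite invmx1 !(mulmx1, mul1mx, trmx1) /marg_cov trmx1 mul1mx mulmx1 addrC => ->.
by rewrite opprB addrC subrK.
Qed.

Lemma bayes_gain1 P : posdefmx P -> bayes_gain P 1%:M 1%:M = 1%:M - invmx (1%:M + P).
Proof. by move=> pP; rewrite -post_cov1// /bayes_gain invmx1 trmx1 !mulmx1. Qed.

Lemma inv_contr S v : posdefmx S -> (forall v, dotv v v <= quad S v) ->
  dotv (invmx S *m v) (invmx S *m v) <= dotv v v.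
Proof.
move=> pS S1; set u := invmx S *m v; have vE : v = S *m u by rewrite mulmxVl// posdef_unit.
have [->|u0] := eqVneq u 0; first by rewrite dot0v dotvv_ge0.
have ugt := dotvv_gt0 u0.
have h1 : dotv u u ^+ 2 <= dotv u u * dotv v v.
  apply: (le_trans _ (dotv_CS u v)); rewrite ler_sqr ?nnegrE ?dotvv_ge0//.
    by rewrite vE; exact: S1.
  by rewrite vE; apply: le_trans (S1 u); exact: dotvv_ge0.
by move: h1; rewrite expr2 ler_pM2l.
Qed.

(** T^-1 - S^-1 = S^-1 (S - T) T^-1, and both inverses are contractions because S and T dominate the
    identity. *)
Lemma frob_inv_diff S T : posdefmx S -> posdefmx T ->
  (forall v, dotv v v <= quad S v) -> (forall v, dotv v v <= quad T v) ->
  frob (invmx T - invmx S) <= frob (S - T).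
Proof.
move=> pS pT S1 T1.
have -> : invmx T - invmx S = invmx S *m (S - T) *m invmx T.
  rewrite mulmxBr mulVmx ?posdef_unit// mulmxBl mul1mx -mulmxA mulmxV ?posdef_unit//.
  by rewrite mulmx1.
rewrite -mulmxA; apply: (@le_trans _ _ (frob ((S - T) *m invmx T))).
  rewrite -[leRHS]mul1r; apply: frob_mulmx_le => v.
  by rewrite mul1r; exact: inv_contr.
rewrite -frob_tr trmx_mul -[leRHS]frob_tr -[leRHS]mul1r; apply: frob_mulmx_le => v.
rewrite invmx_sym ?mul1r; first exact: inv_contr.
by case: pT.
Qed.

Lemma frob_conj_le (alpha : R) (A X : 'M[R]_K) : 0 <= alpha ->
  (forall v, dotv (A *m v) (A *m v) <= alpha * dotv v v) ->
  frob (A *m X *m A^T) <= alpha ^+ 2 * frob X.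
Proof.
move=> a0 hA; rewrite -mulmxA expr2 -mulrA.
apply: (le_trans (frob_mulmx_le _ hA)); rewrite ler_wpM2l//.
rewrite -frob_tr trmx_mul trmxK -[in leRHS]frob_tr.
exact: frob_mulmx_le.
Qed.

Lemma mcvg_quad_ge (X : nat -> 'M[R]_K) L c : mcvg X L ->
  (forall j v, c * dotv v v <= quad (X j) v) -> forall v, c * dotv v v <= quad L v.
Proof.
move=> XL h v; have q := cvg_quad (v := v) XL.
have n : \forall j \near \oo, c * dotv v v <= quad (X j) v by apply: nearW => j; exact: h.
exact: (cvgr_to_ge q n).
Qed.

Variables (A Q S1 : 'M[R]_K) (alpha : R).
Hypotheses (a0 : 0 <= alpha) (a1 : alpha < 1).
Hypothesis A_contr : forall v, dotv (A *m v) (A *m v) <= alpha * dotv v v.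
Hypotheses (pQ : posdefmx Q) (pS1 : posdefmx S1).

(** Innovation covariance: state uncertainty plus unit observation noise. *)
Definition innov_cov j := 1%:M + riccati A Q S1 j.
(** In terms of S = 1 + P, where the Bayes gain P S^-1 equals 1 - S^-1. *)
Definition kalman_gain S := A *m (1%:M - invmx S).

Let pr j : posdefmx (riccati A Q S1 j) := riccati_posdef A j pQ pS1.

Lemma innov_cov_posdef j : posdefmx (innov_cov j).
Proof. exact: Ps1_posdef. Qed.

Lemma innov_covS j : innov_cov j.+1 =
  1%:M + (A *m (1%:M - invmx (innov_cov j)) *m A^T + Q).
Proof. by rewrite /innov_cov {1}/riccati iterS -/(riccati A Q S1 j) /marg_cov post_cov1. Qed.

Lemma innov_cov_ge1 j v : dotv v v <= quad (innov_cov j) v.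
Proof.
have [_ h] := posdef_psd (pr j).
by rewrite /innov_cov quadDl quad1 lerDl.
Qed.

(** The excess over the identity dominates S1 at time 0 and Q afterwards. This margin r is the
    source of the positive rate. *)
Lemma innov_cov_lower : exists2 r, 0 < r &
  forall j v, (1 + r) * dotv v v <= quad (innov_cov j) v.
Proof.
have [r1 r10 h1] := posdef_lower pQ; have [r2 r20 h2] := posdef_lower pS1.
exists (Num.min r1 r2); first by rewrite lt_min r10 r20.
move=> j v; rewrite /innov_cov quadDl quad1 mulrDl mul1r lerD2l.
case: j => [|j].
  by apply: le_trans (h2 v); rewrite ler_wpM2r ?dotvv_ge0// ge_min lexx orbT.
rewrite {1}/riccati iterS -/(riccati A Q S1 j) /marg_cov quadDl.
have [_ h] := psd_congr A (posdef_psd (post_cov_posdef 1%:M (pr j) posdef1)).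
rewrite -[leLHS]add0r; apply: lerD; first exact: h.
by apply: le_trans (h1 v); rewrite ler_wpM2r ?dotvv_ge0// ge_min lexx.
Qed.

(** In the form S' = 1 + A (1 - S^-1) A^T + Q, inversion is 1-Lipschitz above the identity and
    conjugation by A contracts [frob] by alpha^2. *)
Lemma innov_cov_cvg : exists S, [/\ mcvg innov_cov S, posdefmx S &
  mcvg (fun j => invmx (innov_cov j)) (invmx S)].
Proof.
have [S SnS] : exists S, mcvg innov_cov S.
  apply: (@mcvg_contraction _ _ _ (alpha ^+ 2)); rewrite ?sqr_ge0//.
    by rewrite expr_lt1.
  move=> j.
  have -> : innov_cov j.+2 - innov_cov j.+1 =
      A *m (invmx (innov_cov j) - invmx (innov_cov j.+1)) *m A^T.
    rewrite (innov_covS j.+1) [X in _ - X]innov_covS.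
    rewrite opprD addrACA subrr add0r opprD addrACA subrr addr0 -mulmxBl -mulmxBr.
    by congr (_ *m _ *m _); rewrite opprB addrC addrA subrK.
  apply: (le_trans (frob_conj_le _ a0 A_contr)).
  rewrite ler_wpM2l ?sqr_ge0//; apply: frob_inv_diff => //;
    by [exact: innov_cov_posdef|move=> v; exact: innov_cov_ge1].
have S_ge v : 1 * dotv v v <= quad S v.
  by apply: (mcvg_quad_ge SnS) => j u; rewrite mul1r; exact: innov_cov_ge1.
have pS : posdefmx S.
  apply/posdefmxP; split.
    apply: (mcvg_unique (mcvgT SnS)); apply: eq_mcvg SnS => j.
    by have [] := innov_cov_posdef j.
  by move=> v v0; apply: lt_le_trans (S_ge v); rewrite mul1r dotvv_gt0.
exists S; split => //; apply: mcvg_frob.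
apply: (@squeeze_cvgr _ _ _ _ (fun=> 0) (fun j => frob (innov_cov j - S)));
  [|exact: cvg_cst|exact: cvg_frob0].
apply: nearW => j; rewrite frob_ge0/=.
apply: (le_trans (frob_inv_diff pS (innov_cov_posdef j) _ _)).
- by move=> v; have := S_ge v; rewrite mul1r.
- by move=> v; exact: innov_cov_ge1.
- by rewrite !frobE le_eqVlt; apply/orP; left; apply/eqP; apply: eq_bigr => i _;
    apply: eq_bigr => k _; rewrite !mxE -sqrrN opprB.
Qed.

(** H is the limit of the partial sums of (A^T)^k A^k, a contraction iterated from 0. *)
Lemma lyapunov_solution : exists H : 'M[R]_K, H^T = H /\ H = 1%:M + A^T *m H *m A.
Proof.
pose Hn j := iter j (fun H => 1%:M + A^T *m H *m A) (0 : 'M[R]_K).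
have HnS j : Hn j.+1 = 1%:M + A^T *m Hn j *m A by [].
have At := normsq_trmx_le a0 A_contr.
have [H HnH] : exists H, mcvg Hn H.
  apply: (@mcvg_contraction _ _ _ (alpha ^+ 2)); rewrite ?sqr_ge0//.
    by rewrite expr_lt1.
  move=> j; rewrite HnS (HnS j).
  rewrite opprD addrACA subrr add0r -mulmxBl -mulmxBr.
  by have := frob_conj_le (Hn j.+1 - Hn j) a0 At; rewrite trmxK.
have Hsym j : (Hn j)^T = Hn j.
  elim: j => [|j IH]; first by rewrite trmx0.
  by rewrite HnS raddfD/= trmx1 !trmx_mul trmxK IH mulmxA.
exists H; split.
  by apply: (mcvg_unique (mcvgT HnH)); exact: eq_mcvg HnH.
apply: (mcvg_unique (mcvgS HnH)).
apply: mcvgD; first exact: mcvg_cst.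
apply: mcvgM; last exact: mcvg_cst.
by apply: mcvgM => //; exact: mcvg_cst.
Qed.

End kalman_limits.

(** * Likelihoods as products along a path *)

Section path_products.
Context {R : realType} {K : nat}.
Local Notation V := 'cV[R]_K.

Fixpoint path_state (u : nat -> V -> V -> V) (m : V) (z : nat -> V) (j : nat) : V :=
  if j is j'.+1 then u j' (path_state u m z j') (z j') else m.

Lemma path_state_shift (u : nat -> V -> V -> V) m z j :
  path_state (fun i => u i.+1) (u 0%N m (z 0%N)) (fun i => z i.+1) j =
  path_state u m z j.+1.
Proof. by elim: j => [//|j IH] /=; rewrite IH. Qed.

Lemma lik_shift (c : nat -> V -> V -> R) u i m ys :
  lik c u i.+1 m ys = lik (fun j => c j.+1) (fun j => u j.+1) i m ys.
Proof. by elim: ys i m => [//|y ys IH] i m /=; rewrite IH. Qed.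

Lemma lik_prod (c : nat -> V -> V -> R) u m (z : nat -> V) n :
  lik c u 0 m [tuple z i | i < n] =
  \prod_(0 <= j < n) c j (path_state u m z j) (z j).
Proof.
have -> : [tuple z i | i < n] = mkseq z n :> seq V.
  by rewrite /mkseq -val_enum_ord -map_comp.
elim: n c u m z => [|n IH] c u m z; first by rewrite big_geq.
rewrite big_nat_recl// /mkseq /= -[in iota 1 n](addn0 1%N) iotaDl -map_comp.
rewrite lik_shift; congr (_ * _).
rewrite [LHS](IH _ _ _ (fun j => z j.+1)).
by apply: eq_big_nat => j _; rewrite path_state_shift.
Qed.

Lemma ln_prod_nat (f : nat -> R) n : (forall j, 0 < f j) ->
  ln (\prod_(0 <= j < n) f j) = \sum_(0 <= j < n) ln (f j).
Proof.
move=> f0; elim: n => [|n IH]; first by rewrite !big_geq// ln1.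
rewrite !big_nat_recr//= lnM ?IH// posrE//.
by apply: prodr_gt0.
Qed.

End path_products.

(** * Limit of the likelihood ratio *)

Lemma past_integral_cst (R : realType) (K : nat) k (c : \bar R) : (0 <= c)%E ->
  past_integral (K := K) (fun _ : k.-tuple 'cV[R]_K => c) = c.
Proof.
move=> c0; elim: k => [//|k IH] /=.
rewrite -[RHS]IH; congr past_integral; apply/funext => u.
rewrite ge0_integralZl//.
- by rewrite integral_gaussian_pdf ?mule1//; exact: posdef1.
- by apply/measurable_EFinP; apply: measurable_gaussian_pdf.
- by move=> v _; rewrite lee_fin gaussian_pdf_ge0.
Qed.

Lemma integral_has_density d (Omega : measurableType d) (R : realType)
    (P : probability Omega R) d' (U : measurableType d') (X : Omega -> U)
    (mu : {measure set U -> \bar R}) (g : U -> R) :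
  measurable_fun setT X -> measurable_fun setT g -> (forall u, 0 <= g u) ->
  (forall B, measurable B ->
    (\int[P]_w (\1_B (X w))%:E = \int[mu]_u ((\1_B u)%:E * (g u)%:E))%E) ->
  has_density P X mu g.
Proof.
move=> mX mg g0 H; split => // B mB.
have mpre : measurable (X @^-1` B) by rewrite -[X in measurable X]setTI; exact: mX.
rewrite -[X @^-1` B]setIT -integral_indic// [RHS]integral_mkcond.
rewrite -[LHS]/(\int[P]_w (\1_B (X w))%:E)%E H// epatch_indic.
by apply: eq_integral => u _; rewrite muleC.
Qed.

Section likelihood_densities.
Context d (Omega : measurableType d) (R : realType) (K : nat).
Local Notation V := 'cV[R]_K.
Variables (A Q S1 : 'M[R]_K) (m1 : V) (y : nat -> {mfun Omega >-> V}).
Hypotheses (pQ : posdefmx Q) (pS1 : posdefmx S1).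
Local Notation klik := (kalman_lik A Q S1 m1).
Local Notation leb n := (tuple_measure (lebesgue_cV R K) n).

Lemma kalman_lik_ge0 v : 0 <= klik v.
Proof.
apply: lik_ge0 => i m z; apply: gaussian_pdf_ge0.
exact: (innov_cov_posdef A pQ pS1 i).
Qed.

Lemma white_lik_ge0 (v : seq V) : 0 <= white_lik v.
Proof. by apply: lik_ge0 => i m z; exact: gaussian_pdf_ge0. Qed.

Lemma measurable_kalman_lik n d' (T : measurableType d') (f : T -> n.-tuple V) :
  measurable_fun setT f -> measurable_fun setT (fun s => klik (f s)).
Proof.
move=> mf; apply: (@measurable_lik _ _ _ _ _ _ _ _ _ _ (cst m1) f) => // i.
- exact: measurable_kalman_pred.
- exact: measurable_kalman_update.
Qed.

Lemma measurable_white_lik n d' (T : measurableType d') (f : T -> n.-tuple V) :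
  measurable_fun setT f -> measurable_fun setT (fun s => white_lik (f s)).
Proof.
move=> mf; apply: (@measurable_lik _ _ _ _ _ _ _ _ _ _ (cst 0) f) => // i.
- exact: measurable_gaussian_pdf.
- exact: measurable_fst.
Qed.

Lemma kalman_density (P : probability Omega R) t0 n : (1 <= t0)%N ->
  change_law A Q m1 S1 y t0 P ->
  has_density P (obs_block y t0 n) (leb n) (fun v : n.-tuple V => klik v).
Proof.
move=> t1 lawP; apply: integral_has_density.
- exact: measurable_obs_block.
- exact: measurable_kalman_lik.
- by move=> v; exact: kalman_lik_ge0.
move=> B mB.
have := @change_law_integral _ _ _ _ A Q S1 m1 y t0 n P
  (fun p => (\1_B p.2)%:E) t1 pQ pS1 lawP.
rewrite /= => ->; last 2 first.
- by apply/measurable_EFinP; apply: measurableT_comp.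
- by move=> p; rewrite lee_fin.
rewrite past_integral_cst//.
by apply: integral_ge0 => v _; rewrite mule_ge0// lee_fin ?kalman_lik_ge0.
Qed.

Lemma white_density (P : probability Omega R) t0 n : (1 <= t0)%N -> nochange_law y P ->
  has_density P (obs_block y t0 n) (leb n) (fun v : n.-tuple V => white_lik v).
Proof.
move=> t1 lawP; apply: integral_has_density.
- exact: measurable_obs_block.
- exact: measurable_white_lik.
- by move=> v; exact: white_lik_ge0.
move=> B mB.
have := @nochange_law_integral _ _ _ _ y t0 n P (fun p => (\1_B p.2)%:E) t1 lawP.
rewrite /= => ->; last 2 first.
- by apply/measurable_EFinP; apply: measurableT_comp.
- by move=> p; rewrite lee_fin.
rewrite past_integral_cst//.
by apply: integral_ge0 => v _; rewrite mule_ge0// lee_fin ?white_lik_ge0.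
Qed.

End likelihood_densities.

Section likelihood_ratio_limit.
Context d (Omega : measurableType d) (R : realType) (K : nat).
Local Notation V := 'cV[R]_K.
Hypothesis K_gt0 : (0 < K)%N.
Variables (A Q S1 : 'M[R]_K) (m1 : V) (y : nat -> {mfun Omega >-> V}).
Hypotheses (pQ : posdefmx Q) (pS1 : posdefmx S1) (A1 : operator_norm A < 1).
Variables (t0 : nat) (P : probability Omega R).
Hypotheses (t0_ge1 : (1 <= t0)%N) (lawP : change_law A Q m1 S1 y t0 P).
Local Notation klik := (kalman_lik A Q S1 m1).
Local Notation Ps := (riccati A Q S1).
Local Notation Sn := (innov_cov A Q S1).

Definition kalman_path w := path_state (kalman_update A Ps) m1 (fun j => y (t0 + j)%N w).
Definition innovation w j := y (t0 + j)%N w - kalman_path w j.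

Lemma kalman_path_innovation w j : kalman_path w j + innovation w j = y (t0 + j)%N w.
Proof. by rewrite addrC subrK. Qed.

Lemma kalman_pathS w j :
  kalman_path w j.+1 = A *m kalman_path w j + kalman_gain A (Sn j) *m innovation w j.
Proof.
rewrite /kalman_path /= /kalman_update bayes_gain1; last exact: riccati_posdef.
by rewrite mulmxDr mulmxA.
Qed.

Lemma kalman_lik_block w n : klik (obs_block y t0 n w) =
  \prod_(0 <= j < n) gaussian_pdf (kalman_path w j) (Sn j) (y (t0 + j)%N w).
Proof. by rewrite /kalman_lik /obs_block (lik_prod _ _ _ (fun j => y (t0 + j)%N w)). Qed.

Lemma white_lik_block w n : white_lik (obs_block y t0 n w) =
  \prod_(0 <= j < n) gaussian_pdf 0 1%:M (y (t0 + j)%N w).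
Proof. by rewrite /white_lik /obs_block (lik_prod _ _ _ (fun j => y (t0 + j)%N w)). Qed.

(** The competitor keeps the filter's update and changes only the predictive density, so both
    likelihoods are products along the same path and their logarithms subtract term by term. *)
Lemma kalman_path_competitor (C Sigma : nat -> 'M[R]_K) :
  (forall j, posdefmx (Sigma j)) ->
  \forall w \ae P, competitor_le Sn (kalman_path w) (innovation w) C Sigma.
Proof.
move=> pSi.
pose c j (m z : V) := gaussian_pdf (m + C j *m m) (Sigma j) z.
have c0 j m z : 0 < c j m z by apply: gaussian_pdf_gt0.
have f0 j m z : 0 < gaussian_pdf m (Sn j) z.
  by apply: gaussian_pdf_gt0; exact: innov_cov_posdef.
have mc j : measurable_fun setT (fun p : V * V => c j p.1 p.2).
  apply: measurable_gaussian_pdf => //.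
  by apply: measurable_fun_addmx => //; exact: measurable_fun_mulmx.
have mu := measurable_kalman_update A Ps.
pose q n (v : n.-tuple V) := lik c (kalman_update A Ps) 0 m1 v.
have mq n : measurable_fun setT (@q n).
  exact: (@measurable_lik _ _ _ _ mc mu _ _ _ _ (cst m1) id).
have q0 n v : 0 <= @q n v by apply: lik_ge0 => i m z; rewrite ltW.
have q1 n : (\int[tuple_measure (lebesgue_cV R K) n]_v (@q n v)%:E <= 1)%E.
  rewrite (integral_lik mc mu)// => i m; last exact: integral_gaussian_pdf.
  by move=> z; rewrite ltW.
have := competitor_ae (measurable_obs_block y t0)
  (fun n => kalman_density pQ pS1 n t0_ge1 lawP) mq q0 q1.
apply: filterS => w h e e0; move: (h e e0); apply: filterS => n.
rewrite kalman_lik_block /q /obs_block (lik_prod _ _ _ (fun j => y (t0 + j)%N w)).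
rewrite -ler_ln ?posrE ?mulr_gt0 ?expR_gt0 ?prodr_gt0//.
rewrite lnM ?posrE ?expR_gt0 ?prodr_gt0// expRK !ln_prod_nat// add0r => le.
rewrite big_split/= sumrN lerBlDr.
by under eq_bigr do rewrite kalman_path_innovation;
  under [X in _ <= _ + X]eq_bigr do rewrite kalman_path_innovation.
Qed.

Lemma ae_forall_sign (X : bool -> nat -> Omega -> Prop) :
  (forall b n, \forall w \ae P, X b n w) -> \forall w \ae P, forall b n, X b n w.
Proof.
move=> h; have h1 b : \forall w \ae P, forall n, X b n w by apply/ae_foralln.
by apply: filterS2 (h1 true) (h1 false) => w ht hf [].
Qed.

(** The competitors form a countable family, so one null set serves the whole path analysis. The
    sign of the rate, though deterministic, is obtained along a path and hence stated under the
    almost sure quantifier. *)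
Lemma llr_ae H S : H^T = H -> H = 1%:M + A^T *m H *m A ->
  posdefmx S -> mcvg Sn S -> mcvg (fun j => invmx (Sn j)) (invmx S) ->
  \forall w \ae P, 0 < llr_rate H S (kalman_gain A S) /\
    (n%:R^-1 * ln (klik (obs_block y t0 n w) / white_lik (obs_block y t0 n w)))
      @[n --> \oo] --> llr_rate H S (kalman_gain A S).
Proof.
move=> Hsym HE pS SnS iSnS; set G := kalman_gain A S.
have [on0 onA] := operator_norm_ge0_le A.
have al0 : 0 <= operator_norm A ^+ 2 by rewrite sqr_ge0.
have al1 : operator_norm A ^+ 2 < 1 by rewrite expr_lt1.
have [r r0 Sn_ge] := innov_cov_lower A pQ pS1.
have pSn := innov_cov_posdef A pQ pS1.
have GnG : mcvg (fun j => kalman_gain A (Sn j)) G.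
  apply: mcvgM; first exact: mcvg_cst.
  by apply: mcvgD; [exact: mcvg_cst|exact: mcvgN].
have comp_inv W : \forall w \ae P, forall b n, posdefmx (invmx S - inv_sign b n *: W) ->
    competitor_le Sn (kalman_path w) (innovation w) (fun=> 0)
      (fun=> invmx (invmx S - inv_sign b n *: W)).
  apply: ae_forall_sign => b n.
  have [pW|nW] := pselect (posdefmx (invmx S - inv_sign b n *: W)); last exact: aeW.
  by apply: filterS (kalman_path_competitor (fun=> 0) (fun=> posdef_inv pW)).
have comp_cross U : \forall w \ae P, forall b n,
    competitor_le Sn (kalman_path w) (innovation w)
      (fun j => inv_sign b n *: (Sn j *m U^T)) Sn.
  by apply: ae_forall_sign => b n; exact: kalman_path_competitor.
have c_double := kalman_path_competitor (fun=> 0) (fun j => posdefZ (ltr0n R 2) (pSn j)).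
have r1 : 0 < 1 + r by rewrite addr_gt0.
have pr : posdefmx ((1 + r)%:M : 'M[R]_K).
  by rewrite -scalemx1; exact: posdefZ.
have c_pos := kalman_path_competitor (fun=> - 1%:M) (fun=> pr).
apply: filterS2 (filterI (comp_inv (invmx S))
  (comp_inv (1%:M + G^T *m H *m G - invmx S)))
  (filterI (filterI c_double c_pos)
    (filterI (comp_cross (1%:M + A^T *m H *m G)) (comp_cross 1%:M))).
move=> w [cS cW] [[c2 cP] [cU c1]]; split.
  apply: (llr_rate_gt0 K_gt0 al0 al1 r0 onA Hsym HE pSn pS Sn_ge SnS iSnS GnG
    (kalman_pathS w) c2 cS cW cU c1 cP).
have := llr_avg K_gt0 al0 al1 onA Hsym HE pSn pS SnS iSnS GnG (kalman_pathS w) c2 cS cW cU.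
move=> /avg_cvgP; apply: cvg_trans; apply: near_eq_cvg; apply: nearW => n.
rewrite kalman_lik_block white_lik_block.
have f0 j : 0 < gaussian_pdf (kalman_path w j) (Sn j) (y (t0 + j)%N w).
  by apply: gaussian_pdf_gt0; exact: pSn.
have g0 j : 0 < gaussian_pdf 0 1%:M (y (t0 + j)%N w) by apply: gaussian_pdf_gt0.
rewrite ln_div ?posrE ?prodr_gt0// !ln_prod_nat// -sumrB; congr (_ * _).
by apply: eq_bigr => j _; rewrite /llr_increment kalman_path_innovation.
Qed.

End likelihood_ratio_limit.

(** * Stopping times and change of measure *)

Section observation_filtration.
Context d (Omega : measurableType d) (R : realType) (K : nat).
Local Notation V := 'cV[R]_K.
Variable y : nat -> {mfun Omega >-> V}.
Local Notation past := (past_obs (fun i => y i : Omega -> V) S).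
Local Notation F := (obs_filtration y).
Local Notation FT k := (g_sigma_algebraType
  (\bigcup_(s in [set s | (1 <= s <= k)%N])
     preimage_set_system setT (y s : Omega -> V) measurable)).

Lemma obs_filtration_mono j k : (j <= k)%N -> F j `<=` F k.
Proof.
move=> jk; apply: sub_sigma_algebra2 => B [s /andP[s1 sj] sB]; exists s => //=.
by rewrite s1 (leq_trans sj).
Qed.

Lemma obs_filtrationD k B C : F k B -> F k C -> F k (B `\` C).
Proof. exact: (@measurableD _ (FT k)). Qed.

Lemma obs_filtrationT k : F k setT.
Proof. exact: (@measurableT _ (FT k)). Qed.

(** The preimages under Z form a sigma-algebra that contains the generators of the filtration. *)
Lemma obs_filtration_preimage k d' (U : measurableType d') (Z : Omega -> U) :
  (forall s, (1 <= s <= k)%N ->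
     exists2 g : U -> V, measurable_fun setT g & forall w, y s w = g (Z w)) ->
  forall B, F k B -> exists2 B', measurable B' & B = Z @^-1` B'.
Proof.
move=> h B FB.
suff : F k `<=` preimage_set_system setT Z measurable.
  by move=> /(_ _ FB)[B' mB' <-]; exists B' => //; rewrite setTI.
apply: smallest_sub.
  by apply: sigma_algebra_preimage; exact: sigma_algebra_measurable.
move=> _ [s sk [C mC <-]]; have [g mg yE] := h s sk.
exists (g @^-1` C); first by rewrite -[X in measurable X]setTI; exact: mg.
by congr (_ `&` _); apply/seteqP; split=> w /=; rewrite yE.
Qed.

Lemma obs_filtration_measurable k B : F k B -> measurable B.
Proof.
move=> /(obs_filtration_preimage (Z := id))[|B' mB' ->] //.
by move=> s _; exists (y s).
Qed.

Lemma past_entry k s : (1 <= s <= k)%N ->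
  exists2 g : k.-tuple V -> V, measurable_fun setT g & forall w, y s w = g (past k w).
Proof.
elim: k => [|k IH]; first by case: s.
move=> /andP[s1]; rewrite leq_eqVlt => /orP[/eqP ->|sk].
  by exists (@thead _ V); [exact: measurable_tnth|].
have [|g mg gE] := IH; first by rewrite s1 -ltnS.
exists (fun u : k.+1.-tuple V => g [tuple of behead u]).
  by apply: (measurableT_comp mg); exact: measurable_behead.
by move=> w; rewrite gE; congr g; apply/val_inj.
Qed.

Lemma obs_filtration_past k B : measurable B -> F k (past k @^-1` B).
Proof.
suff h j : (j <= k)%N -> measurable_fun (setT : set (FT k)) (past j).
  by move=> mB; rewrite -[_ @^-1` _]setTI; exact: h.
elim: j => [|j IH] jk /=; first exact: measurable_cst.
apply: measurable_cons; last by apply: IH; exact: ltnW.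
move=> _ C mC; apply: sub_sigma_algebra; exists j.+1 => //=.
by exists C.
Qed.

Lemma past_preimage k B : F k B -> exists2 B', measurable B' & B = past k @^-1` B'.
Proof. by apply: obs_filtration_preimage => s; exact: past_entry. Qed.

Lemma past_block_preimage t0 m B : (1 <= t0)%N -> F (t0.-1 + m) B ->
  exists2 B', measurable B' & B = (fun w => (past t0.-1 w, obs_block y t0 m w)) @^-1` B'.
Proof.
move=> t1; apply: obs_filtration_preimage => s /andP[s1 sm].
have [st|ts] := leqP s t0.-1.
  have [|g mg gE] := @past_entry t0.-1 s; first by rewrite s1.
  by exists (g \o fst) => //; apply: measurableT_comp.
have lt : (s - t0 < m)%N by lia.
exists (fun p => tnth p.2 (Ordinal lt)).
  by apply: (measurableT_comp (measurable_tnth _)); exact: measurable_snd.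
by move=> w; rewrite tnth_mktuple /= subnKC//; lia.
Qed.

Section stopping.
Variable tau : Omega -> option nat.
Hypothesis st : stopping_time y tau.

Definition not_before n := [set w | if tau w is Some k then (n <= k)%N else true].

(** {tau >= n + 1} is {tau >= n} minus {tau = n}. At n = 0 the truncated index is harmless because
    [not_before 0] is everything. *)
Lemma not_before_filtration n : F n.-1 (not_before n).
Proof.
elim: n => [|n IH] /=.
  rewrite (_ : not_before 0 = setT); first exact: obs_filtrationT.
  by apply/seteqP; split => // w _; rewrite /not_before /=; case: (tau w).
rewrite (_ : not_before n.+1 = not_before n `\` [set w | tau w = Some n]).
  by apply: obs_filtrationD; [exact: (obs_filtration_mono (leq_pred n) IH)|exact: st].
apply/seteqP; split => w; rewrite /not_before /=.
  case: (tau w) => [k nk|_]; split => //; first exact: ltnW.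
  by move=> [kn]; move: nk; rewrite kn ltnn.
case: (tau w) => [k [nk kn]|//].
by rewrite ltn_neqAle nk andbT; apply/eqP => nk'; apply: kn; rewrite nk'.
Qed.

Lemma measurable_not_before n : measurable (not_before n).
Proof. by apply: (@obs_filtration_measurable n.-1); exact: not_before_filtration. Qed.

End stopping.

End observation_filtration.

Section change_of_measure.
Context d (Omega : measurableType d) (R : realType) (K : nat).
Local Notation V := 'cV[R]_K.
Variables (A Q S1 : 'M[R]_K) (m1 : V) (y : nat -> {mfun Omega >-> V}).
Hypotheses (pQ : posdefmx Q) (pS1 : posdefmx S1).
Variables (t0 : nat) (P Pinf : probability Omega R).
Hypotheses (t0_ge1 : (1 <= t0)%N) (lawP : change_law A Q m1 S1 y t0 P).
Hypothesis lawPinf : nochange_law y Pinf.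
Local Notation klik := (kalman_lik A Q S1 m1).
Local Notation leb n := (tuple_measure (lebesgue_cV R K) n).
Local Notation past := (past_obs (fun i => y i : Omega -> V) S).
Local Open Scope ereal_scope.

Lemma white_lik_gt0 (v : seq V) : (0 < white_lik v)%R.
Proof.
suff h i m : (0 < lik (fun _ _ => gaussian_pdf 0 1%:M) (fun _ m _ => m) i m v)%R by exact: h.
elim: v i m => [|z v IH] i m //=.
by apply: mulr_gt0; [exact: gaussian_pdf_gt0|exact: IH].
Qed.

Lemma change_past (g : t0.-1.-tuple V -> \bar R) :
  measurable_fun setT g -> (forall u, 0 <= g u) ->
  \int[P]_w g (past t0.-1 w) = past_integral g.
Proof.
move=> mg g0.
have mH : measurable_fun setT (fun p : t0.-1.-tuple V * 0.-tuple V => g p.1).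
  exact: measurableT_comp.
rewrite [LHS](change_law_integral t0_ge1 pQ pS1 lawP mH)//.
congr past_integral; apply/funext => u.
rewrite integral_tuple_measure0; first by rewrite /= mule1.
apply: emeasurable_funM; first by rewrite /=; exact: measurable_cst.
by apply/measurable_EFinP; apply: measurable_kalman_lik.
Qed.

Lemma nochange_past (g : t0.-1.-tuple V -> \bar R) :
  measurable_fun setT g -> (forall u, 0 <= g u) ->
  \int[Pinf]_w g (past t0.-1 w) = past_integral g.
Proof.
move=> mg g0.
have mH : measurable_fun setT (fun p : t0.-1.-tuple V * 0.-tuple V => g p.1).
  exact: measurableT_comp.
rewrite [LHS](nochange_law_integral t0_ge1 lawPinf mH)//.
congr past_integral; apply/funext => u.
rewrite integral_tuple_measure0; first by rewrite /= mule1.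
apply: emeasurable_funM; first by rewrite /=; exact: measurable_cst.
by apply/measurable_EFinP; apply: measurable_white_lik.
Qed.

Lemma past_probability B : measurable B ->
  P (past t0.-1 @^-1` B) = Pinf (past t0.-1 @^-1` B).
Proof.
move=> mB; have mX : measurable (past t0.-1 @^-1` B).
  by rewrite -[X in measurable X]setTI; exact: measurable_past.
rewrite -[past t0.-1 @^-1` B]setIT -!integral_indic//.
have mI : measurable_fun setT (fun u : t0.-1.-tuple V => (\1_B u : R)%:E).
  exact/measurable_EFinP.
transitivity (past_integral (fun u : t0.-1.-tuple V => (\1_B u : R)%:E)).
  by apply: (etrans _ (change_past mI _)) => // u; rewrite lee_fin.
by apply/esym; apply: (etrans _ (nochange_past mI _)) => // u; rewrite lee_fin.
Qed.

(** Conditional expectation of H given the past, as a function of the past: the block is integrated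
    against its own law by independence. *)
Definition future n (H : t0.-1.-tuple V * n.-tuple V -> \bar R) u :=
  \int[leb n]_v (H (u, v) * (klik v)%:E).

Lemma future_ge0 n (H : t0.-1.-tuple V * n.-tuple V -> \bar R) u :
  (forall p, 0 <= H p) -> 0 <= future H u.
Proof.
by move=> H0; apply: integral_ge0 => v _; rewrite mule_ge0// lee_fin kalman_lik_ge0.
Qed.

Lemma measurable_future n (H : t0.-1.-tuple V * n.-tuple V -> \bar R) :
  measurable_fun setT H -> (forall p, 0 <= H p) -> measurable_fun setT (future H).
Proof.
move=> mH H0.
apply: (measurable_fun_fubini_tonelli_F (m2 := leb n) (fun p => H p * (klik p.2)%:E)).
  apply: emeasurable_funM => //; apply/measurable_EFinP.
  by apply: measurable_kalman_lik; exact: measurable_snd.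
by move=> p; rewrite mule_ge0// lee_fin kalman_lik_ge0.
Qed.

Lemma integral_future n (H : t0.-1.-tuple V * n.-tuple V -> \bar R) :
  measurable_fun setT H -> (forall p, 0 <= H p) ->
  \int[P]_w H (past t0.-1 w, obs_block y t0 n w) =
  \int[P]_w future H (past t0.-1 w).
Proof.
move=> mH H0; rewrite [LHS](change_law_integral t0_ge1 pQ pS1 lawP mH H0).
apply/esym; apply: change_past; first exact: measurable_future.
by move=> u; exact: future_ge0.
Qed.

Lemma past_block_probability n B D : measurable B -> measurable D ->
  P (past t0.-1 @^-1` B `&` obs_block y t0 n @^-1` D) =
  P (past t0.-1 @^-1` B) * \int[leb n]_(v in D) (klik v)%:E.
Proof.
move=> mB mD.
have mXB : measurable (past t0.-1 @^-1` B).
  by rewrite -[X in measurable X]setTI; exact: measurable_past.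
have mXD : measurable (obs_block y t0 n @^-1` D).
  by rewrite -[X in measurable X]setTI; exact: measurable_obs_block.
pose H (p : t0.-1.-tuple V * n.-tuple V) : \bar R := (\1_B p.1 * \1_D p.2)%:E.
have H0 p : 0 <= H p by rewrite lee_fin mulr_ge0.
have mH : measurable_fun setT H.
  by apply/measurable_EFinP; apply: measurable_funM; exact: measurableT_comp.
have k0 v : 0 <= (klik v)%:E by rewrite lee_fin kalman_lik_ge0.
have mk : measurable_fun setT (fun v : n.-tuple V => (klik v)%:E).
  by apply/measurable_EFinP; apply: measurable_kalman_lik.
have mDk : measurable_fun setT (fun v : n.-tuple V => (\1_D v)%:E * (klik v)%:E).
  by apply: emeasurable_funM => //; exact/measurable_EFinP.
have Dk0 v : 0 <= (\1_D v)%:E * (klik v)%:E by rewrite mule_ge0// lee_fin.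
rewrite [\int[leb n]_(v in D) _]integral_mkcond epatch_indic.
have -> : \int[leb n]_v ((klik v)%:E * (\1_D v)%:E) =
    \int[leb n]_v ((\1_D v)%:E * (klik v)%:E).
  by apply: eq_integral => v _; rewrite muleC.
set c := \int[leb n]_v ((\1_D v)%:E * (klik v)%:E).
have c0 : 0 <= c by exact: integral_ge0.
rewrite -[X in P X = _]setIT -integral_indic//; last exact: measurableI.
rewrite indicI.
transitivity (\int[P]_w (c * (\1_(past t0.-1 @^-1` B) w)%:E)); last first.
  rewrite ge0_integralZl//; last exact/measurable_EFinP.
  by rewrite integral_indic// setIT muleC.
apply: (etrans (integral_future mH H0)); apply: eq_integral => w _.
rewrite /future /H /=; under eq_integral do rewrite EFinM -muleA.
by rewrite ge0_integralZl ?lee_fin// muleC.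
Qed.

Lemma measurable_lik_ratio n d' (T : measurableType d') (f : T -> n.-tuple V) :
  measurable_fun setT f -> measurable_fun setT (fun s => klik (f s) / white_lik (f s))%R.
Proof.
move=> mf; apply: measurable_funM; first exact: measurable_kalman_lik.
have ml := measurableT_comp (@measurable_ln R) (measurable_white_lik mf).
have mn : measurable_fun setT (fun s => - ln (white_lik (f s)))%R.
  by apply: measurableT_comp.
have := measurableT_comp (@measurable_expR R) mn.
apply: eq_measurable_fun => s _ /=.
by rewrite expRN lnK// posrE white_lik_gt0.
Qed.

(** The past has the same law under both measures, so the ratio for the block alone is the density
    of P_t0 with respect to P_oo. *)
Lemma integral_ratio n (H : t0.-1.-tuple V * n.-tuple V -> \bar R) :
  measurable_fun setT H -> (forall p, 0 <= H p) ->
  \int[P]_w H (past t0.-1 w, obs_block y t0 n w) =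
  \int[Pinf]_w (H (past t0.-1 w, obs_block y t0 n w) *
    (klik (obs_block y t0 n w) / white_lik (obs_block y t0 n w))%:E).
Proof.
move=> mH H0; rewrite [LHS](change_law_integral t0_ge1 pQ pS1 lawP mH H0).
pose H' (p : t0.-1.-tuple V * n.-tuple V) := H p * (klik p.2 / white_lik p.2)%:E.
have mH' : measurable_fun setT H'.
  apply: emeasurable_funM => //; apply/measurable_EFinP.
  by apply: measurable_lik_ratio; exact: measurable_snd.
have H'0 p : 0 <= H' p.
  by rewrite mule_ge0// lee_fin mulr_ge0// ?invr_ge0 ?white_lik_ge0 ?kalman_lik_ge0.
apply/esym; apply: (etrans (nochange_law_integral t0_ge1 lawPinf mH' H'0)).
congr past_integral; apply/funext => u; apply: eq_integral => v _.
by rewrite /H' /= -muleA -EFinM divfK// gt_eqF// white_lik_gt0.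
Qed.

End change_of_measure.

(** * Tail sums for the detection delay *)

Section delay.
Context d (Omega : measurableType d) (R : realType).
Implicit Types tau : Omega -> option nat.
Local Open Scope ereal_scope.

Lemma nneseries_ltn (k : nat) : \sum_(n <oo) ((n < k)%N%:R : R)%:E = (k%:R)%:E.
Proof.
apply: lim_near_cst => //; exists k => // N /= kN.
have -> : (\sum_(0 <= n < N) ((n < k)%N%:R : R)%:E) = ((minn k N)%:R : R)%:E.
  elim: N {kN} => [|N IH]; first by rewrite big_geq// minn0.
  rewrite big_nat_recr//= IH -EFinD -natrD; congr (_%:R%:E).
  by case: (ltnP N k) => /= h; lia.
by rewrite (minn_idPl kN).
Qed.

Lemma nneseries_1 : \sum_(0 <= n <oo) (1 : R)%:E = +oo.
Proof.
apply/eqyP => r _.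
have : \sum_(0 <= n < (Num.truncn r).+1) (1 : R)%:E <= \sum_(0 <= n <oo) (1 : R)%:E.
  by apply: nneseries_lim_ge => n _ _; rewrite lee_fin ler01.
apply: le_trans; rewrite sumEFin lee_fin sumr_const_nat subn0.
by rewrite ltW// truncnS_gt.
Qed.

(** Tail-sum formula; if [tau] never stops, every indicator is 1 and the series is infinite. *)
Lemma detection_delay_series tau t0 w :
  detection_delay R tau t0 w = \sum_(n <oo) ((\1_(not_before tau (t0 + n).+1) w : R)%:E).
Proof.
rewrite /detection_delay; case tw : (tau w) => [k|]; last first.
  rewrite /= [RHS](_ : _ = \sum_(0 <= n <oo) (1 : R)%:E).
    by rewrite nneseries_1 maxye.
  by apply: eq_eseriesr => n _; rewrite indicE mem_set// /not_before /= tw.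
transitivity (\sum_(n <oo) ((n < k - t0)%N%:R : R)%:E); last first.
  apply: eq_eseriesr => n _; rewrite indicE; congr (_%:R%:E); congr nat_of_bool.
  apply/idP/idP => [h|]; first by rewrite mem_set// /not_before /= tw; lia.
  by rewrite inE /not_before /= tw; lia.
rewrite nneseries_ltn /= -EFinB -EFin_max; congr EFin.
have [tk|kt] := leqP t0 k.
  by rewrite natrB// max_l// subr_ge0 ler_nat.
(* [k <= t0] is by definition [k - t0 == 0], with truncated subtraction. *)
by rewrite (eqP (ltnW kt)) max_r// subr_le0 ler_nat ltnW.
Qed.

Lemma stop_value_series tau w : stop_value R (tau w) = detection_delay R tau 0 w.
Proof.
rewrite /detection_delay sube0; case: (tau w) => [k|] /=; last by rewrite maxye.
by rewrite -EFin_max max_l.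
Qed.

Lemma measurable_detection_delay tau t0 :
  (forall n, measurable (not_before tau n)) ->
  measurable_fun setT (detection_delay R tau t0 : Omega -> \bar R).
Proof.
move=> mB; rewrite (_ : detection_delay _ _ _ = fun w =>
    \sum_(n <oo) ((\1_(not_before tau (t0 + n).+1) w : R)%:E)); last first.
  by apply/funext => w; rewrite detection_delay_series.
by apply: ge0_emeasurable_sum => // n _; exact/measurable_EFinP.
Qed.

Lemma detection_delay_ge0 tau t0 w : 0 <= (detection_delay R tau t0 w : \bar R).
Proof. by rewrite le_max lexx orbT. Qed.

Lemma ess_sup_cond_expectation (P : probability Omega R) (G : set_system Omega)
    (Z g : Omega -> \bar R) B (c : R) :
  (forall C, G C -> measurable C) -> is_cond_expectation P G Z g -> G B ->
  0 < P B -> (0 < c)%R -> c%:E * P B <= \int[P]_(w in B) Z w -> c%:E <= ess_sup P g.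
Proof.
move=> Gm [g0 mg gE] GB PB c0; rewrite -gE// => cB.
have mgT : measurable_fun setT g by move=> _ C mC; rewrite setTI; apply: Gm; exact: mg.
have mB := Gm _ GB.
(* The maximum gives a nonnegative constant to integrate; c > 0 later excludes that it is 0. *)
set M := maxe (ess_sup P g) 0.
have : c%:E <= M.
  rewrite -(lee_pmul2r _ PB) ?fin_num_measure//.
  apply: (le_trans cB); rewrite -[M * _]integral_cst//.
  apply: ae_ge0_le_integral => //.
  - exact: measurable_funTS.
  - by move=> w _; rewrite le_max lexx orbT.
  - by apply: filterS (ess_sup_ge P g) => w h _; rewrite le_max h.
rewrite /M le_max => /orP[//|]; rewrite lee_fin => /(lt_le_trans c0).
by rewrite ltxx.
Qed.

End delay.

Section detection.
Context d (Omega : measurableType d) (R : realType) (K : nat).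
Local Notation V := 'cV[R]_K.
Variables (A Q S1 : 'M[R]_K) (m1 : V) (y : nat -> {mfun Omega >-> V}).
Hypotheses (pQ : posdefmx Q) (pS1 : posdefmx S1).
Variables (t0 : nat) (P Pinf : probability Omega R).
Hypotheses (t0_ge1 : (1 <= t0)%N) (lawP : change_law A Q m1 S1 y t0 P).
Hypothesis lawPinf : nochange_law y Pinf.
Variable tau : Omega -> option nat.
Hypothesis st : stopping_time y tau.
Local Notation klik := (kalman_lik A Q S1 m1).
Local Notation leb n := (tuple_measure (lebesgue_cV R K) n).
Local Notation past := (past_obs (fun i => y i : Omega -> V) S).
Local Notation F := (obs_filtration y).
Local Open Scope ereal_scope.

Lemma measurable_past_preimage B : measurable B -> measurable (past t0.-1 @^-1` B).
Proof. by move=> mB; rewrite -[X in measurable X]setTI; exact: measurable_past. Qed.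

Lemma measurable_past_block n : measurable_fun setT
  (fun w => (past t0.-1 w, obs_block y t0 n w)).
Proof.
by apply: measurable_fun_pair; [exact: measurable_past|exact: measurable_obs_block].
Qed.

Lemma integral_future_on n B (H : t0.-1.-tuple V * n.-tuple V -> \bar R) :
  measurable B -> measurable_fun setT H -> (forall p, 0 <= H p) ->
  \int[P]_(w in past t0.-1 @^-1` B) future A Q S1 m1 H (past t0.-1 w) =
  \int[P]_(w in past t0.-1 @^-1` B) H (past t0.-1 w, obs_block y t0 n w).
Proof.
move=> mB mH H0; rewrite !(integral_mkcond (_ @^-1` _)) !epatch_indic.
pose H' (p : t0.-1.-tuple V * n.-tuple V) := (\1_B p.1 : R)%:E * H p.
have H'0 p : 0 <= H' p by rewrite mule_ge0// lee_fin.
have mH' : measurable_fun setT H'.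
  apply: emeasurable_funM => //; apply/measurable_EFinP; exact: measurableT_comp.
have e : forall w, future A Q S1 m1 H (past t0.-1 w) * (\1_(past t0.-1 @^-1` B) w)%:E =
    future A Q S1 m1 H' (past t0.-1 w).
  move=> w; rewrite muleC /future /H' /=; under [RHS]eq_integral do rewrite -muleA.
  rewrite ge0_integralZl ?lee_fin//.
  - apply: emeasurable_funM; first exact: (measurableT_comp mH (measurable_pair1 _)).
    by apply/measurable_EFinP; apply: measurable_kalman_lik.
  - by move=> v _; rewrite mule_ge0// lee_fin kalman_lik_ge0.
under eq_integral do rewrite e.
rewrite -(integral_future pQ pS1 t0_ge1 lawP mH' H'0).
by apply: eq_integral => w _; rewrite /H' /= muleC.
Qed.

(* A version is obtained by integrating the events {tau > t0 + n} over the
   observations y t0, ..., y (t0 + n), which have density [klik] given the past. *)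
Lemma cond_expectation_delay :
  is_cond_expectation P (F t0.-1) (detection_delay R tau t0)
    (cond_expectation P (F t0.-1) (detection_delay R tau t0)).
Proof.
apply: (@xgetPex _ _ [set g | is_cond_expectation P (F t0.-1) (detection_delay R tau t0) g]).
have E n : exists B, measurable B /\ not_before tau (t0 + n).+1 =
    (fun w => (past t0.-1 w, obs_block y t0 n.+1 w)) @^-1` B.
  have h : F (t0 + n).+1.-1 (not_before tau (t0 + n).+1) by apply: not_before_filtration.
  have [|B mB BE] := @past_block_preimage _ _ _ _ y t0 n.+1 (not_before tau (t0 + n).+1) t0_ge1.
    by rewrite (_ : (t0.-1 + n.+1 = (t0 + n).+1.-1)%N)//; lia.
  by exists B.
pose B n := sval (cid (E n)).
have hB n : measurable (B n) /\ not_before tau (t0 + n).+1 =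
    (fun w => (past t0.-1 w, obs_block y t0 n.+1 w)) @^-1` B n by exact: svalP (cid (E n)).
pose H n (p : t0.-1.-tuple V * n.+1.-tuple V) := (\1_(B n) p : R)%:E.
have H0 n p : 0 <= H n p by rewrite lee_fin.
have mH n : measurable_fun setT (H n).
  by apply/measurable_EFinP; have [mB _] := hB n; exact: measurable_indic.
have f0 n u : 0 <= future A Q S1 m1 (H n) u by exact: future_ge0.
have mf n : measurable_fun setT (future A Q S1 m1 (H n)) by exact: measurable_future.
pose G u := \sum_(n <oo) future A Q S1 m1 (H n) u.
have mG : measurable_fun setT G by exact: ge0_emeasurable_sum.
exists (G \o past t0.-1); split.
- by move=> w; apply: nneseries_ge0.
- move=> C mC; rewrite comp_preimage; apply: obs_filtration_past.
  by rewrite -[X in measurable X]setTI; exact: mG.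
move=> C /past_preimage[C' mC' ->].
have mpC := measurable_past_preimage mC'.
rewrite /= [LHS]integral_nneseries//; last first.
  by move=> n; apply: measurable_funTS; apply: measurableT_comp => //; exact: measurable_past.
under [RHS]eq_integral do rewrite detection_delay_series.
rewrite [RHS]integral_nneseries//; last first.
  move=> n; apply: measurable_funTS; apply/measurable_EFinP; apply: measurable_indic.
  by apply: measurable_not_before; exact: st.
apply: eq_eseriesr => n _; rewrite integral_future_on//.
by apply: eq_integral => w _; have [_ ->] := hB n.
Qed.

(** E is split by the likelihood ratio. Where it is at most c, P is at most c times Pinf; elsewhere
    E is enlarged to B, which is independent of the block. The factor P B keeps the estimate
    meaningful conditionally on B. *)
Lemma stopped_probability_le m (c : R) B E : (0 <= c)%R ->
  F t0.-1 B -> F (t0.-1 + m) E -> E `<=` B ->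
  P E <= c%:E * Pinf E +
    P B * \int[leb m]_(v in [set v : m.-tuple V | (c * white_lik v < klik v)%R]) (klik v)%:E.
Proof.
move=> c0 /past_preimage[B' mB' ->] /(past_block_preimage t0_ge1)[E' mE' ->] EB.
set D := [set v : m.-tuple V | _].
set Z := (X in P (X @^-1` E')).
have mE : measurable (Z @^-1` E').
  by rewrite -[X in measurable X]setTI; exact: measurable_past_block.
have mk : measurable_fun setT (fun v : m.-tuple V => klik v) by apply: measurable_kalman_lik.
have mw : measurable_fun setT (fun v : m.-tuple V => white_lik v) by apply: measurable_white_lik.
have mD : measurable D.
  rewrite (_ : D = ~` [set v : m.-tuple V | (klik v <= c * white_lik v)%R]).
    apply: measurableC; rewrite -[X in measurable X]setTI.
    by apply: (measurable_fun_le measurableT) => //; exact: measurable_funM.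
  by apply/seteqP; split => v; rewrite /D /= ltNge => /negP.
have mDD : measurable (obs_block y t0 m @^-1` D).
  by rewrite -[X in measurable X]setTI; exact: measurable_obs_block.
rewrite -past_block_probability//.
apply: (@le_trans _ _ (P (Z @^-1` E' `\` obs_block y t0 m @^-1` D) +
    P (Z @^-1` E' `&` obs_block y t0 m @^-1` D))).
  rewrite -measureU//; first by rewrite setUC setUIDK.
  - exact: measurableD.
  - exact: measurableI.
  - by rewrite setDE setIACA setICl setI0.
apply: leeD; last first.
  rewrite le_measure ?inE//.
  - exact: measurableI.
  - by apply: measurableI => //; exact: measurable_past_preimage.
  - exact: setSI.
pose H (p : t0.-1.-tuple V * m.-tuple V) := (\1_E' p * \1_(~` D) p.2 : R)%:E.
have H0 p : 0 <= H p by rewrite lee_fin mulr_ge0.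
have mH : measurable_fun setT H.
  apply/measurable_EFinP; apply: measurable_funM; first exact: measurable_indic.
  by apply: measurableT_comp => //; apply: measurable_indic; exact: measurableC.
rewrite setDE -[X in P X]setIT -integral_indic//; last first.
  by apply: measurableI => //; exact: measurableC.
rewrite indicI [leLHS](integral_ratio pQ pS1 t0_ge1 lawP lawPinf mH H0).
rewrite -[X in Pinf X]setIT -integral_indic// -ge0_integralZl ?lee_fin//;
  last exact/measurable_EFinP.
apply: ge0_le_integral => //.
- move=> w _; apply: mule_ge0; first exact: H0.
  by rewrite lee_fin; apply: divr_ge0; [exact: kalman_lik_ge0|exact: white_lik_ge0].
- apply: emeasurable_funM.
    by apply: (measurableT_comp mH); exact: measurable_past_block.
  apply/measurable_EFinP; apply: measurable_lik_ratio; exact: measurable_obs_block.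
- by apply: emeasurable_funM => //; exact/measurable_EFinP.
move=> w _; rewrite /H -!EFinM lee_fin -/(Z w).
have wp := white_lik_gt0 (obs_block y t0 m w).
have [Dw|nDw] := pselect (D (obs_block y t0 m w)).
  by rewrite [\1_(~` D) _]indicE memNset// mulr0 mul0r mulr_ge0.
rewrite [\1_(~` D) _]indicE mem_set// mulr1 [leRHS]mulrC; apply: ler_wpM2l => //.
by rewrite ler_pdivrMr// leNgt; apply/negP.
Qed.

End detection.

(** * The lower bound on the detection delay *)

(** Splitting off the first m terms, each at most 1, leaves a shifted sum that is at most 1 - theta
    times the original. *)
Lemma sum_shift_bound (R : realType) (b : nat -> R) m theta N :
  (forall n, 0 <= b n <= 1) -> (forall n, b (n + m)%N <= (1 - theta) * b n) ->
  theta * \sum_(0 <= n < N) b n <= m%:R.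
Proof.
move=> b01 h.
have h1 : \sum_(0 <= n < N) b n <= \sum_(0 <= n < N + m) b n.
  rewrite (@big_cat_nat _ _ _ N _ (N + m))//= ?leq_addr// lerDl.
  by apply: sumr_ge0 => n _; case/andP: (b01 n).
have h2 : \sum_(0 <= n < N + m) b n = \sum_(0 <= n < m) b n + \sum_(0 <= n < N) b (n + m)%N.
  rewrite (@big_cat_nat _ _ _ m _ (N + m))//= ?leq_addl//; congr (_ + _).
  by rewrite -{1}[m]add0n big_addn addnK.
have h3 : \sum_(0 <= n < m) b n <= m%:R.
  apply: (@le_trans _ _ (\sum_(0 <= n < m) 1)); last by rewrite sumr_const_nat subn0.
  by apply: ler_sum => n _; case/andP: (b01 n).
have h4 : \sum_(0 <= n < N) b (n + m)%N <= (1 - theta) * \sum_(0 <= n < N) b n.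
  by rewrite mulr_sumr; apply: ler_sum => n _; exact: h.
lra.
Qed.

(** The tail unions decrease to the upper limit of the events, which is null. *)
Lemma probability_eventually_le d (Omega : measurableType d) (R : realType)
    (P : probability Omega R) (B : nat -> set Omega) (eta : R) :
  (forall n, measurable (B n)) -> (\forall w \ae P, \forall n \near \oo, ~ B n w) ->
  0 < eta -> \forall n \near \oo, (P (B n) <= eta%:E)%E.
Proof.
move=> mB ae eta0.
have mU n : measurable (\bigcup_(k in [set k | (n <= k)%N]) B k) by exact: bigcup_measurable.
have Pfin C : measurable C -> (P C < +oo)%E.
  by move=> mC; apply: (le_lt_trans (probability_le1 P mC)); rewrite ltry.
have mL : measurable (lim_sup_set B) by exact: bigcapT_measurable.
have L0 : P (lim_sup_set B) = 0%E.
  apply/negligibleP => //; apply: negligibleS ae => w /= wL [N _ hN].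
  by have [k /= Nk Bk] := wL N I; exact: hN Bk.
have cv : (P (\bigcup_(k in [set k | (n <= k)%N]) B k)) @[n --> \oo] --> 0%E.
  by rewrite -L0; exact: (lim_sup_set_cvg P B mB (Pfin _ (mU 0%N))).
have : \forall n \near \oo, (P (\bigcup_(k in [set k | (n <= k)%N]) B k) < eta%:E)%E.
  apply: (cv [set x | (x < eta%:E)%E]); by apply: open_ereal_lt'; rewrite lte_fin.
apply: filterS => n /ltW; apply: le_trans; apply: le_measure; rewrite ?inE//.
by move=> w Bw; exists n => /=.
Qed.

Section average_run_length.
Context d (Omega : measurableType d) (R : realType).
Variables (Pinf : probability Omega R) (tau : Omega -> option nat).
Hypothesis mtau : forall n, measurable (not_before tau n).

Lemma ARL_series : ARL Pinf tau = (\sum_(n <oo) Pinf (not_before tau n.+1))%E.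
Proof.
rewrite /ARL; under eq_integral do rewrite stop_value_series detection_delay_series.
rewrite integral_nneseries//; last by move=> n; exact/measurable_EFinP.
by apply: eq_eseriesr => n _; rewrite integral_indic// setIT.
Qed.

(* Otherwise the survival probabilities of [tau] decay geometrically along steps of
   length [m], and the average run length is at most [gamma / 2]. *)
Lemma ARL_slow_decay (m : nat) (gamma : R) : (0 < m)%N -> 0 < gamma ->
  (gamma%:E <= ARL Pinf tau)%E ->
  exists2 t0, (1 <= t0)%N & (1 - 2 * m%:R / gamma) * fine (Pinf (not_before tau t0)) <
    fine (Pinf (not_before tau (t0 + m))).
Proof.
move=> m0 g0 ga; apply: contrapT => nex.
pose b n := fine (Pinf (not_before tau n.+1)).
have Pb n : Pinf (not_before tau n.+1) = (b n)%:E by rewrite fineK ?fin_num_measure.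
have b01 n : 0 <= b n <= 1.
  by rewrite -!lee_fin -Pb measure_ge0 probability_le1.
have h n : b (n + m)%N <= (1 - 2 * m%:R / gamma) * b n.
  rewrite leNgt; apply/negP => lt; apply: nex; exists n.+1; [by []|exact: lt].
have m0' : 0 < m%:R :> R by rewrite ltr0n.
have : (ARL Pinf tau <= (gamma / 2)%:E)%E.
  rewrite ARL_series; apply: lime_le; first exact: is_cvg_nneseries.
  apply: nearW => N; under eq_bigr do rewrite Pb.
  rewrite sumEFin lee_fin; have := sum_shift_bound N b01 h.
  by rewrite -ler_pdivlMl ?divr_gt0 ?mulr_gt0// => /le_trans; apply;
    rewrite le_eqVlt; apply/orP; left; apply/eqP; field; rewrite !gt_eqF.
move=> /(le_trans ga); rewrite lee_fin; lra.
Qed.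

End average_run_length.

Section delay_lower_bound.
Context d (Omega : measurableType d) (R : realType) (K : nat).
Local Notation V := 'cV[R]_K.
Variables (A Q S1 : 'M[R]_K) (m1 : V) (y : nat -> {mfun Omega >-> V}).
Hypotheses (pQ : posdefmx Q) (pS1 : posdefmx S1).
Local Notation klik := (kalman_lik A Q S1 m1).
Local Notation leb n := (tuple_measure (lebesgue_cV R K) n).

Definition large_ratio (c : R) m := [set v : m.-tuple V | c * white_lik v < klik v].
Arguments large_ratio : clear implicits.

(** The conclusion is stated through the density of the block and does not mention t0, so one change
    point controls them all. *)
Lemma large_ratio_small (P : probability Omega R) t0 (rate delta k : R) :
  (1 <= t0)%N -> change_law A Q m1 S1 y t0 P ->
  (\forall w \ae P, n%:R^-1 * ln (klik (obs_block y t0 n w) / white_lik (obs_block y t0 n w))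
      @[n --> \oo] --> rate) ->
  0 < delta -> 0 < k ->
  \forall m \near \oo,
    (\int[leb m]_(v in large_ratio (expR ((rate + delta) * m%:R)) m) (klik v)%:E <= k%:E)%E.
Proof.
move=> t1 lawP cvP d0 k0.
pose c m : R := expR ((rate + delta) * m%:R).
have mD m : measurable (large_ratio (c m) m).
  rewrite (_ : large_ratio _ _ = ~` [set v : m.-tuple V | klik v <= c m * white_lik v]).
    apply: measurableC; rewrite -[X in measurable X]setTI.
    apply: (measurable_fun_le measurableT); first exact: measurable_kalman_lik.
    by apply: measurable_funM => //; exact: measurable_white_lik.
  by apply/seteqP; split => v; rewrite /large_ratio /= ltNge => /negP.
have mB m : measurable (obs_block y t0 m @^-1` large_ratio (c m) m).
  by rewrite -[X in measurable X]setTI; by apply: measurable_obs_block => //; exact: mD.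
have : \forall w \ae P, \forall m \near \oo,
    ~ (obs_block y t0 m @^-1` large_ratio (c m) m) w.
  apply: filterS cvP => w /cvgr_lt/(_ (rate + delta)) h.
  near=> m; rewrite /large_ratio /= => lt.
  have m0 : 0 < m%:R :> R by rewrite ltr0n; near: m; exact: nbhs_infty_gt.
  have : m%:R^-1 * ln (klik (obs_block y t0 m w) / white_lik (obs_block y t0 m w)) <
      rate + delta by near: m; apply: h; rewrite ltrDl.
  have wp := white_lik_gt0 (obs_block y t0 m w).
  have kp : 0 < klik (obs_block y t0 m w).
    by apply: le_lt_trans lt; rewrite mulr_ge0 ?expR_ge0// ltW.
  rewrite ltr_pdivrMl// [ltRHS]mulrC => lt2.
  move: lt; rewrite -ltr_pdivlMr// ltNge => /negP; apply.
  by rewrite -[leLHS]lnK ?posrE ?divr_gt0// ler_expR ltW.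
move=> /(probability_eventually_le mB)/(_ k0); apply: filterS => m.
have [_ _ PD] := kalman_density pQ pS1 m t1 lawP.
by rewrite PD; [exact|exact: mD].
Unshelve. all: by end_near. Qed.

Variables (P : nat -> probability Omega R) (Pinf : probability Omega R).
Hypothesis lawP : forall t0, (1 <= t0)%N -> change_law A Q m1 S1 y t0 (P t0).
Hypothesis lawPinf : nochange_law y Pinf.

(** With t0 from [ARL_slow_decay], B is {tau >= t0} and B minus C a stop within the window of length
    m. Given B, the latter has P_oo-probability at most 2 m / gamma, hence P_t0-probability at most
    eta; on C the delay is at least m. *)
Lemma WADD_ge tau (m : nat) (c k eta gamma : R) :
  stopping_time y tau -> (0 < m)%N -> 0 < gamma -> 0 <= c -> eta < 1 ->
  c * (2 * m%:R / gamma) + k <= eta ->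
  (\int[leb m]_(v in large_ratio c m) (klik v)%:E <= k%:E)%E ->
  (gamma%:E <= ARL Pinf tau)%E -> ((m%:R * (1 - eta))%:E <= WADD y P tau)%E.
Proof.
move=> st m0 g0 c0 eta1 cke kD ga.
have mnb n : measurable (not_before tau n) by apply: measurable_not_before; exact: st.
have [t0 t1] := ARL_slow_decay mnb m0 g0 ga.
set B := not_before tau t0; set C := not_before tau (t0 + m).
set a := fine (Pinf B); set a' := fine (Pinf C) => slow.
have Ba : Pinf B = a%:E by rewrite fineK ?fin_num_measure//; exact: mnb.
have Ca : Pinf C = a'%:E by rewrite fineK ?fin_num_measure//; exact: mnb.
have a0 : 0 <= a by rewrite -lee_fin -Ba measure_ge0.
have CB : C `<=` B.
  by move=> w; rewrite /C /B /not_before /=; case: (tau w) => // j; lia.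
have a'a : a' <= a by rewrite -lee_fin -Ca -Ba le_measure ?inE//; exact: mnb.
have agt : 0 < a.
  rewrite lt0r a0 andbT; apply/eqP => az; move: slow; rewrite az mulr0 => a'0.
  by move: a'a; rewrite az leNgt a'0.
have FB : obs_filtration y t0.-1 B by apply: not_before_filtration.
have FE : obs_filtration y (t0.-1 + m) (B `\` C).
  apply: obs_filtrationD; first by apply: obs_filtration_mono FB; exact: leq_addr.
  rewrite (_ : (t0.-1 + m = (t0 + m).-1)%N); last by rewrite -{2}(prednK t1).
  by apply: not_before_filtration.
have PB : P t0 B = a%:E.
  have [B' mB' BE] := past_preimage FB.
  by rewrite -Ba BE; exact: (past_probability pQ pS1 t1 (lawP t1) lawPinf mB').
have PinfE : Pinf (B `\` C) = (a - a')%:E.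
  rewrite measureD//; [|exact: mnb|exact: mnb|].
    by rewrite setIidr// EFinB -Ba -Ca.
  by rewrite -[ltLHS]/(Pinf B) Ba ltry.
have PE : (P t0 (B `\` C) <= (eta * a)%:E)%E.
  apply: (le_trans (stopped_probability_le pQ pS1 t1 (lawP t1) lawPinf c0 FB FE _)).
    by move=> w [].
  rewrite PinfE PB; apply: (@le_trans _ _ ((c * (a - a'))%:E + (a * k)%:E)%E).
    by rewrite leeD// EFinM lee_wpmul2l.
  rewrite -EFinD lee_fin; apply: le_trans (ler_wpM2r a0 cke).
  rewrite mulrDl [k * a]mulrC lerD2r -[leRHS]mulrA ler_wpM2l//.
  by move: slow; set th := 2 * m%:R / gamma => slow; lra.
have PC : ((a * (1 - eta))%:E <= P t0 C)%E.
  have PD : P t0 (B `\` C) = (P t0 B - P t0 C)%E.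
    rewrite measureD//; [by rewrite setIidr|exact: mnb|exact: mnb|].
    by rewrite -[ltLHS]/(P t0 B) PB ltry.
  move: PE; rewrite PD PB -[P t0 C]fineK ?fin_num_measure//; last exact: mnb.
  by rewrite -EFinB !lee_fin; lra.
apply: (@le_trans _ _ (ess_sup (P t0) (cond_expectation (P t0)
    (obs_filtration y t0.-1) (detection_delay R tau t0)))); last first.
  by apply: ereal_sup_ubound; exists t0.
apply: (ess_sup_cond_expectation _ (cond_expectation_delay pQ pS1 t1 (lawP t1) st) FB).
- by move=> X; exact: obs_filtration_measurable.
- by rewrite PB lte_fin.
- by rewrite mulr_gt0 ?subr_gt0// ltr0n.
have mZ := @measurable_detection_delay _ _ R tau t0 mnb.
have mC : measurable C := mnb _.
have mB : measurable B := mnb _.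
apply: (@le_trans _ _ (\int[P t0]_(w in C) detection_delay R tau t0 w)%E); last first.
  apply: ge0_subset_integral => //; first exact: measurable_funTS.
  by move=> w _; exact: detection_delay_ge0.
apply: (@le_trans _ _ (\int[P t0]_(w in C) (m%:R)%:E)%E).
  rewrite integral_cst// PB -EFinM mulrAC -mulrA EFinM.
  by rewrite lee_wpmul2l.
apply: ge0_le_integral => //; first exact: measurable_funTS.
move=> w; rewrite /C /not_before /= /detection_delay.
case: (tau w) => [j /= tj|_]; last by rewrite /= maxye leey.
rewrite -EFinB -EFin_max lee_fin le_max; apply/orP; left.
by rewrite lerBrDr -natrD ler_nat addnC.
Qed.

End delay_lower_bound.

(** Uses exp z >= z^2 / 4 at z = eps x / 4; the constant is 1024 = 2 * 8 * 4 * 16. *)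
Lemma expR_linear_bound (R : realType) (eps L x : R) :
  0 < eps -> 0 < L -> 1024 / (L * eps ^+ 3) <= x ->
  2 * (x / L) * expR (- (eps * x / 4)) <= eps / 8.
Proof.
move=> e0 L0 xge; have e3 : 0 < L * eps ^+ 3 by rewrite mulr_gt0// exprn_gt0.
have c0 : 0 < 1024 :> R by rewrite ltr0n.
have x0 : 0 < x := lt_le_trans (divr_gt0 c0 e3) xge.
set z := eps * x / 4; have z0 : 0 < z by rewrite divr_gt0// mulr_gt0.
have ez : z ^+ 2 / 4 <= expR z.
  have -> : expR z = expR (z / 2) ^+ 2 by rewrite -expRM_natl; congr expR; field.
  have -> : z ^+ 2 / 4 = (z / 2) ^+ 2 by field.
  have z2 : 0 <= z / 2 by rewrite divr_ge0// ltW.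
  rewrite ler_sqr ?nnegrE ?expR_ge0//.
  by apply: ltW; apply: lt_le_trans (expR_ge1Dx _); rewrite ltrDr.
rewrite expRN ler_pdivrMr ?expR_gt0//.
apply: le_trans (ler_wpM2l _ ez); last by rewrite divr_ge0// ltW.
move: xge; rewrite ler_pdivrMr// => xge.
have -> : 2 * (x / L) = 2 * x / L by rewrite mulrA.
rewrite ler_pdivrMr//.
have -> : eps / 8 * (z ^+ 2 / 4) * L = x * (x * (L * eps ^+ 3) / 512).
  by rewrite /z; field.
rewrite mulrC; apply: ler_wpM2l; first exact: ltW.
lra.
Qed.

(** * Choice of the window and asymptotics *)

Section asymptotics.
Context d (Omega : measurableType d) (R : realType) (K : nat).
Local Notation V := 'cV[R]_K.
Variables (A Q S1 : 'M[R]_K) (m1 : V) (y : nat -> {mfun Omega >-> V}).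
Hypotheses (pQ : posdefmx Q) (pS1 : posdefmx S1).
Local Notation klik := (kalman_lik A Q S1 m1).
Variables (P : nat -> probability Omega R) (Pinf : probability Omega R).
Hypothesis lawP : forall t0, (1 <= t0)%N -> change_law A Q m1 S1 y t0 (P t0).
Hypothesis lawPinf : nochange_law y Pinf.
Variable L : R.
Hypothesis L0 : 0 < L.
Hypothesis llr_cvg : \forall w \ae P 1%N,
  n%:R^-1 * ln (klik (obs_block y 1 n w) / white_lik (obs_block y 1 n w))
    @[n --> \oo] --> L.

(** With u = ln gamma / L the window is (1 - eps / 2) u, truncated; delta = L eps / 4 and eta = eps
    / 4, half of it for large ratios. As (1 + eps / 4) (1 - eps / 2) <= 1 - eps / 4, the change of
    measure costs at most gamma exp (- eps x / 4), where x = ln gamma. *)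
Lemma WADD_asymptotic (eps : R) : 0 < eps -> eps < 1 ->
  \forall gamma \near +oo, forall tau, stopping_time y tau ->
    (gamma%:E <= ARL Pinf tau)%E -> (((1 - eps) * (ln gamma / L))%:E <= WADD y P tau)%E.
Proof.
move=> e0 e1.
have d0 : 0 < L * eps / 4 by rewrite divr_gt0// mulr_gt0.
have k0 : 0 < eps / 8 by rewrite divr_gt0.
have [N _ hN] := large_ratio_small pQ pS1 (leqnn 1) (lawP (leqnn 1)) llr_cvg d0 k0.
near=> gamma => tau st ga.
have g0 : 0 < gamma by near: gamma; exact: nbhs_pinfty_gt.
set x := ln gamma; have gE : gamma = expR x by rewrite lnK.
have xge X : expR X <= gamma -> X <= x by rewrite gE ler_expR.
(* The thresholds let the exponential beat the linear factor, pay for truncating m, and push m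
   beyond N. *)
have x1 : 1024 / (L * eps ^+ 3) <= x.
  by apply: xge; near: gamma; apply: nbhs_pinfty_ge; rewrite num_real.
have x2 : 4 * L / eps <= x.
  by apply: xge; near: gamma; apply: nbhs_pinfty_ge; rewrite num_real.
have x3 : 2 * N.+1%:R * L <= x.
  by apply: xge; near: gamma; apply: nbhs_pinfty_ge; rewrite num_real.
have x0 : 0 < x by apply: lt_le_trans x2; rewrite divr_gt0// mulr_gt0.
set u := x / L; have u0 : 0 < u by rewrite divr_gt0.
have u2 : 4 <= eps * u.
  by rewrite /u mulrA ler_pdivlMr// [eps * x]mulrC -ler_pdivrMr.
have u3 : 2 * N.+1%:R <= u by rewrite /u ler_pdivlMr.
have v0 : 0 <= (1 - eps / 2) * u by rewrite mulr_ge0 ?ltW//; lra.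
set m := Num.truncn ((1 - eps / 2) * u).
have [mle mgt] : m%:R <= (1 - eps / 2) * u /\ (1 - eps / 2) * u < m.+1%:R.
  by have /andP[] := truncn_itv v0.
have Nm : (N < m)%N.
  rewrite -ltnS -(ltr_nat R); apply: le_lt_trans mgt.
  apply: (@le_trans _ _ (2^-1 * u)); first by lra.
  by rewrite ler_wpM2r ?ltW//; lra.
have m0 : (0 < m)%N by exact: leq_ltn_trans Nm.
have cm : expR ((L + L * eps / 4) * m%:R) * (2 * m%:R / gamma) + eps / 8 <= eps / 4.
  have mu : m%:R <= u by apply: (le_trans mle); rewrite ler_piMl ?ltW//; lra.
  have le1 : expR ((L + L * eps / 4) * m%:R) <= gamma * expR (- (eps * x / 4)).
    rewrite gE -expRD ler_expR.
    apply: (@le_trans _ _ ((L + L * eps / 4) * ((1 - eps / 2) * u))).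
      by rewrite ler_wpM2l// addr_ge0 ?ltW.
    have -> : (L + L * eps / 4) * ((1 - eps / 2) * u) = (1 + eps / 4) * (1 - eps / 2) * x.
      by rewrite /u; field; rewrite gt_eqF.
    by nra.
  have := expR_linear_bound e0 L0 x1; rewrite -/u => le2.
  suff : expR ((L + L * eps / 4) * m%:R) * (2 * m%:R / gamma) <=
      2 * u * expR (- (eps * x / 4)) by lra.
  apply: (@le_trans _ _ (gamma * expR (- (eps * x / 4)) * (2 * m%:R / gamma))).
    by apply: ler_wpM2r => //; apply: divr_ge0; [rewrite mulr_ge0|exact: ltW].
  have -> : gamma * expR (- (eps * x / 4)) * (2 * m%:R / gamma) =
      2 * m%:R * expR (- (eps * x / 4)) by field; rewrite gt_eqF.
  by apply: ler_wpM2r; [exact: expR_ge0|apply: ler_wpM2l].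
have eta1 : eps / 4 < 1 by lra.
have := WADD_ge pQ pS1 lawP lawPinf st m0 g0 (expR_ge0 _) eta1 cm (hN _ (ltnW Nm)) ga.
apply: le_trans; rewrite lee_fin -/u; move: mgt; rewrite -[m.+1%:R]natr1 => mgt.
apply: (@le_trans _ _ (((1 - eps / 2) * u - 1) * (1 - eps / 4))); first by nra.
apply: ler_wpM2r; [by rewrite subr_ge0 ltW|by rewrite lerBlDr; exact: ltW].
Unshelve. all: by end_near. Qed.

Lemma WADD_inf_asymptotic : exists2 o : R -> R, o gamma @[gamma --> +oo] --> (0 : R) &
  \forall gamma \near +oo,
    ((ln gamma / L * (1 + o gamma))%:E <=
     ereal_inf [set WADD y P tau | tau in
       [set tau | stopping_time y tau /\ (gamma%:E <= ARL Pinf tau)%E]])%E.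
Proof.
pose I (gamma : R) := ereal_inf [set WADD y P tau | tau in
  [set tau | stopping_time y tau /\ (gamma%:E <= ARL Pinf tau)%E]].
have I_ge eps : 0 < eps -> eps < 1 -> \forall gamma \near +oo,
    (((1 - eps) * (ln gamma / L))%:E <= I gamma)%E.
  move=> e0 e1; have := WADD_asymptotic e0 e1; apply: filterS => gamma h.
  by apply: le_ereal_inf_tmp => _ [tau [st ga] <-]; exact: h.
have ln_pos : \forall gamma \near +oo, 0 < ln gamma :> R.
  by near=> gamma; rewrite ln_gt0//; near: gamma; exact: nbhs_pinfty_gt.
(* The exact relative error, cut off at 0 because only a lower bound is claimed; an infinite infimum
   gets no correction. *)
exists (fun gamma => if I gamma == +oo%E then 0 else
    Num.min 0 (fine (I gamma) * L / ln gamma - 1)).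
  apply/cvgrPdist_le => e e0; set eps := Num.min e 2^-1.
  have eps0 : 0 < eps by rewrite lt_min e0 invr_gt0/=.
  have eps1 : eps < 1 by rewrite gt_min; apply/orP; right; lra.
  near=> gamma; case: ifPn => [_|Ioo]; first by rewrite subrr normr0 ltW.
  have lg : 0 < ln gamma :> R by near: gamma.
  have : (((1 - eps) * (ln gamma / L))%:E <= I gamma)%E by near: gamma; exact: I_ge.
  case: (I gamma) Ioo => [r| |]//= _; rewrite lee_fin => le.
  have le2 : 1 - eps <= r * L / ln gamma by rewrite ler_pdivlMr// -ler_pdivrMr// -mulrA.
  rewrite sub0r normrN ler0_norm ?ge_min ?lexx// lerNl le_min.
  have : eps <= e by rewrite ge_min lexx.
  lra.
(* The bound with eps = 1/2 excludes the value -oo of the infimum. *)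
have half0 : 0 < 2^-1 :> R by rewrite invr_gt0.
have half1 : 2^-1 < 1 :> R by lra.
have I2 := I_ge _ half0 half1.
near=> gamma; have lg : 0 < ln gamma :> R by near: gamma.
have : (((1 - 2^-1) * (ln gamma / L))%:E <= I gamma)%E by near: gamma.
rewrite -/(I gamma); case: (I gamma) => [r| |]//= _; last by rewrite leey.
rewrite lee_fin.
apply: (@le_trans _ _ (ln gamma / L * (r * L / ln gamma))).
  apply: ler_wpM2l; first exact: divr_ge0 (ltW lg) (ltW L0).
  by rewrite -lerBrDl ge_min lexx orbT.
rewrite le_eqVlt; apply/orP; left; apply/eqP; field.
by rewrite !gt_eqF.
Unshelve. all: by end_near. Qed.

End asymptotics.

Theorem theorem1 (R : realType) (K : nat) (hK : (1 <= K)%N)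
    (A : 'M[R]_K) (hA : A \in unitmx) (hA1 : operator_norm A < 1)
    (Romega : 'M[R]_K) (hRomega : posdefmx Romega)
    (m1 : 'cV[R]_K) (S1 : 'M[R]_K) (hS1 : posdefmx S1)
    (d : measure_display) (Omega : measurableType d)
    (y : nat -> {mfun Omega >-> 'cV[R]_K})
    (P : nat -> probability Omega R) (Pinf : probability Omega R)
    (hP : forall t0, (1 <= t0)%N -> change_law A Romega m1 S1 y t0 (P t0))
    (hPinf : nochange_law y Pinf)
    (p pinf : forall t0 t : nat, t.-tuple 'cV[R]_K -> R)
    (hp : forall t0 t, (1 <= t0)%N -> (1 <= t)%N ->
      has_density (P t0) (obs_block y t0 t)
        (tuple_measure (lebesgue_cV R K) t) (p t0 t))
    (hpinf : forall t0 t, (1 <= t0)%N -> (1 <= t)%N ->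
      has_density Pinf (obs_block y t0 t)
        (tuple_measure (lebesgue_cV R K) t) (pinf t0 t)) :
  exists Kc : R,
    [/\ 0 < Kc,
        forall t0, (1 <= t0)%N ->
          \forall w \ae (P t0),
            (t%:R^-1 * ln (p t0 t (obs_block y t0 t w) /
                           pinf t0 t (obs_block y t0 t w)))
              @[t --> \oo] --> Kc &
        exists2 o : R -> R, o gamma @[gamma --> +oo] --> (0 : R) &
          \forall gamma \near +oo,
            ((ln gamma / Kc * (1 + o gamma))%:E <=
             ereal_inf [set WADD y P tau | tau in
               [set tau | stopping_time y tau /\
                          (gamma%:E <= ARL Pinf tau)%E]])%E].
Proof.
have [on0 onA] := operator_norm_ge0_le A.
have al0 : 0 <= operator_norm A ^+ 2 by rewrite sqr_ge0.
have al1 : operator_norm A ^+ 2 < 1 by rewrite expr_lt1.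
have [S [SnS pS iSnS]] := innov_cov_cvg al0 al1 onA hRomega hS1.
have [H [Hsym HE]] := lyapunov_solution al0 al1 onA.
have llr t0 (t1 : (1 <= t0)%N) :=
  llr_ae hK hRomega hS1 hA1 t1 (hP t0 t1) Hsym HE pS SnS iSnS.
set Kc := llr_rate H S (kalman_gain A S) in llr.
have Kc0 : 0 < Kc.
  (* The sign does not depend on the path, so a nonpositive rate would make the almost sure
     statement [llr] fail everywhere. *)
  apply: contrapT => n.
  have : P 1%N setT = 0%E.
    by apply/negligibleP => //; apply: negligibleS (llr 1%N (leqnn 1)) => w _ [/n].
  by rewrite probability_setT => /eqP; rewrite onee_eq0.
exists Kc; split => //; last first.
  apply: (WADD_inf_asymptotic hRomega hS1 hP hPinf Kc0).
  by apply: filterS (llr 1%N (leqnn 1)) => w [].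
move=> t0 t1.
(* [p] and [pinf] are arbitrary versions of the densities; almost surely they agree with the
   explicit ones for all positive block lengths, which determine the limit. *)
have eqp : \forall w \ae P t0, forall t, p t0 t.+1 (obs_block y t0 t.+1 w) =
    kalman_lik A Romega S1 m1 (obs_block y t0 t.+1 w).
  apply/ae_foralln => t; have k := kalman_density hRomega hS1 t.+1 t1 (hP t0 t1).
  by apply: (has_density_unique _ k (hp t0 t.+1 t1 isT) k); exact: measurable_obs_block.
have eqpinf : \forall w \ae P t0, forall t, pinf t0 t.+1 (obs_block y t0 t.+1 w) =
    white_lik (obs_block y t0 t.+1 w).
  apply/ae_foralln => t; have k := kalman_density hRomega hS1 t.+1 t1 (hP t0 t1).
  apply: (has_density_unique _ k (hpinf t0 t.+1 t1 isT) (white_density t.+1 t1 hPinf)).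
  exact: measurable_obs_block.
apply: filterS3 eqp eqpinf (llr t0 t1) => w ep epinf [_].
apply: cvg_trans; apply: near_eq_cvg; exists 1%N => // -[//|t] _ /=.
by rewrite ep epinf.
Qed.
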